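(* Let $\Sigma$ be a root system on $\mathbb R^d$, and let $P^D$ and $N^D$ be the Poisson kernel of the unit ball $B$ and the Newton kernel of the Dyson Brownian Motion $D_t^\Sigma$ on $\mathfrak a^+$. Let $Y_0\in\overline{\mathfrak a^+}$, $\Sigma'=\{\alpha\in\Sigma:\alpha(Y_0)=0\}$, $\Sigma'_+=\Sigma'\cap\Sigma^+$, $\gamma'=|\Sigma'_+|$, $\pi'(X)=\prod_{\alpha\in\Sigma'_+}\langle\alpha,X\rangle$ and $\rho'=\sum_{\alpha\in\Sigma'_+}\alpha$. (i) If $Y_0\in\partial B$, then as $X\to Y_0$ $$\frac{P^{D}(X,Y_0)}{\pi'(Y_0)^2}\sim\frac{2^{2\gamma'}(d/2)_{\gamma'}}{w_d\,\pi'(\rho')}\,\frac{1-|X|^2}{|X-Y_0|^{2\gamma'+d}}.$$ (ii) If $d=2$, $\alpha,\beta$ are the simple roots, $\alpha(Y_0)\ne0$ and $\beta(Y_0)=0$, then as $X\to Y_0$ $$\frac{N^{D}(X,Y_0)}{\pi'(Y_0)^2}\sim\frac{-2^{2\gamma'-1}(\gamma'-1)!}{2\pi\,\langle\beta,\beta\rangle}\,|X-Y_0|^{-2}.$$ (iii) If $d\ge3$, then as $X\to Y_0$ $$\frac{N^{D}(X,Y_0)}{\pi'(Y_0)^2}\sim\frac{2^{2\gamma'}((d-2)/2)_{\gamma'}}{(2-d)\,w_d\,\pi'(\rho')}\,\frac{1}{|X-Y_0|^{2\gamma'+d-2}}.$$ Here $f\sim g$ as $X\to Y_0$ means $f(X)/g(X)\to1$,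 and, when $Y_0$ is singular, the quotients on the left are understood as the limits as $Y\to Y_0$ of $P^D(X,Y)/\pi'(Y)^2$ and $N^D(X,Y)/\pi'(Y)^2$.
   Context: $\Sigma$ is a root system on Euclidean $\mathbb R^d$, with positive roots $\Sigma^+$, Weyl group $W$, $\epsilon(w)=\det w$, positive Weyl chamber $\mathfrak a^+=\{X:\langle\alpha,X\rangle>0\ \forall\alpha\in\Sigma^+\}$; $\alpha(X)=\langle\alpha,X\rangle$; $\pi(X)=\prod_{\alpha\in\Sigma^+}\langle\alpha,X\rangle$ (in the factor $2\pi$, $\pi$ is the number); empty products equal $1$. $w_d=2\pi^{d/2}/\Gamma(d/2)$; $(a)_n=a(a+1)\cdots(a+n-1)$, $(a)_0=1$. The Dyson Brownian Motion $D_t^\Sigma$ on $\mathfrak a^+$ is the Doob $h$-transform with $h=\pi$ of Brownian motion on $\mathbb R^d$ (generator $\Delta^{\mathbb R^d}$) killed at $\partial\mathfrak a^+$; its generator is $\Delta^Df=\pi^{-1}\Delta^{\mathbb R^d}(\pi f)$ on $\mathfrak a^+$. Its Poisson kernel of the unit ball (density of the exit position from $B=B(0,1)$ with respect to surface measure) and Newton kernel (fundamental solution of $\Delta^D$ with respect to $dY$, vanishing at infinity) are, for $X,Y\in\overline{\mathfrak a^+}$, $$P^{D}(X,Y)=\frac{(1-|X|^2)\pi(Y)}{w_d\,\pi(X)}\sum_{w\in W}\frac{\epsilon(w)}{|X-w\cdot Y|^d}\quad(|X|<1,\ |Y|=1),$$ $$N^{D}(X,Y)=\frac{\pi(Y)}{2\pi\,\pi(X)}\sum_{w\in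 W}\epsilon(w)\ln|X-w\cdot Y|\ (d=2),\qquad N^{D}(X,Y)=\frac{\pi(Y)}{(2-d)w_d\,\pi(X)}\sum_{w\in W}\frac{\epsilon(w)}{|X-w\cdot Y|^{d-2}}\ (d\ge3).$$ These are $\pi(Y)^2$ times functions that extend continuously to all singular $X,Y$ with $X\ne Y$, which gives meaning to ratios such as $P^D(X,Y)/\pi'(Y)^2$ at singular $Y$. In the limits $X\to Y_0$, $X\in\overline{\mathfrak a^+}$ (and $|X|<1$ in (i)). *)

(* Defs.v *)
From HB Require Import structures.
From mathcomp Require Import all_boot all_order all_algebra.
From mathcomp Require Import finmap.
From mathcomp Require Import all_classical all_reals all_analysis.

Set Implicit Arguments.
Unset Strict Implicit.
Unset Printing Implicit Defensive.

Import Order.TTheory GRing.Theory Num.Theory.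
Import numFieldNormedType.Exports.

Local Open Scope classical_set_scope.
Local Open Scope ring_scope.

(* Pitfall: the library's norm `|X| on matrices is the sup norm, so the
   Euclidean structure of R^d is given by edot and enorm; the topology of
   'cV[R]_d is the usual one. *)
Definition edot (R : realType) (d : nat) (X Y : 'cV[R]_d) : R :=
  \sum_(i < d) X i 0 * Y i 0.

Definition enorm (R : realType) (d : nat) (X : 'cV[R]_d) : R :=
  Num.sqrt (edot X X).

Definition reflection_mx (R : realType) (d : nat) (a : 'cV[R]_d) : 'M[R]_d :=
  1%:M - (2 / edot a a) *: (a *m a^T).

(* Reduced, so that root_prod below is harmonic, and crystallographic, but not required to span R^d, so that for
   instance A_(d-1) in R^d is allowed. *)
Definition root_system (R : realType) (d : nat) (S : {fset 'cV[R]_d}) : Prop :=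
  [/\ forall a, a \in S -> a != 0,
      forall a (c : R), a \in S -> c *: a \in S <-> (c = 1 \/ c = -1),
      forall a b, a \in S -> b \in S -> reflection_mx a *m b \in S &
      forall a b, a \in S -> b \in S ->
        exists z : int, 2 * edot a b / edot a a = z%:~R].

Definition positive_roots (R : realType) (d : nat) (S Sp : {fset 'cV[R]_d}) :
    Prop :=
  exists v : 'cV[R]_d,
    (forall a, a \in S -> edot a v != 0) /\
    (forall a, a \in Sp <-> (a \in S) && (0 < edot a v)).

Definition simple_root (R : realType) (d : nat) (Sp : {fset 'cV[R]_d})
    (a : 'cV[R]_d) : Prop :=
  a \in Sp /\ forall b c, b \in Sp -> c \in Sp -> a <> b + c.

Definition weyl_group (R : realType) (d : nat) (S : {fset 'cV[R]_d}) :
    set 'M[R]_d :=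
  [set w | exists2 s : seq 'cV[R]_d, {subset s <= S} &
     w = \big[mulmx/1%:M]_(a <- s) reflection_mx a].

Definition chamber (R : realType) (d : nat) (Sp : {fset 'cV[R]_d}) :
    set 'cV[R]_d :=
  [set X | forall a, a \in Sp -> 0 < edot a X].

Definition root_prod (R : realType) (d : nat) (Sp : {fset 'cV[R]_d})
    (X : 'cV[R]_d) : R :=
  \prod_(a <- Sp) edot a X.

Definition root_sum (R : realType) (d : nat) (Sp : {fset 'cV[R]_d}) :
    'cV[R]_d :=
  \sum_(a <- Sp) a.

Definition roots_at (R : realType) (d : nat) (Sp : {fset 'cV[R]_d})
    (Y0 : 'cV[R]_d) : {fset 'cV[R]_d} :=
  [fset a in Sp | edot a Y0 == 0]%fset.

Definition euler_Gamma (R : realType) (s : R) : R :=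
  \int[lebesgue_measure]_(x in `]0, +oo[) (x `^ (s - 1) * expR (- x)).

Definition sphere_area (R : realType) (d : nat) : R :=
  2 * pi `^ (d%:R / 2) / euler_Gamma (d%:R / 2).

Definition pochhammer (R : realType) (a : R) (n : nat) : R :=
  \prod_(i < n) (a + i%:R).

(* Method of images (alternating sum over the Weyl group) applied to the
   Euclidean Poisson and Newton kernels, followed by the Doob transform by
   root_prod Sp, i.e. multiplication by root_prod Sp Y / root_prod Sp X.
   The formulas are meaningful for X and Y in the open chamber; the
   values at singular points are obtained by passing to the limit, see
   PD_quotient and ND_quotient. *)
Definition PD (R : realType) (d : nat) (S Sp : {fset 'cV[R]_d})
    (X Y : 'cV[R]_d) : R :=
  (1 - enorm X ^+ 2) * root_prod Sp Y / (sphere_area R d * root_prod Sp X) *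
  \sum_(w \in weyl_group S) (\det w / enorm (X - w *m Y) ^+ d).

(* Relevant for d >= 2 only. *)
Definition ND (R : realType) (d : nat) (S Sp : {fset 'cV[R]_d})
    (X Y : 'cV[R]_d) : R :=
  if d == 2%N then
    root_prod Sp Y / (2 * pi * root_prod Sp X) *
    \sum_(w \in weyl_group S) (\det w * ln (enorm (X - w *m Y)))
  else
    root_prod Sp Y / ((2 - d%:R) * sphere_area R d * root_prod Sp X) *
    \sum_(w \in weyl_group S) (\det w / enorm (X - w *m Y) ^+ (d - 2)).

(* PD_quotient S Sp Y0 q says that q X is the value of P^D(X,Y0) / pi'(Y0)^2
   for every X in the closed chamber with |X| < 1: the limit, through points of
   the open chamber, of the quotient at (X',Y) -> (X,Y0). If (X,Y0) is itself
   regular it lies in the domain of the limit, so q X is the plain quotient. *)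
Definition PD_quotient (R : realType) (d : nat) (S Sp : {fset 'cV[R]_d})
    (Y0 : 'cV[R]_d) (q : 'cV[R]_d -> R) : Prop :=
  forall X, closure (chamber Sp) X -> enorm X < 1 ->
    (fun p : 'cV[R]_d * 'cV[R]_d =>
       PD S Sp p.1 p.2 / root_prod (roots_at Sp Y0) p.2 ^+ 2)
      @ within [set p | [/\ chamber Sp p.1, enorm p.1 < 1,
                            chamber Sp p.2 & enorm p.2 = 1]]
               (nbhs (X, Y0))
      --> q X.

Definition ND_quotient (R : realType) (d : nat) (S Sp : {fset 'cV[R]_d})
    (Y0 : 'cV[R]_d) (q : 'cV[R]_d -> R) : Prop :=
  forall X, closure (chamber Sp) X -> X <> Y0 ->
    (fun p : 'cV[R]_d * 'cV[R]_d =>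
       ND S Sp p.1 p.2 / root_prod (roots_at Sp Y0) p.2 ^+ 2)
      @ within [set p | [/\ chamber Sp p.1, chamber Sp p.2 & p.1 <> p.2]]
               (nbhs (X, Y0))
      --> q X.

Definition asymp_equiv (R : realType) (d : nat) (A : set 'cV[R]_d)
    (Y0 : 'cV[R]_d) (f g : 'cV[R]_d -> R) : Prop :=
  (fun X => f X / g X) @ within A (nbhs Y0) --> (1 : R).

(* Main.v *)
Require Import Defs.
From HB Require Import structures.
From mathcomp Require Import all_boot all_order all_algebra.
From mathcomp Require Import finmap.
From mathcomp Require Import all_classical all_reals all_analysis.
From mathcomp Require Import measurable_realfun ring lra zify.

(** Both kernels are alternating sums over the Weyl group W of a radial kernel
    [phi (|X - wY|^2)], multiplied by [pi(Y) / pi(X)], where [phi(r)] is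
    [r^(-d/2)], [r^(-(d-2)/2)] or [ln (sqrt r)].

    Extension to singular points. Put [A = |X|^2 + |Y|^2 + 2M], so that
    [|X - wY|^2 = A (1 - 2 (<X, wY> + M) / A)], with [M] large enough for
    [<X, wY> + M] to be nonnegative. As [<X, wY> <= <X, Y>] on the closed
    chamber ([weyl_dominant_le]), the expansion of [phi] in powers of the ratio
    converges geometrically as long as [X <> Y]. The alternating sum of the
    powers [(<X, wY> + M)^n] vanishes on all the root hyperplanes of [X] and of
    [Y], hence is divisible by [pi(X) pi(Y)]. Dividing by a linear form is
    taking a divided difference along the projection onto its kernel; iterated,
    this gives a continuous quotient bounded by a polynomial in [n] times the
    [n]-th power of the largest value of [<X, wY> + M] ([alt_pow_division]).
    Summing over [n] gives a continuous extension of the kernel divided by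
    [pi(X) pi(Y)] ([alt_kernel_division]).

    Asymptotics at [Y0]. Split W into the stabilizer W' of [Y0] and its
    complement. The complement is stable under multiplication by the
    reflections that fix [Y0] and its terms are not singular at [(Y0, Y0)], so
    the same division shows that its part is [pi'(X) pi'(Y)] times a bounded
    function. For W', expand about [Y0] along [Y = Y0 + t v]: the sums
    [sum_(w in W') det w <X - Y0, wv>^n] vanish for [n < gamma'] and equal
    [gamma'! 2^gamma' / pi'(rho') * pi'(X) pi'(v)] for [n = gamma']
    ([weyl_pow_low]), so only the Taylor coefficient of order [gamma'] of [phi]
    remains when [t] tends to [0] ([stab_limit]). It dominates the bounded part
    because it is a negative power of [|X - Y0|] ([ratio_limit]). Regular [X]
    are treated first, and continuity gives all the [X] of the closed chamber.

    The constant comes from the lowest-degree part of Weyl's denominator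
    formula ([weyl_denominator_pow]), applied to W'. Two facts about reflection
    groups support it: W acts freely on its chambers ([weyl_free]) and the
    stabilizer of a point is generated by the reflections that fix it
    ([weyl_stabilizer]). Finally the area of the sphere is not zero, since
    Euler's integral for Gamma converges to a positive number
    ([euler_Gamma_gt0]). *)

Set Implicit Arguments.
Unset Strict Implicit.
Unset Printing Implicit Defensive.

Import Order.TTheory GRing.Theory Num.Theory.
Import numFieldNormedType.Exports.

Local Open Scope classical_set_scope.
Local Open Scope ring_scope.


(** * The Euclidean inner product, orthogonal matrices and reflections *)

Section Euclidean.
Variables (R : realType) (d : nat).
Implicit Types (X Y Z a b : 'cV[R]_d) (w : 'M[R]_d) (c : R).

Lemma edotC X Y : edot X Y = edot Y X.
Proof. by apply: eq_bigr => i _; rewrite mulrC. Qed.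

Lemma edotDl X Y Z : edot (X + Y) Z = edot X Z + edot Y Z.
Proof. by rewrite -big_split; apply: eq_bigr => i _; rewrite mxE mulrDl. Qed.

Lemma edotZl c X Y : edot (c *: X) Y = c * edot X Y.
Proof. by rewrite mulr_sumr; apply: eq_bigr => i _; rewrite mxE mulrA. Qed.

Lemma edotDr X Y Z : edot X (Y + Z) = edot X Y + edot X Z.
Proof. by rewrite !(edotC X) edotDl. Qed.

Lemma edotZr c X Y : edot X (c *: Y) = c * edot X Y.
Proof. by rewrite !(edotC X) edotZl. Qed.

Lemma edotNl X Y : edot (- X) Y = - edot X Y.
Proof. by rewrite -scaleN1r edotZl mulN1r. Qed.

Lemma edotNr X Y : edot X (- Y) = - edot X Y.
Proof. by rewrite !(edotC X) edotNl. Qed.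

Lemma edotBl X Y Z : edot (X - Y) Z = edot X Z - edot Y Z.
Proof. by rewrite edotDl edotNl. Qed.

Lemma edotBr X Y Z : edot X (Y - Z) = edot X Y - edot X Z.
Proof. by rewrite edotDr edotNr. Qed.

Lemma edot0l X : edot 0 X = 0.
Proof. by rewrite -(scale0r 0) edotZl mul0r. Qed.

Lemma edot0r X : edot X 0 = 0.
Proof. by rewrite edotC edot0l. Qed.

Lemma edot_suml (I : Type) (r : seq I) (P : pred I) (F : I -> 'cV[R]_d) Y :
  edot (\sum_(i <- r | P i) F i) Y = \sum_(i <- r | P i) edot (F i) Y.
Proof.
by elim/big_rec2 : _ => [|i y1 y2 _ <-]; rewrite ?edot0l// edotDl.
Qed.

Lemma edot_sumr (I : Type) (r : seq I) (P : pred I) (F : I -> 'cV[R]_d) Y :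
  edot Y (\sum_(i <- r | P i) F i) = \sum_(i <- r | P i) edot Y (F i).
Proof. by rewrite edotC edot_suml; apply: eq_bigr => i _; rewrite edotC. Qed.

Lemma edot_ge0 X : 0 <= edot X X.
Proof. by apply: sumr_ge0 => i _; rewrite -expr2 sqr_ge0. Qed.

Lemma edot_eq0 X : (edot X X == 0) = (X == 0).
Proof.
apply/eqP/eqP => [H|->]; last by rewrite edot0l.
apply/matrixP => i j; rewrite ord1 mxE; apply/eqP.
have /psumr_eq0P H1 : forall i : 'I_d, true -> 0 <= X i 0 * X i 0.
  by move=> k _; rewrite -expr2 sqr_ge0.
by have /eqP := H1 H i isT; rewrite mulf_eq0 orbb.
Qed.

Lemma edot_gt0 X : (0 < edot X X) = (X != 0).
Proof. by rewrite lt_neqAle edot_ge0 andbT eq_sym edot_eq0. Qed.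

Lemma edot_mx w X Y : edot X (w *m Y) = edot (w^T *m X) Y.
Proof.
have E A B : edot A B = (A^T *m B) 0 0.
  by rewrite mxE; apply: eq_bigr => i _; rewrite mxE.
by rewrite !E trmx_mul trmxK mulmxA.
Qed.

Lemma edot_sq X Y : edot (X - Y) (X - Y) = edot X X + edot Y Y - 2 * edot X Y.
Proof. by rewrite edotBl !edotBr (edotC Y X); ring. Qed.

Lemma enorm_ge0 X : 0 <= enorm X.
Proof. exact: sqrtr_ge0. Qed.

Lemma enorm_sq X : enorm X ^+ 2 = edot X X.
Proof. by rewrite sqr_sqrtr // edot_ge0. Qed.

Lemma enorm_eq0 X : (enorm X == 0) = (X == 0).
Proof. by rewrite -sqrf_eq0 enorm_sq edot_eq0. Qed.

Lemma cauchy_schwarz X Y : `|edot X Y| <= enorm X * enorm Y.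
Proof.
rewrite -(@ler_pXn2r _ 2) ?nnegrE ?normr_ge0 ?mulr_ge0 ?enorm_ge0 //.
rewrite real_normK ?num_real // exprMn !enorm_sq.
have [->|Y0] := eqVneq Y 0; first by rewrite !edot0r mulr0 expr0n.
have Y1 : 0 < edot Y Y by rewrite edot_gt0.
have := edot_ge0 (edot Y Y *: X - edot X Y *: Y).
rewrite edot_sq !edotZl !edotZr => H.
(* The square of the norm of [<Y, Y> X - <X, Y> Y] is nonnegative. *)
rewrite -(ler_pM2l Y1); nra.
Qed.

(** Orthogonal matrices. *)
Definition orth_mx w := w^T *m w = 1%:M.

Lemma orth_mxC w : orth_mx w -> w *m w^T = 1%:M.
Proof. exact: mulmx1C. Qed.

Lemma orth_mxM w1 w2 : orth_mx w1 -> orth_mx w2 -> orth_mx (w1 *m w2).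
Proof.
by move=> h1 h2; rewrite /orth_mx trmx_mul -mulmxA (mulmxA _ w1) h1 mul1mx h2.
Qed.

Lemma edot_ortho w X Y : orth_mx w -> edot (w *m X) (w *m Y) = edot X Y.
Proof. by move=> h; rewrite edot_mx mulmxA h mul1mx. Qed.

Lemma enorm_ortho w X : orth_mx w -> enorm (w *m X) = enorm X.
Proof. by move=> h; rewrite /enorm edot_ortho. Qed.

Lemma refl_mxE a X :
  reflection_mx a *m X = X - (2 * edot a X / edot a a) *: a.
Proof.
rewrite mulmxBl mul1mx -scalemxAl -mulmxA; congr (_ - _).
have -> : a^T *m X = (edot a X)%:M.
  apply/matrixP => i j; rewrite !ord1 !mxE /= mulr1n.
  by apply: eq_bigr => k _; rewrite mxE.
by rewrite mul_mx_scalar scalerA; congr (_ *: _); ring.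
Qed.

Lemma refl_mxT a : (reflection_mx a)^T = reflection_mx a.
Proof. by rewrite linearB /= trmx1 linearZ /= trmx_mul trmxK. Qed.

Lemma refl_mxN a : reflection_mx (- a) = reflection_mx a.
Proof. by rewrite /reflection_mx edotNl edotNr opprK linearN /= mulmxN mulNmx opprK. Qed.

Lemma mulmx_eq (w1 w2 : 'M[R]_d) : (forall X, w1 *m X = w2 *m X) -> w1 = w2.
Proof.
move=> h; apply/matrixP => i j.
have := h (delta_mx j 0); rewrite -!colE => /matrixP /(_ i 0).
by rewrite !mxE.
Qed.

Lemma refl_mx_self a : a != 0 -> reflection_mx a *m a = - a.
Proof.
rewrite -edot_eq0 => a0; rewrite refl_mxE mulfK // scaler_nat mulr2n.
by rewrite opprD addrA subrr sub0r.
Qed.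

Lemma refl_mxK a : a != 0 -> reflection_mx a *m reflection_mx a = 1%:M.
Proof.
move=> a0; apply: mulmx_eq => X; rewrite -mulmxA mul1mx [X in _ *m X]refl_mxE.
by rewrite mulmxBr -scalemxAr refl_mx_self // refl_mxE scalerN opprK subrK.
Qed.

Lemma refl_ortho a : a != 0 -> orth_mx (reflection_mx a).
Proof. by move=> a0; rewrite /orth_mx refl_mxT refl_mxK. Qed.

Lemma refl_mx_conj w a : orth_mx w ->
  reflection_mx (w *m a) = w *m reflection_mx a *m w^T.
Proof.
move=> h; rewrite /reflection_mx edot_ortho // mulmxBr mulmxBl mulmx1.
by rewrite orth_mxC // -scalemxAr -scalemxAl trmx_mul !mulmxA.
Qed.

(** The block matrix with rows [1, a^T] and [c a, 1] is block triangularized in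
    two ways. *)
Lemma det_refl a : a != 0 -> \det (reflection_mx a) = -1.
Proof.
move=> a0.
pose c := 2 / edot a a.
pose M1 := block_mx (1%:M : 'M[R]_1) a^T (c *: a) (1%:M : 'M[R]_d).
have E1 : M1 = block_mx 1%:M 0 (c *: a) 1%:M *m
               block_mx 1%:M a^T 0 (reflection_mx a).
  rewrite mulmx_block ?mul1mx ?mul0mx ?mulmx1 ?mulmx0 ?addr0.
  by rewrite -scalemxAl /reflection_mx addrC subrK.
have E2 : M1 = block_mx (1%:M - c *: (a^T *m a)) a^T 0 1%:M *m
               block_mx 1%:M 0 (c *: a) 1%:M.
  rewrite mulmx_block ?mulmx1 ?mul0mx ?mulmx0 ?mul1mx ?add0r ?addr0.
  by rewrite -scalemxAr subrK.
have := congr1 determinant E1; rewrite E2 !det_mulmx !det_lblock !det_ublock.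
rewrite !det1 !mul1r !mulr1 => <-.
rewrite det_mx11 !mxE /= mulr1n.
have -> : \sum_j a^T 0 j * a j 0 = edot a a.
  by apply: eq_bigr => k _; rewrite mxE.
rewrite divfK ?edot_eq0 //; ring.
Qed.

(** The product of the reflections in the successive vectors of a list. *)
Definition wprod (s : seq 'cV[R]_d) : 'M[R]_d :=
  \big[mulmx/1%:M]_(a <- s) reflection_mx a.

Lemma wprod_nil : wprod [::] = 1%:M.
Proof. by rewrite /wprod big_nil. Qed.

Lemma wprod_cons a s : wprod (a :: s) = reflection_mx a *m wprod s.
Proof. by rewrite /wprod big_cons. Qed.

Lemma wprod_cat s t : wprod (s ++ t) = wprod s *m wprod t.
Proof.
elim: s => [|a s IH]; first by rewrite wprod_nil mul1mx.
by rewrite cat_cons !wprod_cons IH mulmxA.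
Qed.

Lemma wprod_seq1 a : wprod [:: a] = reflection_mx a.
Proof. by rewrite wprod_cons wprod_nil mulmx1. Qed.

Lemma wprod_rev s : wprod (rev s) = (wprod s)^T.
Proof.
elim: s => [|a s IH]; first by rewrite wprod_nil trmx1.
by rewrite rev_cons -cats1 wprod_cat wprod_seq1 wprod_cons trmx_mul refl_mxT IH.
Qed.

End Euclidean.

(** * Simple roots and the Weyl group *)

Section Cone.
Variables (R : realType) (d : nat).
Implicit Types (L : seq 'cV[R]_d) (x a : 'cV[R]_d).

(** The convex cone spanned by a finite list of vectors. *)
Definition in_cone L x := exists2 c : 'cV[R]_d -> R,
  (forall a, 0 <= c a) & x = \sum_(a <- L) c a *: a.

Lemma in_cone0 L : in_cone L 0.
Proof.
exists (fun=> 0) => // ; rewrite big1 // => a _; exact: scale0r.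
Qed.

Lemma in_coneD L x y : in_cone L x -> in_cone L y -> in_cone L (x + y).
Proof.
move=> [c c0 ->] [e e0 ->]; exists (fun a => c a + e a) => [a|].
  exact: addr_ge0.
by rewrite -big_split; apply: eq_bigr => a _; rewrite scalerDl.
Qed.

Lemma in_coneZ L k x : 0 <= k -> in_cone L x -> in_cone L (k *: x).
Proof.
move=> k0 [c c0 ->]; exists (fun a => k * c a) => [a|]; first exact: mulr_ge0.
by rewrite scaler_sumr; apply: eq_bigr => a _; rewrite scalerA.
Qed.

Lemma mem_in_cone L x : uniq L -> x \in L -> in_cone L x.
Proof.
move=> uL xL; exists (fun a => (a == x)%:R) => [a|]; first exact: ler0n.
rewrite (bigD1_seq x) //= eqxx scale1r big1 ?addr0 // => a /negPf ->.
exact: scale0r.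
Qed.

Lemma in_cone_sub L L' x : (forall a, a \in L -> in_cone L' a) ->
  in_cone L x -> in_cone L' x.
Proof.
move=> H [c c0 ->].
elim: L H => [|a L IH] H; first by rewrite big_nil; apply: in_cone0.
rewrite big_cons; apply: in_coneD.
  by apply: in_coneZ => //; apply: H; rewrite mem_head.
by apply: IH => b bL; apply: H; rewrite inE bL orbT.
Qed.

(** A finite set of generators of a cone contains an irredundant one. *)
Lemma irredundant_generators L : uniq L -> exists D,
  [/\ uniq D, {subset D <= L}, forall x, x \in L -> in_cone D x &
      forall a, a \in D -> ~ in_cone (rem a D) a].
Proof.
move=> uL.
suff H n D : (size D <= n)%N -> uniq D -> {subset D <= L} ->
    (forall x, x \in L -> in_cone D x) ->
    exists D', [/\ uniq D', {subset D' <= L}, forall x, x \in L -> in_cone D' x &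
      forall a, a \in D' -> ~ in_cone (rem a D') a].
  by apply: (H (size L) L) => // x; apply: mem_in_cone.
elim: n D => [|n IH] D sD uD DL Dg.
  by exists D; split => // a; move: sD; rewrite leqn0 => /nilP ->.
have [[a [aD Da]]|N] := pselect (exists a, a \in D /\ in_cone (rem a D) a).
  apply: (IH (rem a D)) => //.
  - by rewrite size_rem // -ltnS prednK //; case: (D) aD.
  - exact: rem_uniq.
  - by move=> x /mem_rem; apply: DL.
  - move=> x /Dg; apply: in_cone_sub => b bD.
    have [->//|ba] := eqVneq b a.
    by apply: mem_in_cone; [exact: rem_uniq|rewrite mem_rem_uniq // !inE ba].
by exists D; split => // a aD Da; apply: N; exists a.
Qed.

End Cone.

(** In this section [v] is a regular vector and [Sp] is the set of the roots
    that are positive on it. *)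
Section RootSystem.
Variables (R : realType) (d : nat) (S Sp : {fset 'cV[R]_d}) (v : 'cV[R]_d).
Hypothesis hS : root_system S.
Hypothesis hv : forall a, a \in S -> edot a v != 0.
Hypothesis hSp : forall a, a \in Sp <-> (a \in S) && (0 < edot a v).
Implicit Types (a b x X Y : 'cV[R]_d) (w : 'M[R]_d) (s : seq 'cV[R]_d).

Lemma root_neq0 a : a \in S -> a != 0. Proof. by case: hS => + _ _ _; apply. Qed.

Lemma root_refl a b : a \in S -> b \in S -> reflection_mx a *m b \in S.
Proof. by case: hS => _ _ + _; apply. Qed.

Lemma rootN a : a \in S -> - a \in S.
Proof.
by move=> aS; rewrite -scaleN1r; case: hS => _ /(_ a (-1) aS) [_ +] _ _; apply; right.
Qed.

Lemma pos_root a : a \in Sp -> a \in S.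
Proof. by move=> /hSp /andP[]. Qed.

Lemma pos_height a : a \in Sp -> 0 < edot a v.
Proof. by move=> /hSp /andP[]. Qed.

Lemma pos_or_neg a : a \in S -> a \in Sp \/ - a \in Sp.
Proof.
move=> aS; have := hv aS; rewrite neq_lt => /orP[h|h]; [right|left].
  by apply/hSp; rewrite rootN //= edotNl oppr_gt0.
by apply/hSp; rewrite aS.
Qed.

Lemma pos_notN a : a \in Sp -> - a \notin Sp.
Proof.
move=> /pos_height h; apply/negP => /pos_height.
by rewrite edotNl oppr_gt0 ltNge ltW.
Qed.

Lemma weylM w1 w2 : weyl_group S w1 -> weyl_group S w2 ->
  weyl_group S (w1 *m w2).
Proof.
move=> [s1 h1 ->] [s2 h2 ->]; exists (s1 ++ s2).
  by move=> x; rewrite mem_cat => /orP[/h1|/h2].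
by rewrite -[LHS]/(wprod s1 *m wprod s2) -wprod_cat.
Qed.

Lemma weylT w : weyl_group S w -> weyl_group S w^T.
Proof.
move=> [s h ->]; exists (rev s); first by move=> x; rewrite mem_rev => /h.
by rewrite -[LHS]/((wprod s)^T) -wprod_rev.
Qed.

Lemma weyl1 : weyl_group S 1%:M.
Proof. by exists [::] => //; rewrite big_nil. Qed.

Lemma weyl_refl a : a \in S -> weyl_group S (reflection_mx a).
Proof.
move=> aS; exists [:: a]; first by move=> x; rewrite inE => /eqP ->.
by rewrite -[RHS]/(wprod _) wprod_seq1.
Qed.

Lemma weyl_ind (P : 'M[R]_d -> Prop) : P 1%:M ->
  (forall a w, a \in S -> weyl_group S w -> P w -> P (reflection_mx a *m w)) ->
  forall w, weyl_group S w -> P w.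
Proof.
move=> P1 PM w [s hs ->]; elim: s hs => [|a s IH] hs; first by rewrite big_nil.
have hs' : {subset s <= S} by move=> x xs; apply: hs; rewrite inE xs orbT.
rewrite big_cons; apply: PM; [by apply: hs; rewrite mem_head | by exists s|].
exact: IH.
Qed.

Lemma weyl_ortho w : weyl_group S w -> orth_mx w.
Proof.
move: w; apply: weyl_ind => [|a w aS _ ow]; first by rewrite /orth_mx trmx1 mul1mx.
by apply: orth_mxM => //; apply: refl_ortho; apply: root_neq0.
Qed.

Lemma weyl_root w a : weyl_group S w -> a \in S -> w *m a \in S.
Proof.
move=> ww aS; elim/weyl_ind: w / ww => [|b w bS _ IH]; first by rewrite mul1mx.
by rewrite -mulmxA root_refl.
Qed.

Lemma refl_root_inj a x y : a \in S ->
  reflection_mx a *m x = reflection_mx a *m y -> x = y.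
Proof.
move=> /root_neq0 a0 /(congr1 (mulmx (reflection_mx a))).
by rewrite !mulmxA refl_mxK // !mul1mx.
Qed.

(** Simple roots, taken as an irredundant set of generators [D] of the cone of
    the positive roots. If the reflection in [a] of a positive [b <> a] were
    negative, then the sum of [b] and of the opposite of this reflection, which
    is a multiple of [a], would express [a] by the other generators. *)
Lemma simple_system_exists : exists D, 
  [/\ uniq D, {subset D <= Sp}, forall b, b \in Sp -> in_cone D b,
      forall a b, a \in D -> b \in Sp -> b != a -> reflection_mx a *m b \in Sp &
      forall a, a \in D -> a \in S].
Proof.
have [D [uD DS Dg Dm]] := irredundant_generators (fset_uniq Sp).
exists D; split => //; last by move=> a /DS/pos_root.
move=> a b aD bSp ba; have aSp := DS _ aD; have aS := pos_root aSp.
case: (pos_or_neg (root_refl aS (pos_root bSp))) => // nb; exfalso.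
have [c c0 Ec] := Dg _ bSp; have [e e0 Ee] := Dg _ nb.
pose n := 2 * edot a b / edot a a.
have E : \sum_(x <- D) (c x + e x) *: x = n *: a.
  under eq_bigr do rewrite scalerDl.
  by rewrite big_split /= -Ec -Ee refl_mxE opprB addrCA subrr addr0.
have pD : perm_eq D (a :: rem a D) by exact: perm_to_rem.
have {}E : \sum_(x <- rem a D) (c x + e x) *: x = (n - (c a + e a)) *: a.
  rewrite (perm_big _ pD) big_cons /= in E.
  by rewrite scalerBl -E addrC addrK.
have [h|h] := ltP 0 (n - (c a + e a)).
  apply: (Dm _ aD); exists (fun x => (n - (c a + e a))^-1 * (c x + e x)).
    move=> x; apply: mulr_ge0; last exact: addr_ge0.
    by rewrite invr_ge0 ltW.
  under eq_bigr do rewrite -scalerA.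
  by rewrite -scaler_sumr E scalerA mulVf ?scale1r // gt_eqF.
have rS x : x \in rem a D -> 0 < edot x v by move=> /mem_rem/DS/pos_height.
have Z x : x \in rem a D -> c x = 0.
  have /eqP := congr1 (fun y => edot y v) E; rewrite edot_suml edotZl => H.
  have H0 : \sum_(i <- rem a D) edot ((c i + e i) *: i) v <= 0.
    by rewrite (eqP H) mulr_le0_ge0 //; apply/ltW/pos_height.
  have T i : i \in rem a D -> 0 <= edot ((c i + e i) *: i) v.
    by move=> /rS iv; rewrite edotZl mulr_ge0 ?addr_ge0 // ltW.
  move=> xr; apply/eqP.
  have : edot ((c x + e x) *: x) v <= 0.
    apply: le_trans H0; rewrite (perm_big _ (perm_to_rem xr)) big_cons /= lerDl.
    rewrite big_seq; apply: sumr_ge0 => i /mem_rem; exact: T.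
  rewrite edotZl pmulr_lle0 ?rS // => H1.
  by rewrite eq_le c0 andbT (le_trans _ H1) // lerDl.
have Eb : b = c a *: a.
  rewrite Ec (perm_big _ pD) big_cons /= big_seq big1 ?addr0 // => x /Z ->.
  by rewrite scale0r.
have : c a *: a \in S by rewrite -Eb; exact: pos_root.
case: hS => _ /(_ a (c a) aS) [+ _] _ _ => /[apply] -[] ca.
  by rewrite Eb ca scale1r eqxx in ba.
by have := c0 a; rewrite ca lerNr oppr0 ler10.
Qed.

Section SimpleSystem.
Variable D : seq 'cV[R]_d.
Hypothesis DSp : {subset D <= Sp}.
Hypothesis D_cone : forall b, b \in Sp -> in_cone D b.
Hypothesis D_perm : forall a b,
  a \in D -> b \in Sp -> b != a -> reflection_mx a *m b \in Sp.

Let DS a : a \in D -> a \in S. Proof. by move=> /DSp/pos_root. Qed.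

(** Every reflection is a product of simple reflections: a positive root that
    is not simple is made lower by some simple reflection. *)
Lemma refl_simple_word b : b \in Sp ->
  exists2 s, {subset s <= D} & reflection_mx b = wprod s.
Proof.
have [n] := ubnP #|` [fset x in Sp | edot x v < edot b v]%fset|.
elim: n b => // n IH b hn bSp.
have [c c0 Ec] := D_cone bSp.
have [a aD ab] : exists2 a, a \in D & 0 < edot b a.
  apply: contrapT => N.
  have : edot b b <= 0.
    rewrite {2}Ec edot_sumr big_seq; apply: sumr_le0 => a aD.
    rewrite edotZr mulr_ge0_le0 // leNgt; apply/negP => h; apply: N; by exists a.
  by rewrite leNgt edot_gt0 (root_neq0 (pos_root bSp)).
have [->|ba] := eqVneq b a.
  by exists [:: a]; rewrite ?wprod_seq1 // => x; rewrite inE => /eqP ->.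
have aS := DS aD.
pose b' := reflection_mx a *m b.
have b'S : b' \in Sp by apply: D_perm.
have lt : edot b' v < edot b v.
  rewrite /b' refl_mxE edotBl edotZl gtrBl mulr_gt0 //.
    by rewrite divr_gt0 ?edot_gt0 ?(root_neq0 aS) // edotC mulr_gt0.
  exact/pos_height/DSp.
have [|s sD Es] := IH b' _ b'S.
  rewrite -ltnS; apply: leq_trans hn; rewrite ltnS.
  apply: fproper_ltn_card; rewrite fproperE; apply/andP; split.
    apply/fsubsetP => x; rewrite !inE /= => /andP[-> h]; exact: lt_trans h lt.
  by apply/fsubsetPn; exists b'; rewrite !inE /= b'S ?lt // ltxx.
exists (a :: s ++ [:: a]).
  move=> x; rewrite inE mem_cat inE => /or3P[/eqP ->|/sD|/eqP ->] //.
rewrite wprod_cons wprod_cat wprod_seq1 -Es /b' refl_mx_conj; last first.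
  exact/refl_ortho/root_neq0.
rewrite refl_mxT !mulmxA refl_mxK ?(root_neq0 aS) // mul1mx -mulmxA refl_mxK ?(root_neq0 aS) //.
by rewrite mulmx1.
Qed.

Lemma weyl_simple_word w : weyl_group S w ->
  exists2 s, {subset s <= D} & w = wprod s.
Proof.
move: w; apply: weyl_ind => [|a w aS _ [s sD ->]].
  by exists [::] => //; rewrite wprod_nil.
have [t tD ->] : exists2 t, {subset t <= D} & reflection_mx a = wprod t.
  by case: (pos_or_neg aS) => /refl_simple_word //; rewrite refl_mxN.
exists (t ++ s); last by rewrite wprod_cat.
by move=> x; rewrite mem_cat => /orP[/tD|/sD].
Qed.

Lemma simple_word_weyl s : {subset s <= D} -> weyl_group S (wprod s).
Proof. by move=> h; exists s => // x /h/DS. Qed.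

(** When a word makes a positive root negative, the sign changes at a letter
    equal to the image of the root by the letters that follow. *)
Lemma simple_word_flip s a : {subset s <= D} -> a \in Sp -> wprod s *m a \notin Sp ->
  exists s1 b s2, [/\ s = s1 ++ b :: s2 & wprod s2 *m a = b].
Proof.
elim: s => [|c t IH] sD aSp; first by rewrite wprod_nil mul1mx aSp.
have tD : {subset t <= D} by move=> x xt; apply: sD; rewrite inE xt orbT.
have [h|h] := boolP (wprod t *m a \in Sp); last first.
  by have [s1 [b [s2 [-> E]]]] := IH tD aSp h; exists (c :: s1), b, s2.
rewrite wprod_cons -mulmxA => h2; exists [::], c, t; split => //.
apply/eqP; apply: contraNT h2 => /D_perm; apply => //.
by apply: sD; rewrite mem_head.
Qed.

(** The exchange argument: a word that preserves the positive roots can be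
    shortened by two letters until it is empty. *)
Lemma simple_word_eq1 s : {subset s <= D} ->
  (forall a, a \in Sp -> wprod s *m a \in Sp) -> wprod s = 1%:M.
Proof.
have [n] := ubnP (size s); elim: n s => // n IH s sn sD sS.
case/lastP: s => [|s a] in sn sD sS *; first by rewrite wprod_nil.
have aD : a \in D by apply: sD; rewrite mem_rcons mem_head.
have s'D : {subset s <= D} by move=> x xs; apply: sD; rewrite mem_rcons inE xs orbT.
have a0 : a != 0 by exact/root_neq0/DS.
have := sS a (DSp aD); rewrite -cats1 wprod_cat wprod_seq1 -mulmxA refl_mx_self //.
rewrite mulmxN => /pos_notN; rewrite opprK => /(simple_word_flip s'D (DSp aD)).
move=> [s1 [b [s2 [Es Eb]]]].
have s12 : {subset s1 ++ s2 <= D}.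
  move=> x; rewrite mem_cat => xs; apply: s'D; rewrite Es mem_cat inE.
  by case/orP: xs => ->; rewrite ?orbT.
have o2 : orth_mx (wprod s2).
  apply: weyl_ortho; apply: simple_word_weyl => x xs; apply: s12.
  by rewrite mem_cat xs orbT.
(* The reflection in b = s2 a is s2 s_a s2^-1, so both letters cancel. *)
have E : wprod s *m reflection_mx a = wprod (s1 ++ s2).
  rewrite Es wprod_cat wprod_cons -Eb refl_mx_conj // wprod_cat -!mulmxA.
  rewrite (mulmxA (wprod s2)^T) o2 mul1mx refl_mxK // mulmx1 //.
rewrite E; apply: IH => //.
  move: sn; rewrite Es -cats1 !size_cat /= ltnS => h; apply: leq_trans h; lia.
by move=> x xS; rewrite -E -wprod_seq1 -wprod_cat cats1; apply: sS.
Qed.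

End SimpleSystem.

(** The Weyl group acts freely on the set of positive systems. *)
Lemma weyl_free w : weyl_group S w -> (forall a, a \in Sp -> w *m a \in Sp) ->
  w = 1%:M.
Proof.
have [D [uD DSp Dc Dp _]] := simple_system_exists.
move=> /(weyl_simple_word DSp Dc Dp)[s sD ->].
exact: (simple_word_eq1 DSp Dp).
Qed.

(** A Weyl group element is determined by its action on the roots, since it
    moves every vector along the span of the roots only. *)
Lemma weyl_eq w1 w2 : weyl_group S w1 -> weyl_group S w2 ->
  (forall a, a \in S -> w1^T *m a = w2^T *m a) -> w1 = w2.
Proof.
move=> h1 h2 E; apply: mulmx_eq => X; apply/eqP; rewrite -subr_eq0 -edot_eq0.
set y := w1 *m X - w2 *m X.
have yS a : a \in S -> edot a y = 0.
  by move=> aS; rewrite edotBr !edot_mx E // subrr.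
have H w : weyl_group S w -> edot (w *m X - X) y = 0.
  move=> ww; elim/weyl_ind: w / ww => [|a w aS _ IH].
    by rewrite mul1mx subrr edot0l.
  by rewrite -mulmxA refl_mxE addrAC edotBl edotZl IH yS // mulr0 subrr.
rewrite {1}/y; have -> : w1 *m X - w2 *m X = (w1 *m X - X) - (w2 *m X - X).
  by rewrite opprB addrA subrK.
by rewrite edotBl !H // subrr.
Qed.

Lemma finite_weyl : finite_set (weyl_group S).
Proof.
pose P (f : {ffun S -> S}) w :=
  weyl_group S w /\ forall a : S, val (f a) = w^T *m val a.
pose g (f : {ffun S -> S}) := xget 0 (P f).
apply: (@sub_finite_set _ _ (g @` setT)); last exact/finite_image/finite_finset.
move=> w ww; have h (a : S) : w^T *m val a \in S.
  by apply: weyl_root (valP a); apply: weylT.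
exists [ffun a : S => FSetSub (h a)] => //=.
rewrite /g; case: xgetP => [w' _ [w'w E]|/(_ w)]; last first.
  by case; split => // a; rewrite ffunE.
apply: weyl_eq => // a aS; have := E (FSetSub aS); rewrite ffunE /= => <- //.
Qed.

(** The Weyl group as a duplicate-free list. *)
Definition weyl_seq : seq 'M[R]_d := fset_set (weyl_group S).

Lemma mem_weyl_seq w : (w \in weyl_seq) <-> weyl_group S w.
Proof.
rewrite /weyl_seq in_fset_set; last exact: finite_weyl.
by split => [/set_mem|/mem_set].
Qed.

Lemma uniq_weyl_seq : uniq weyl_seq. Proof. exact: fset_uniq. Qed.

Lemma sum_weyl (F : 'M[R]_d -> R) :
  \sum_(w \in weyl_group S) F w = \sum_(w <- weyl_seq) F w.
Proof. exact/fsbig_finite/finite_weyl. Qed.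

Lemma perm_weylM u : weyl_group S u ->
  perm_eq [seq w *m u | w <- weyl_seq] weyl_seq.
Proof.
move=> uW; have o := weyl_ortho uW.
have inj : injective (mulmx^~ u : 'M[R]_d -> 'M[R]_d).
  move=> x y /(congr1 (fun z => z *m u^T)).
  by rewrite -!mulmxA orth_mxC // !mulmx1.
apply: uniq_perm; rewrite ?map_inj_uniq ?uniq_weyl_seq // => w.
apply/mapP/idP => [[w' /mem_weyl_seq h ->]|/mem_weyl_seq h].
  by apply/mem_weyl_seq; apply: weylM.
exists (w *m u^T); first by apply/mem_weyl_seq/weylM/weylT.
by rewrite -mulmxA o mulmx1.
Qed.

Lemma seq_argmax (T : eqType) (f : T -> R) (L : seq T) (x0 : T) : x0 \in L ->
  exists2 x, x \in L & forall y, y \in L -> f y <= f x.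
Proof.
elim: L x0 => // a L IH x0 _.
case: L IH => [|b L] IH; first by exists a; rewrite ?mem_head // => y; rewrite inE => /eqP ->.
have [x xL hx] := IH b (mem_head _ _).
have [h|/ltW h] := leP (f a) (f x).
  exists x; first by rewrite in_cons xL orbT.
  by move=> y; rewrite in_cons => /predU1P[->//|]; apply: hx.
exists a; rewrite ?mem_head // => y; rewrite in_cons => /predU1P[->//|/hx h2].
exact: le_trans h.
Qed.

(** The closed Weyl chamber, as the set of the points where no positive root is
    negative. *)
Definition dominant X := forall a, a \in Sp -> 0 <= edot a X.

(** Every orbit meets the closed chamber, at a point that maximizes the inner
    product with a given regular dominant vector. *)
Lemma orbit_dominant X Y : chamber Sp X -> exists2 w, weyl_group S w &
  dominant (w *m Y) /\ forall u, weyl_group S u -> edot X (u *m Y) <= edot X (w *m Y).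
Proof.
move=> hX.
have [w /mem_weyl_seq ww hw] := seq_argmax (fun w => edot X (w *m Y))
  ((mem_weyl_seq 1%:M).2 weyl1).
have {}hw u : weyl_group S u -> edot X (u *m Y) <= edot X (w *m Y).
  by move=> /mem_weyl_seq; apply: hw.
exists w => //; split => // a aSp.
have aS := pos_root aSp.
have := hw _ (weylM (weyl_refl aS) ww); rewrite -mulmxA refl_mxE edotBr edotZr.
rewrite gerBl (edotC X) pmulr_lge0; last exact: hX.
by rewrite pmulr_lge0 ?invr_gt0 ?edot_gt0 ?root_neq0 // pmulr_rge0.
Qed.

Lemma chamber_pos a X : a \in S -> chamber Sp X -> 0 < edot a X -> a \in Sp.
Proof.
move=> aS hX h; case: (pos_or_neg aS) => // /hX.
by rewrite edotNl oppr_gt0 ltNge ltW.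
Qed.

Lemma chamber_fundamental w Y : weyl_group S w -> chamber Sp Y ->
  dominant (w *m Y) -> w = 1%:M.
Proof.
move=> ww hY h; apply: (can_inj trmxK); rewrite trmx1; apply: weyl_free.
  exact: weylT.
move=> a aSp; have aS := pos_root aSp.
have wS : w^T *m a \in S by apply: weyl_root => //; apply: weylT.
apply: (chamber_pos wS hY).
have := h a aSp; rewrite edot_mx le_eqVlt => /predU1P[|//] E.
exfalso; case: (pos_or_neg wS) => /hY; rewrite ?edotNl -E ?oppr0 ltxx //.
Qed.

Lemma chamberv : chamber Sp v.
Proof. by move=> a /pos_height. Qed.

Lemma quad_ge0 (p q r : R) :
  (forall t, 0 < t -> 0 <= p + q * t + r * (t * t)) -> 0 <= p.
Proof.
move=> h; rewrite leNgt; apply/negP => p0.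
pose K := `|q| + `|r| + 1.
have K0 : 0 < K by rewrite ltr_wpDl // addr_ge0.
pose t := Num.min 1 (- p / (2 * K)).
have t0 : 0 < t by rewrite lt_min ltr01 divr_gt0 ?mulr_gt0 ?oppr_gt0.
have t1 : t <= 1 by rewrite ge_min lexx.
have tK : t * (2 * K) <= - p by rewrite -ler_pdivlMr ?mulr_gt0 // ge_min lexx orbT.
have := h t t0.
have q1 : q * t <= `|q| * t by rewrite ler_wpM2r ?ler_norm // ltW.
have r1 : r * (t * t) <= `|r| * t.
  apply: (@le_trans _ _ (`|r| * (t * t))).
    by rewrite ler_wpM2r ?ler_norm // mulr_ge0 // ltW.
  by rewrite ler_wpM2l // -[leRHS]mulr1 ler_wpM2l // ltW.
have : `|q| * t + `|r| * t <= - p / 2.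
  have : (`|q| + `|r|) * t <= K * t by rewrite ler_wpM2r ?(ltW t0) // lerDl.
  nra.
lra.
Qed.

(** Translations by small multiples of [v] reduce this to the open chamber,
    where the maximum over the orbit of [Y] is reached at a dominant point,
    hence at [Y] itself. *)
Lemma weyl_dominant_le w X Y : weyl_group S w -> dominant X -> dominant Y ->
  edot X (w *m Y) <= edot X Y.
Proof.
move=> ww hX hY.
have shift Z t : dominant Z -> 0 < t -> chamber Sp (Z + t *: v).
  move=> hZ t0 a aSp; rewrite edotDr edotZr ltr_wpDl ?hZ ?mulr_gt0 //.
  exact: pos_height.
have reg X' Y' : chamber Sp X' -> chamber Sp Y' -> edot X' (w *m Y') <= edot X' Y'.
  move=> hX' hY'; have [w0 w0W [h0 le0]] := orbit_dominant Y' hX'.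
  by rewrite (chamber_fundamental w0W hY' h0) mul1mx in le0; apply: le0.
rewrite -subr_ge0.
apply: (@quad_ge0 _ (edot X v + edot v Y - edot X (w *m v) - edot v (w *m Y))
   (edot v v - edot v (w *m v))) => t t0.
have := reg _ _ (shift X t hX t0) (shift Y t hY t0).
rewrite mulmxDr -scalemxAr !edotDl !edotDr !edotZl !edotZr; lra.
Qed.

(** * Weyl's denominator formula *)

(** [cdiff T f] applies to [f] the central difference operators with steps the
    elements of [T]; it is the pairing of [f] with the signed measure
    underlying the product of the [exp(a/2) - exp(-a/2)]. *)
Fixpoint cdiff (T : seq 'cV[R]_d) (f : 'cV[R]_d -> R) (x : 'cV[R]_d) : R :=
  if T is a :: T' then cdiff T' f (x + 2^-1 *: a) - cdiff T' f (x - 2^-1 *: a)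
  else f x.

Lemma cdiff_head2 a b T f x : cdiff (a :: b :: T) f x = cdiff (b :: a :: T) f x.
Proof.
by rewrite /= !(addrAC x _ (2^-1 *: a)) !(addrAC x _ (- (2^-1 *: a)));
   set p := cdiff T f _; set q := cdiff T f _; set r := cdiff T f _;
   set s := cdiff T f _; ring.
Qed.

Lemma cdiff_rem a T f x : a \in T -> cdiff T f x = cdiff (a :: rem a T) f x.
Proof.
elim: T x => // b T IH x; rewrite inE /=; have [->//|ba] := eqVneq b a.
move=> /= aT.
by rewrite -[RHS]/(cdiff (a :: b :: rem a T) f x) cdiff_head2 /= !IH.
Qed.

Lemma cdiff_perm T T' f x : perm_eq T T' -> cdiff T f x = cdiff T' f x.
Proof.
elim: T T' x => [|a T IH] T' x; first by rewrite perm_sym => /perm_nilP ->.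
move=> p; have aT' : a \in T' by rewrite -(perm_mem p) mem_head.
rewrite (cdiff_rem f x aT') /=; have {}p : perm_eq T (rem a T').
  by rewrite -(perm_cons a) (perm_trans p) // perm_to_rem.
by rewrite !(IH _ _ p).
Qed.

Lemma cdiffN a T f x : cdiff (- a :: T) f x = - cdiff (a :: T) f x.
Proof. by rewrite /= scalerN opprK opprB. Qed.

Lemma cdiff_mulmx w T f x :
  cdiff T (fun y => f (w *m y)) x = cdiff [seq w *m a | a <- T] f (w *m x).
Proof. by elim: T x => //= a T IH x; rewrite !IH mulmxBr mulmxDr -!scalemxAr. Qed.

Lemma cdiff_sum (I : Type) (L : seq I) (c : I -> R) (F : I -> 'cV[R]_d -> R) T x :
  cdiff T (fun y => \sum_(i <- L) c i * F i y) x =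
  \sum_(i <- L) c i * cdiff T (F i) x.
Proof.
elim: T x => //= a T IH x; rewrite !IH -sumrB.
by apply: eq_bigr => i _; rewrite mulrBr.
Qed.

Lemma cdiff_shift T f x y : cdiff T (fun z => f (z + y)) x = cdiff T f (x + y).
Proof. by elim: T x => //= a T IH x; rewrite !IH -!(addrAC x y). Qed.

(** Each difference lowers the degree of a power by one. *)
Lemma cdiff_pow T n X x : (n <= size T)%N ->
  cdiff T (fun y => edot y X ^+ n) x =
  if n == size T then n`!%:R * \prod_(a <- T) edot a X else 0.
Proof.
elim: T n x => [|a T IH] n x /=.
  by rewrite leqn0 => /eqP ->; rewrite expr0 big_nil mulr1.
move=> nT; pose h := edot (2^-1 *: a) X.
have E y e : edot (y + e *: (2^-1 *: a)) X ^+ n =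
    \sum_(0 <= i < n.+1) (e ^+ i * h ^+ i *+ 'C(n, i)) * edot y X ^+ (n - i).
  rewrite edotDl edotZl -/h exprDn big_mkord.
  by apply: eq_bigr => i _; rewrite exprMn mulrnAl mulrC.
have -> : cdiff T (fun y => edot y X ^+ n) (x + 2^-1 *: a) =
    cdiff T (fun y => \sum_(0 <= i < n.+1) (1 ^+ i * h ^+ i *+ 'C(n, i)) * edot y X ^+ (n - i)) x.
  by rewrite -cdiff_shift; congr cdiff; apply/funext => y; rewrite -E scale1r.
have -> : cdiff T (fun y => edot y X ^+ n) (x - 2^-1 *: a) =
    cdiff T (fun y => \sum_(0 <= i < n.+1) ((-1) ^+ i * h ^+ i *+ 'C(n, i)) * edot y X ^+ (n - i)) x.
  by rewrite -cdiff_shift; congr cdiff; apply/funext => y; rewrite -E scaleN1r.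
rewrite !cdiff_sum -sumrB.
rewrite big_mkord big_ord_recl /= !expr0 subrr add0r.
case: n nT {E} => [_|n]; first by rewrite big_ord0.
rewrite ltnS eqSS => nT.
rewrite big_ord_recl big1 => [|i _].
  rewrite addr0 /bump /= subSS subn0 !expr1 bin1 IH //.
  case: eqP => [->|]; last by rewrite !mulr0 subrr.
  rewrite big_cons factS natrM /h edotZl -[RHS]mulrA; set p := \prod_(_ <- _) _.
  rewrite -!(mulr_natr (_ * _)); move: p ((size T)`!%:R : R) ((size T).+1%:R : R) (edot a X) => p F N x0.
  by field.
have -> : bump 0 (lift ord0 i) = i.+2 by [].
rewrite subSS IH; last by apply: leq_trans nT; rewrite leq_subr.
have -> : (n - i.+1)%N == size T = false.
  apply/negbTE; rewrite neq_ltn; apply/orP; left; apply: leq_trans nT.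
  by rewrite ltn_subrL /=; case: i => i /=; lia.
by rewrite !mulr0 subrr.
Qed.

(** If [f] vanishes below the height of the highest point of evaluation, only
    this point contributes. *)
Lemma cdiff_top T f x h :
  (forall a, a \in T -> 0 < edot a v) ->
  (forall y, edot y v < h -> f y = 0) ->
  h <= edot (x + 2^-1 *: \sum_(a <- T) a) v ->
  edot (x + 2^-1 *: \sum_(a <- T) a) v <= h ->
  cdiff T f x = f (x + 2^-1 *: \sum_(a <- T) a).
Proof.
move=> + f0.
have Z U y : (forall a, a \in U -> 0 < edot a v) ->
    edot (y + 2^-1 *: \sum_(a <- U) a) v < h -> cdiff U f y = 0.
  elim: U y => [|a U IH] y hU /=; first by rewrite big_nil scaler0 addr0 => /f0.
  have hU' b : b \in U -> 0 < edot b v by move=> bU; apply: hU; rewrite inE bU orbT.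
  have := hU a (mem_head _ _) => av.
  rewrite big_cons scalerDr addrA => hy; rewrite !IH ?subrr //.
  apply: le_lt_trans hy; rewrite !edotDl edotNl !edotZl; lra.
elim: T x => [|a T IH] x hT /= h1 h2; first by rewrite big_nil scaler0 addr0.
have hT' b : b \in T -> 0 < edot b v by move=> bT; apply: hT; rewrite inE bT orbT.
have := hT a (mem_head _ _) => av.
rewrite big_cons scalerDr addrA in h1 h2 *.
rewrite IH // Z // ?subr0 //.
apply: lt_le_trans h2; rewrite !edotDl edotNl !edotZl; lra.
Qed.

(** The alternating sum of a function over an orbit. *)
Definition alt_sum (f : 'cV[R]_d -> R) x :=
  \sum_(w <- weyl_seq) \det w * f (w *m x).

Lemma weyl_det2 w : weyl_group S w -> \det w * \det w = 1.
Proof.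
move=> /weyl_ortho ow; rewrite -[X in X * _](det_tr w) -det_mulmx.
by rewrite ow det1.
Qed.

Lemma alt_sum_weyl f w x : weyl_group S w ->
  alt_sum f (w *m x) = \det w * alt_sum f x.
Proof.
move=> ww; rewrite {2}/alt_sum -(perm_big _ (perm_weylM ww)) big_map /= mulr_sumr.
apply: eq_bigr => u _; rewrite det_mulmx mulmxA.
by rewrite -[LHS]mul1r -(weyl_det2 ww); ring.
Qed.

Lemma alt_sum_wall f a x : a \in S -> edot a x = 0 -> alt_sum f x = 0.
Proof.
move=> aS ax; have := alt_sum_weyl f x (weyl_refl aS).
rewrite refl_mxE ax mulr0 mul0r scale0r subr0 det_refl ?root_neq0 // mulN1r.
by move=> /eqP; rewrite -addr_eq0 -mulr2n mulrn_eq0 /= => /eqP.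
Qed.

(** Half the signed sum of the positive roots, the sign of [b] being given by
    [e b]. *)
Definition half_sum (e : 'cV[R]_d -> bool) :=
  \sum_(b <- Sp) ((-1) ^+ e b / 2) *: b.

Lemma half_sum0 : half_sum (fun=> false) = 2^-1 *: root_sum Sp.
Proof.
by rewrite /root_sum scaler_sumr; apply: eq_bigr => b _; rewrite expr0 mul1r.
Qed.

(** A simple reflection permutes the other positive roots. *)
Lemma perm_simple_refl (D : seq 'cV[R]_d) a : {subset D <= Sp} ->
  (forall a b, a \in D -> b \in Sp -> b != a -> reflection_mx a *m b \in Sp) ->
  a \in D ->
  perm_eq [seq reflection_mx a *m b | b <- rem a (Sp : seq 'cV[R]_d)] (rem a (Sp : seq 'cV[R]_d)).
Proof.
move=> DSp Dp aD; have aSp := DSp _ aD; have aS := pos_root aSp.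
have inj : injective (mulmx (reflection_mx a) : 'cV[R]_d -> 'cV[R]_d).
  by move=> x y; apply: refl_root_inj.
have ur : uniq (rem a (Sp : seq 'cV[R]_d)) by exact/rem_uniq/fset_uniq.
have sub : {subset [seq reflection_mx a *m b | b <- rem a (Sp : seq 'cV[R]_d)] <= rem a (Sp : seq 'cV[R]_d)}.
  move=> x /mapP[b]; rewrite (mem_rem_uniq _ (fset_uniq Sp)) !inE => /andP[ba bSp] ->.
  rewrite (mem_rem_uniq _ (fset_uniq Sp)) !inE Dp // andbT; apply/eqP => E.
  have := pos_notN aSp; rewrite -(refl_mx_self (root_neq0 aS)) -{2}E mulmxA.
  by rewrite refl_mxK ?root_neq0 // mul1mx bSp.
have u1 : uniq [seq reflection_mx a *m b | b <- rem a (Sp : seq 'cV[R]_d)].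
  by rewrite map_inj_uniq.
have [|_ E] := uniq_min_size u1 sub; first by rewrite size_map.
exact: uniq_perm.
Qed.

(** The value at [f] of the signed measure of the product of the
    [exp(a/2) - exp(-a/2)] is the alternating sum of [f] over the orbit of
    half the sum of the positive roots. *)
Lemma weyl_denominator f : cdiff Sp f 0 = alt_sum f (2^-1 *: root_sum Sp).
Proof.
have [D [uD DSp Dc Dp DS]] := simple_system_exists.
pose rho := 2^-1 *: root_sum Sp.
have anti w g : weyl_group S w -> cdiff Sp (fun x => g (w *m x)) 0 = \det w * cdiff Sp g 0.
  move=> /(weyl_simple_word DSp Dc Dp)[s sD ->].
  elim: s g sD => [|a s IH] g sD.
    rewrite wprod_nil det1 mul1r; congr cdiff; apply/funext => x.
    by rewrite mul1mx.
  have sD' : {subset s <= D} by move=> x xs; apply: sD; rewrite inE xs orbT.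
  have aD : a \in D by apply: sD; rewrite mem_head.
  have aSp := DSp _ aD; have aS := pos_root aSp.
  rewrite wprod_cons det_mulmx det_refl ?root_neq0 //.
  have -> : (fun x => g (reflection_mx a *m wprod s *m x)) =
     (fun x => (fun y => g (reflection_mx a *m y)) (wprod s *m x)).
    by apply/funext => x; rewrite mulmxA.
  rewrite (IH (fun y => g (reflection_mx a *m y))) // cdiff_mulmx mulmx0.
  rewrite (@cdiff_perm _ (- a :: rem a (Sp : seq 'cV[R]_d))); last first.
    rewrite (perm_trans (perm_map _ (perm_to_rem aSp))) //=.
    by rewrite refl_mx_self ?root_neq0 // perm_cons (perm_simple_refl DSp Dp).
  by rewrite cdiffN -cdiff_rem //; ring.
(* The measure is antisymmetric: alternating [g] over the group only
   multiplies the value by the order of the group. *)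
have average g : cdiff Sp (alt_sum g) 0 = (size weyl_seq)%:R * cdiff Sp g 0.
  rewrite /alt_sum (cdiff_sum _ _ (fun w x => g (w *m x))).
  rewrite big_seq (eq_bigr (fun=> cdiff Sp g 0)); last first.
    by move=> w /mem_weyl_seq ww; rewrite anti // mulrA weyl_det2 // mul1r.
  by rewrite -big_seq big_const_seq count_predT iter_addr_0 mulr_natl.
have rho_simple a : a \in D -> 2 * edot a rho / edot a a = 1.
  move=> aD; have aSp := DSp _ aD; have a0 := root_neq0 (DS _ aD).
  have : reflection_mx a *m rho = rho - a.
    rewrite /rho -scalemxAr /root_sum (perm_big _ (perm_to_rem aSp)) big_cons /=.
    rewrite mulmxDr refl_mx_self // mulmx_sumr -(big_map _ predT id).
    rewrite (perm_big _ (perm_simple_refl DSp Dp aD)) !scalerDr scalerN.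
    rewrite [RHS]addrAC; congr (_ + _).
    by rewrite -[X in _ = _ - X]scale1r -scaleNr -scalerBl; congr (_ *: _); field.
  rewrite refl_mxE => /addrI /oppr_inj /eqP.
  by rewrite -subr_eq0 -[X in _ - X == _]scale1r -scalerBl scaler_eq0 (negPf a0) orbF subr_eq0 => /eqP.
have cone_le (Z : 'cV[R]_d) : (forall a, a \in D -> edot a Z <= 0) ->
    forall b, b \in Sp -> edot b Z <= 0.
  move=> hZ b /Dc[c c0 ->]; rewrite edot_suml big_seq; apply: sumr_le0 => a aD.
  by rewrite edotZl mulr_ge0_le0 // hZ.
have rho_pos b : b \in Sp -> 0 < edot b rho.
  have simple a : a \in D -> 0 < edot a rho.
    move=> aD; have := rho_simple a aD; have : 0 < edot a a by rewrite edot_gt0 root_neq0 ?DS.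
    move=> a0 /divr1_eq h; lra.
  move=> bSp; have [c c0 Eb] := Dc _ bSp.
  have : 0 <= edot b rho.
    have := cone_le (- rho) _ b bSp; rewrite edotNr oppr_le0; apply => a /simple.
    by rewrite edotNr oppr_le0 => /ltW.
  rewrite le_eqVlt => /predU1P[E|//]; exfalso.
  have : \sum_(a <- D) c a * edot a rho == 0.
    have <- : edot b rho = \sum_(a <- D) c a * edot a rho.
      by rewrite Eb edot_suml; apply: eq_bigr => a _; rewrite edotZl.
    by rewrite -E.
  rewrite big_seq psumr_eq0 => [/allP H|a /simple/ltW h]; last exact: mulr_ge0.
  have := root_neq0 (pos_root bSp); rewrite Eb big_seq big1 ?eqxx // => a aD.
  have := H a aD; rewrite aD /= mulf_eq0 (gt_eqF (simple a aD)) orbF => /eqP ->.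
  exact: scale0r.
have free w : weyl_group S w -> w *m rho = rho -> w = 1%:M.
  move=> ww wr; apply: weyl_free => // a aSp.
  apply: (@chamber_pos _ rho) => //; first exact/weyl_root/pos_root.
  by rewrite edotC edot_mx -{1}wr mulmxA weyl_ortho // mul1mx edotC rho_pos.
have stable w e : weyl_group S w -> exists e', w *m half_sum e = half_sum e'.
  move=> /(weyl_simple_word DSp Dc Dp)[s sD ->].
  elim: s sD => [|a s IH] sD; first by exists e; rewrite wprod_nil mul1mx.
  have [|e' E] := IH; first by move=> x xs; apply: sD; rewrite inE xs orbT.
  have aD : a \in D by apply: sD; rewrite mem_head.
  have aSp := DSp _ aD; have aS := pos_root aSp.
  rewrite wprod_cons -mulmxA E.
  exists (fun b => if b == a then ~~ e' a else e' (reflection_mx a *m b)).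
  rewrite /half_sum !(perm_big _ (perm_to_rem aSp)) !big_cons /= eqxx mulmxDr.
  rewrite -scalemxAr refl_mx_self ?root_neq0 // signrN mulNr scaleNr scalerN.
  congr (_ + _); rewrite mulmx_sumr.
  rewrite -[RHS](perm_big _ (perm_simple_refl DSp Dp aD)) big_map big_seq [RHS]big_seq.
  apply: eq_bigr => b; rewrite (mem_rem_uniq _ (fset_uniq Sp)) !inE => /andP[ba bSp].
  rewrite -scalemxAr mulmxA refl_mxK ?root_neq0 // mul1mx ifN //.
  apply: contraTneq bSp => E2; rewrite -(mul1mx b) -(refl_mxK (root_neq0 aS)).
  by rewrite -mulmxA E2 refl_mx_self ?root_neq0 // pos_notN.
(* A regular dominant point of this form pairs to positive integers with the
   simple coroots, so it is at least rho; it is also at most rho. *)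
have regular e : chamber Sp (half_sum e) -> half_sum e = rho.
  move=> hc; pose E := \sum_(b <- Sp) (e b)%:R *: b.
  have hE : half_sum e = rho - E.
    rewrite /rho -half_sum0 /half_sum /E -sumrB; apply: eq_bigr => b _.
    by rewrite -scalerBl; congr (_ *: _); case: (e b); rewrite /=; field.
  have Ea a : a \in D -> edot a E <= 0.
    move=> aD; have aS := DS _ aD; have a0 : 0 < edot a a by rewrite edot_gt0 root_neq0.
    have : 2 * edot a E / edot a a \is a Num.int.
      rewrite /E edot_sumr mulr_sumr mulr_suml big_seq; apply: rpred_sum => b /pos_root bS.
      rewrite edotZr; case: (e b); last by rewrite mul0r mulr0 mul0r rpred0.
      by rewrite mul1r; case: hS => _ _ _ /(_ a b aS bS) [z ->]; apply: intr_int.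
    move=> /intrP[z Ez].
    have := hc a (DSp _ aD); rewrite hE edotBr => h.
    have : 0 < 2 / edot a a * (edot a rho - edot a E) by rewrite mulr_gt0 ?divr_gt0.
    have -> : 2 / edot a a * (edot a rho - edot a E) = 2 * edot a rho / edot a a - 2 * edot a E / edot a a by ring.
    rewrite rho_simple // Ez subr_gt0 ltrz1 -lezD1 -(lerD2r (- 1)) addrK subrr.
    rewrite -(ler_int R) -Ez pmulr_lle0 ?invr_gt0 // pmulr_rle0 //.
  have : edot E E <= 0.
    rewrite {1}/E edot_suml big_seq; apply: sumr_le0 => b bSp.
    by rewrite edotZl mulr_ge0_le0 // cone_le.
  rewrite hE leNgt edot_gt0 negbK => /eqP ->; exact: subr0.
have point e : exists k, forall g, alt_sum g (half_sum e) = k * alt_sum g rho.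
  have [w ww [dw _]] := orbit_dominant (half_sum e) chamberv.
  have [e' E] := stable w e ww.
  have back g : alt_sum g (half_sum e) = \det w * alt_sum g (half_sum e').
    by rewrite -E alt_sum_weyl // mulrA weyl_det2 // mul1r.
  have [h|/existsNP[a /not_implyP[aSp h]]] := pselect (chamber Sp (half_sum e')).
    by exists (\det w) => g; rewrite back regular.
  exists 0 => g; rewrite mul0r back (@alt_sum_wall g a) ?mulr0 //; first exact: pos_root.
  apply/eqP; rewrite eq_le -{2}E dw // andbT leNgt; exact/negP.
have proportional : exists k, forall g, cdiff Sp (alt_sum g) 0 = k * alt_sum g rho.
  suff H T x : uniq T -> (forall e : 'cV[R]_d -> bool, exists k, forall g, alt_sum g
        (x + \sum_(b <- T) ((-1) ^+ e b / 2) *: b) = k * alt_sum g rho) ->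
      exists k, forall g, cdiff T (alt_sum g) x = k * alt_sum g rho.
    apply: H; first exact: fset_uniq.
    by move=> e; have [k Hk] := point e; exists k => g; rewrite add0r Hk.
  elim: T x => [|a T IH] /= x uT H.
    by have [k Hk] := H xpredT; exists k => g; rewrite -Hk big_nil addr0.
  move: uT => /andP[aT uT].
  have H' (s : bool) (e : 'cV[R]_d -> bool) : exists k, forall g,
     alt_sum g (x + ((-1) ^+ s / 2) *: a + \sum_(b <- T) ((-1) ^+ e b / 2) *: b) = k * alt_sum g rho.
    have [k Hk] := H (fun b => if b == a then s else e b); exists k => g.
    rewrite -Hk big_cons eqxx addrA; congr (alt_sum g (_ + _)).
    rewrite big_seq [RHS]big_seq; apply: eq_bigr => b bT.
    by rewrite ifN //; apply: contraNneq aT => <-.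
  have [k1 h1] := IH _ uT (H' false); have [k2 h2] := IH _ uT (H' true).
  exists (k1 - k2) => g; rewrite mulrBl -h1 -h2 expr0 expr1 mul1r mulN1r scaleNr //.
have [k Hk] := proportional.
have W0 : (size weyl_seq)%:R != 0 :> R.
  rewrite pnatr_eq0 -lt0n; have := (mem_weyl_seq 1%:M).2 weyl1.
  by case: weyl_seq.
(* The constant of proportionality is found on the indicator of rho. *)
pose f0 x : R := (x == rho)%:R.
have k1 : k = (size weyl_seq)%:R.
  have := Hk f0; rewrite average.
  have -> : cdiff Sp f0 0 = 1.
    have E0 : 0 + 2^-1 *: \sum_(a <- Sp) a = rho by rewrite add0r.
    rewrite (@cdiff_top _ f0 0 (edot rho v)) ?E0 //; first by rewrite /f0 eqxx.
    - by move=> a /pos_height.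
    - by move=> y; rewrite /f0; case: eqP => // ->; rewrite ltxx.
  have -> : alt_sum f0 rho = 1.
    rewrite /alt_sum (bigD1_seq 1%:M) ?uniq_weyl_seq //=; last exact/mem_weyl_seq/weyl1.
    rewrite det1 mul1mx /f0 eqxx mul1r big_seq_cond big1 ?addr0 //.
    move=> w /andP[/mem_weyl_seq ww w1]; case: eqP => [/(free w ww)/eqP|]; last by rewrite mulr0.
    by rewrite (negPf w1).
  by rewrite !mulr1.
by have := Hk f; rewrite average k1 => /(mulfI W0).
Qed.

(** The lowest-degree part of Weyl's denominator formula. *)
Lemma weyl_denominator_pow X :
  \sum_(w <- weyl_seq) \det w * edot (w *m (2^-1 *: root_sum Sp)) X ^+ #|` Sp| =
  (#|` Sp|)`!%:R * root_prod Sp X.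
Proof.
rewrite -[LHS]/(alt_sum (fun y => edot y X ^+ #|` Sp|) _) -weyl_denominator.
by rewrite cdiff_pow // eqxx.
Qed.

End RootSystem.

(** * Stabilizers *)

Section Stabilizer.
Variables (R : realType) (d : nat) (S Sp : {fset 'cV[R]_d}) (v : 'cV[R]_d).
Hypothesis hS : root_system S.
Hypothesis hv : forall a, a \in S -> edot a v != 0.
Hypothesis hSp : forall a, a \in Sp <-> (a \in S) && (0 < edot a v).
Variable Y0 : 'cV[R]_d.

Lemma mem_roots_at (T : {fset 'cV[R]_d}) a :
  (a \in roots_at T Y0) = (a \in T) && (edot a Y0 == 0).
Proof. by rewrite !inE. Qed.

Lemma roots_at_system : root_system (roots_at S Y0).
Proof.
case: (hS) => h1 h2 h3 h4; split.
- by move=> a; rewrite mem_roots_at => /andP[/h1].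
- move=> a c; rewrite !mem_roots_at => /andP[aS /eqP a0].
  by rewrite edotZl a0 mulr0 eqxx andbT; apply: h2.
- move=> a b; rewrite !mem_roots_at => /andP[aS /eqP a0] /andP[bS /eqP b0].
  by rewrite h3 //= refl_mxE edotBl edotZl a0 b0 mulr0 subrr.
- by move=> a b; rewrite !mem_roots_at => /andP[aS _] /andP[bS _]; apply: h4.
Qed.

Lemma roots_at_regular a : a \in roots_at S Y0 -> edot a v != 0.
Proof. by rewrite mem_roots_at => /andP[/hv]. Qed.

Lemma roots_at_positive a :
  a \in roots_at Sp Y0 <-> (a \in roots_at S Y0) && (0 < edot a v).
Proof.
rewrite !mem_roots_at; split => [/andP[/hSp/andP[-> ->] ->] //|].
by move=> /andP[/andP[aS ->] av]; rewrite andbT; apply/hSp; rewrite aS.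
Qed.

(** Chevalley's theorem: the stabilizer of a point is generated by the
    reflections that fix it. *)
Lemma weyl_stabilizer w : dominant Sp Y0 ->
  weyl_group (roots_at S Y0) w <-> weyl_group S w /\ w *m Y0 = Y0.
Proof.
move=> dY; pose S' := roots_at S Y0.
have sub u : weyl_group S' u -> weyl_group S u /\ u *m Y0 = Y0.
  move=> uW; elim/weyl_ind: u / uW => [|a u aS' _ [uW uY]].
    by split; [exact: weyl1 | rewrite mul1mx].
  move: aS'; rewrite mem_roots_at => /andP[aS /eqP a0]; split.
    by apply: weylM => //; apply: weyl_refl.
  by rewrite -mulmxA uY refl_mxE a0 mulr0 mul0r scale0r subr0.
split; first exact: sub.
move=> [wW wY].
have hS' := roots_at_system.
(* Some [u] in the group generated by these reflections makes [u w v]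
   positive on the roots that vanish at [Y0]; then [u w] preserves the
   positive roots. *)
have [u uW [du _]] := orbit_dominant hS' roots_at_positive (w *m v)
  (chamberv roots_at_positive).
have [uS uY] := sub u uW.
have xW : weyl_group S (u *m w) by apply: weylM.
have xY : (u *m w)^T *m Y0 = Y0.
  by rewrite -{1}uY -{1}wY !mulmxA -(mulmxA _ u) (weyl_ortho hS xW) mul1mx.
have x1 : (u *m w)^T = 1%:M.
  apply: (weyl_free hS hv hSp); first exact: weylT.
  move=> a aSp; have aS := pos_root hSp aSp.
  have xS : (u *m w)^T *m a \in S by apply: (weyl_root hS) => //; apply: weylT.
  have E Z : edot ((u *m w)^T *m a) Z = edot a (u *m w *m Z) by rewrite edot_mx.
  apply/hSp; rewrite xS /= lt_neqAle eq_sym hv //=.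
  have [aY|aY] := eqVneq (edot a Y0) 0.
    by rewrite E -mulmxA; apply: du; rewrite mem_roots_at aSp aY eqxx.
  have aY' : 0 < edot a Y0 by rewrite lt_neqAle eq_sym aY /=; apply: dY.
  case: (pos_or_neg hS hv hSp xS) => [/(pos_height hSp)/ltW // | /dY].
  rewrite edotNl E -{1}xY mulmxA (orth_mxC (weyl_ortho hS xW)).
  by rewrite mul1mx oppr_ge0 leNgt aY'.
have uT : w = u^T.
  have : u *m w = 1%:M by rewrite -(trmxK (u *m w)) x1 trmx1.
  move=> /(congr1 (mulmx u^T)); rewrite mulmxA (weyl_ortho hS uS) mul1mx mulmx1 //.
by rewrite uT; apply: weylT.
Qed.

End Stabilizer.

(** * Limits of inner products *)

Section Limits.
Variables (R : realType) (T : Type) (F : set_system T).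
Context {FF : Filter F}.

Lemma cvg_bigsum (I : Type) (s : seq I) (f : I -> T -> R) (l : I -> R) :
  (forall i, f i x @[x --> F] --> l i) ->
  \sum_(i <- s) f i x @[x --> F] --> \sum_(i <- s) l i.
Proof.
move=> h; elim: s => [|i s IH].
  by rewrite big_nil; under eq_fun do rewrite big_nil; apply: cvg_cst.
rewrite big_cons; under eq_fun do rewrite big_cons.
exact: cvgD.
Qed.

Lemma cvg_bigprod (I : Type) (s : seq I) (f : I -> T -> R) (l : I -> R) :
  (forall i, f i x @[x --> F] --> l i) ->
  \prod_(i <- s) f i x @[x --> F] --> \prod_(i <- s) l i.
Proof.
move=> h; elim: s => [|i s IH].
  by rewrite big_nil; under eq_fun do rewrite big_nil; apply: cvg_cst.
rewrite big_cons; under eq_fun do rewrite big_cons.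
exact: cvgM.
Qed.

Lemma cvg_coord m n (f : T -> 'M[R]_(m, n)) (A : 'M[R]_(m, n)) i j :
  f x @[x --> F] --> A -> (f x i j : R) @[x --> F] --> (A i j : R).
Proof.
move=> fA.
exact: (@continuous_cvg _ _ _ _ FF f (fun B => B i j : R) _ (@coord_continuous _ _ _ i j A) fA).
Qed.

Lemma cvg_colvec d (f : T -> 'cV[R]_d) (A : 'cV[R]_d) :
  (forall i, (f x i 0 : R) @[x --> F] --> (A i 0 : R)) -> f x @[x --> F] --> A.
Proof.
move=> h U [P hP PU].
have hF : F [set x | forall i : 'I_d, P i 0 (f x i 0)].
  by apply: filter_forall => i; exact: (h i _ (hP i 0)).
have sub : [set x | forall i : 'I_d, P i 0 (f x i 0)] `<=` f @^-1` U.
  by move=> x hx; apply: PU => i j; rewrite ord1; apply: hx.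
exact: (filterS sub hF).
Qed.

Lemma cvg_vecD_scale d (f : T -> 'cV[R]_d) (s : T -> R) (A Z : 'cV[R]_d) (l : R) :
  f x @[x --> F] --> A -> s x @[x --> F] --> l ->
  f x + s x *: Z @[x --> F] --> A + l *: Z.
Proof.
move=> fA sl; apply: cvg_colvec => i; rewrite !mxE; under eq_fun do rewrite !mxE.
apply: cvgD; first exact: cvg_coord.
by apply: cvgM => //; exact: cvg_cst.
Qed.

Lemma cvg_vecB d (f g : T -> 'cV[R]_d) (A B : 'cV[R]_d) :
  f x @[x --> F] --> A -> g x @[x --> F] --> B ->
  f x - g x @[x --> F] --> A - B.
Proof.
move=> fA gB; apply: cvg_colvec => i; rewrite !mxE; under eq_fun do rewrite !mxE.
by apply: cvgB; exact: cvg_coord.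
Qed.

Lemma cvg_edot_mx d (N : 'M[R]_d) (f g : T -> 'cV[R]_d) (X Y : 'cV[R]_d) :
  f x @[x --> F] --> X -> g x @[x --> F] --> Y ->
  edot (f x) (N *m g x) @[x --> F] --> edot X (N *m Y).
Proof.
move=> fX gY; apply: cvg_bigsum => i; apply: cvgM; first exact: cvg_coord.
rewrite mxE; under eq_fun do rewrite mxE.
by apply: cvg_bigsum => j; apply: cvgM; [exact: cvg_cst | exact: cvg_coord].
Qed.

Lemma cvg_edot d (f g : T -> 'cV[R]_d) (X Y : 'cV[R]_d) :
  f x @[x --> F] --> X -> g x @[x --> F] --> Y ->
  edot (f x) (g x) @[x --> F] --> edot X Y.
Proof.
move=> fX gY; rewrite -[Y]mul1mx.
by under eq_fun do rewrite -[g _]mul1mx; apply: cvg_edot_mx.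
Qed.

Lemma cvg_pow n (f : T -> R) (l : R) : f x @[x --> F] --> l ->
  f x ^+ n @[x --> F] --> l ^+ n.
Proof.
move=> h; elim: n => [|n IH].
  by rewrite expr0; under eq_fun do rewrite expr0; apply: cvg_cst.
by rewrite exprS; under eq_fun do rewrite exprS; apply: cvgM.
Qed.

End Limits.

Section Lines.
Variables (R : realType) (d : nat).

Lemma near_affine_neq0 (p q : R) : (p != 0) || (q != 0) ->
  \forall t \near 0^'+, p + t * q != 0.
Proof.
move=> pq; have [p0|p0] := eqVneq p 0.
  rewrite p0 eqxx /= in pq.
  near=> t; have t0 : 0 < t by [].
  by rewrite p0 add0r mulf_neq0 // gt_eqF.
have h : p + t * q @[t --> (0 : R)^'+] --> p.
  rewrite -[X in _ --> X]addr0 -[X in _ --> _ + X](mul0r q).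
  apply: cvgD; first exact: cvg_cst.
  apply: cvgM; last exact: cvg_cst.
  exact: (cvg_at_right_filter (@cvg_id _ _)).
exact: cvgr_neq0 h p0.
Unshelve. all: by end_near. Qed.

Lemma near_line_neq0 (L : seq 'cV[R]_d) (X Z : 'cV[R]_d) :
  (forall a, a \in L -> (edot a X != 0) || (edot a Z != 0)) ->
  \forall t \near 0^'+, forall a, a \in L -> edot a (X + t *: Z) != 0.
Proof.
elim: L => [|a L IH] h; first by near=> t.
have h1 := IH (fun b bL => h b (@mem_behead _ (a :: L) b bL)).
have h2 := near_affine_neq0 (h a (mem_head _ _)).
near=> t => b; rewrite inE => /predU1P[->|bL].
  by rewrite edotDr edotZr; near: t; exact: h2.
by move: b bL; near: t; exact: h1.
Unshelve. all: by end_near. Qed.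

Lemma cvg_line (X Z : 'cV[R]_d) : X + t *: Z @[t --> (0 : R)^'+] --> X.
Proof.
have := @cvg_vecD_scale _ _ ((0 : R)^'+) _ d (fun=> X) id X Z 0 (cvg_cst _).
rewrite scale0r addr0; apply.
exact: (cvg_at_right_filter (@cvg_id _ _)).
Qed.

Lemma exists_generic (L : seq 'cV[R]_d) : (forall a, a \in L -> a != 0) ->
  exists Z, forall a, a \in L -> edot a Z != 0.
Proof.
elim: L => [|a L IH] h; first by exists 0.
have [Z hZ] := IH (fun b bL => h b (@mem_behead _ (a :: L) b bL)).
have [] := @filter_ex _ ((0 : R)^'+) _ _ (@near_line_neq0 (a :: L) Z a _).
  move=> b; rewrite inE => /predU1P[->|bL]; last by rewrite hZ.
  by rewrite edot_eq0 h ?mem_head ?orbT.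
by move=> t ht; exists (Z + t *: a).
Qed.

End Lines.

(** * Division of alternating sums by products of linear forms *)

Section Division.
Variables (R : realType) (d : nat).
Implicit Types (X Y p q a b : 'cV[R]_d) (N : 'M[R]_d).

(** The orthogonal projection onto the hyperplane orthogonal to [b]. *)
Definition hproj b : 'M[R]_d := 2^-1 *: (1%:M + reflection_mx b).

Lemma hprojE b X : b != 0 -> hproj b *m X = X - (edot b X / edot b b) *: b.
Proof.
move=> b0; rewrite -scalemxAl mulmxDl mul1mx refl_mxE addrA scalerBr scalerA.
congr (_ - _ *: _); last by field; rewrite edot_eq0.
by rewrite -mulr2n -[X *+ 2]scaler_nat scalerA mulVf ?scale1r // pnatr_eq0.
Qed.

Lemma hproj_edot b X Y : edot (hproj b *m X) Y = edot X (hproj b *m Y).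
Proof.
have hT : (hproj b)^T = hproj b.
  by rewrite /hproj linearZ /= linearD /= trmx1 refl_mxT.
by rewrite edot_mx hT.
Qed.

Lemma hproj_avg b X Y :
  edot X (hproj b *m Y) = (edot X Y + edot X (reflection_mx b *m Y)) / 2.
Proof. by rewrite -scalemxAl mulmxDl mul1mx edotZr edotDr mulrC. Qed.

Lemma hproj_contract b X : b != 0 -> enorm (hproj b *m X) <= enorm X.
Proof.
move=> b0; rewrite ler_sqrt ?edot_ge0 // hprojE // edot_sq edotZl !edotZr.
rewrite divfK ?edot_eq0 // (edotC X b) -subr_ge0.
have -> : forall x y z : R, x - (x + y - 2 * z) = 2 * z - y by move=> x y z; ring.
have -> : 2 * (edot b X / edot b b * edot b X) - edot b X / edot b b * edot b X =
   edot b X ^+ 2 / edot b b by field; rewrite edot_eq0.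
by rewrite divr_ge0 ?sqr_ge0 ?edot_ge0.
Qed.

Variables (G : seq 'M[R]_d) (T : seq 'cV[R]_d) (M rho h : R).
Hypothesis uG : uniq G.
Hypothesis G_ortho : forall w, w \in G -> orth_mx w.
Hypothesis T_neq0 : forall b, b \in T -> b != 0.
Hypothesis G_left : forall b w, b \in T -> w \in G -> reflection_mx b *m w \in G.
Hypothesis G_right : forall b w, b \in T -> w \in G -> w *m reflection_mx b \in G.
Hypothesis T_gen : forall a b, a \in T -> b \in T -> a != b -> hproj b *m a != 0.
Hypothesis h_ge0 : 0 <= h.
Hypothesis rho_ge0 : 0 <= rho.
Hypothesis T_h : forall b, b \in T -> (enorm b)^-1 <= h.

(** The maximum of [1] and of the forms [<X, wY> + M]; the floor [1] makes it
    dominate the factors produced by the divisions. *)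
Definition gmax X Y := \big[Num.max/1]_(w <- G) (edot X (w *m Y) + M).

Lemma gmax_ge1 X Y : 1 <= gmax X Y.
Proof.
rewrite /gmax; elim: G => [|w L IH]; first by rewrite big_nil.
by rewrite big_cons le_max IH orbT.
Qed.

Lemma gmax_ge w X Y : w \in G -> edot X (w *m Y) + M <= gmax X Y.
Proof.
rewrite /gmax; elim: G => // u L IH; rewrite inE big_cons le_max.
by case/predU1P => [->|/IH ->]; rewrite ?lexx // orbT.
Qed.

Lemma gmax_le m X Y : 1 <= m -> (forall w, w \in G -> edot X (w *m Y) + M <= m) ->
  gmax X Y <= m.
Proof.
move=> m1; rewrite /gmax; elim: G => [|u L IH] H; first by rewrite big_nil.
rewrite big_cons ge_max H ?mem_head //= IH // => w wL.
by apply: H; rewrite inE wL orbT.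
Qed.

(** The matrices [N] whose bilinear forms share the bounds of the elements of
    [G]; unlike [G], this set is stable under the projections. *)
Definition adm N :=
  (forall X Y, `|edot X (N *m Y)| <= enorm X * enorm Y) /\
  (forall X Y, edot X (N *m Y) + M <= gmax X Y).

Lemma adm_G w : w \in G -> adm w.
Proof.
move=> wG; split => X Y; last exact: gmax_ge.
by apply: (le_trans (cauchy_schwarz _ _)); rewrite (enorm_ortho _ (G_ortho wG)).
Qed.

Lemma gmax_projl b X Y : b \in T -> gmax (hproj b *m X) Y <= gmax X Y.
Proof.
move=> bT; apply: gmax_le => [|w wG]; first exact: gmax_ge1.
rewrite hproj_edot hproj_avg mulmxA.
have := gmax_ge X Y wG; have := gmax_ge X Y (G_left bT wG); lra.
Qed.

Lemma gmax_projr b X Y : b \in T -> gmax X (hproj b *m Y) <= gmax X Y.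
Proof.
move=> bT; apply: gmax_le => [|w wG]; first exact: gmax_ge1.
rewrite edot_mx hproj_avg -!edot_mx mulmxA.
have := gmax_ge X Y wG; have := gmax_ge X Y (G_right bT wG); lra.
Qed.

Lemma adm_projl b N : b \in T -> adm N -> adm (hproj b *m N).
Proof.
move=> bT [h1 h2]; split => X Y; rewrite -mulmxA -hproj_edot.
  by apply: (le_trans (h1 _ _)); rewrite ler_wpM2r ?enorm_ge0 ?hproj_contract ?T_neq0.
by apply: (le_trans (h2 _ _)); apply: gmax_projl.
Qed.

Lemma adm_projr b N : b \in T -> adm N -> adm (N *m hproj b).
Proof.
move=> bT [h1 h2]; split => X Y; rewrite -mulmxA.
  by apply: (le_trans (h1 _ _)); rewrite ler_wpM2l ?enorm_ge0 ?hproj_contract ?T_neq0.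
by apply: (le_trans (h2 _ _)); apply: gmax_projr.
Qed.

(** The factor by which a division multiplies the bound of a factor, on the
    ball of radius [rho]; [h] bounds the inverse lengths of the divisors. *)
Definition divC := 1 + h ^+ 2 + 2 * h * rho.

Lemma divC_ge1 : 1 <= divC.
Proof.
by rewrite /divC -addrA lerDl addr_ge0 ?sqr_ge0 // !mulr_ge0.
Qed.

(** [good n c f]: the function [f] is a combination of products of [n] affine
    forms in [X] and [Y]. A factor is either of the kind [<X, N Y> + M], which
    [gmax] bounds, or of the kind produced by dividing such a factor by
    linear forms; [c] records a bound of [f] by [c * gmax ^+ n] on the ball of
    radius [rho]. *)
Inductive good : nat -> R -> ('cV[R]_d -> 'cV[R]_d -> R) -> Prop :=
| good_one : good 0 1 (fun _ _ => 1)
| good_form N n c f : adm N -> good n c f ->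
    good n.+1 c (fun X Y => (edot X (N *m Y) + M) * f X Y)
| good_low k p q n c f : `|k| <= h ^+ 2 -> enorm p <= h -> enorm q <= h ->
    good n c f ->
    good n.+1 (divC * c) (fun X Y => (k + edot p X + edot q Y) * f X Y)
| good_zero n : good n 0 (fun _ _ => 0)
| good_add n c1 c2 f1 f2 : good n c1 f1 -> good n c2 f2 ->
    good n (c1 + c2) (fun X Y => f1 X Y + f2 X Y)
| good_scale n c k f : `|k| <= 1 -> good n c f ->
    good n c (fun X Y => k * f X Y)
| good_weak n c c' f : c <= c' -> good n c f -> good n c' f.

Lemma good_ge0 n c f : good n c f -> 0 <= c.
Proof.
elim => //.
- by move=> *; rewrite mulr_ge0 // (le_trans _ divC_ge1).
- by move=> *; rewrite addr_ge0.
- by move=> {}n {}c c' {}f cc' _ /le_trans; apply.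
Qed.

Lemma good_bound n c f X Y : enorm X <= rho -> enorm Y <= rho -> rho ^+ 2 <= M ->
  good n c f -> `|f X Y| <= c * gmax X Y ^+ n.
Proof.
move=> Xr Yr rM; have g1 := gmax_ge1 X Y.
have g0 : 0 <= gmax X Y by apply: le_trans g1.
elim => {n c f}.
- by rewrite normr1 mulr1.
- move=> N n c f [h1 h2] gf IH; rewrite normrM exprS mulrCA ler_pM //.
  have := h1 X Y; rewrite ler_norml => /andP[h3 _].
  rewrite ler_norml (h2 X Y) andbT.
  have : enorm X * enorm Y <= rho * rho by rewrite ler_pM ?enorm_ge0.
  rewrite expr2 in rM; lra.
- move=> k p q n c f hk hp hq gf IH; rewrite normrM exprS mulrACA ler_pM //.
  have e1 : `|edot p X| <= h * rho.
    by apply: (le_trans (cauchy_schwarz _ _)); rewrite ler_pM ?enorm_ge0.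
  have e2 : `|edot q Y| <= h * rho.
    by apply: (le_trans (cauchy_schwarz _ _)); rewrite ler_pM ?enorm_ge0.
  apply: (@le_trans _ _ divC); last first.
    by rewrite -[leLHS]mulr1 ler_wpM2l // (le_trans _ divC_ge1).
  apply: (le_trans (ler_normD _ _)); apply: (le_trans (lerD (ler_normD _ _) (lexx _))).
  rewrite /divC; lra.
- by move=> n; rewrite normr0 mul0r.
- move=> n c1 c2 f1 f2 _ IH1 _ IH2; rewrite mulrDl.
  exact: le_trans (ler_normD _ _) (lerD IH1 IH2).
- move=> n c k f k1 _ IH; rewrite normrM -[leRHS]mul1r ler_pM //.
- move=> n c c' f cc' _ IH; apply: (le_trans IH).
  by rewrite ler_wpM2r // exprn_ge0.
Qed.

Lemma good_cvg n c f (A : Type) (F : set_system A) (FF : Filter F) (x y : A -> 'cV[R]_d) X Y :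
  good n c f -> x t @[t --> F] --> X -> y t @[t --> F] --> Y ->
  f (x t) (y t) @[t --> F] --> f X Y.
Proof.
move=> + hx hy; elim => {n c f}.
- exact: cvg_cst.
- move=> N n c f _ _ IH; apply: cvgM => //; apply: cvgD; last exact: cvg_cst.
  exact: cvg_edot_mx.
- move=> k p q n c f _ _ _ _ IH; apply: cvgM => //; apply: cvgD; [apply: cvgD|].
  + exact: cvg_cst.
  + by apply: cvg_edot => //; apply: cvg_cst.
  + by apply: cvg_edot => //; apply: cvg_cst.
- by move=> *; apply: cvg_cst.
- by move=> *; apply: cvgD.
- by move=> *; apply: cvgM => //; apply: cvg_cst.
- by [].
Qed.

Lemma good_sum n (f : 'M[R]_d -> 'cV[R]_d -> 'cV[R]_d -> R) (L : seq 'M[R]_d) :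
  (forall w, w \in L -> good n 1 (f w)) ->
  good n (size L)%:R (fun X Y => \sum_(w <- L) f w X Y).
Proof.
elim: L => [|w L IH] H /=.
  suff -> : (fun X Y => \sum_(w <- [::]) f w X Y) = (fun _ _ => 0) by apply: good_zero.
  by apply/funext => X; apply/funext => Y; rewrite big_nil.
have -> : (fun X Y => \sum_(u <- w :: L) f u X Y) =
    (fun X Y => f w X Y + \sum_(u <- L) f u X Y).
  by apply/funext => X; apply/funext => Y; rewrite big_cons.
rewrite -natr1 addrC; apply: good_add; first exact/H/mem_head.
by apply: IH => u uL; apply: H; rewrite inE uL orbT.
Qed.

Let enorm_divsq p k b : b \in T -> 0 <= k -> enorm p <= k * enorm b ->
  enorm ((edot b b)^-1 *: p) <= k * h.
Proof.
move=> bT k0 pb; have b0 : 0 < enorm b by rewrite lt_neqAle eq_sym enorm_eq0 T_neq0 //= enorm_ge0.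
have -> : enorm ((edot b b)^-1 *: p) = enorm p / enorm b ^+ 2.
  apply/eqP; rewrite -(@eqrXn2 _ 2) ?divr_ge0 ?exprn_ge0 ?enorm_ge0 //.
  rewrite exprMn exprVn !enorm_sq edotZl edotZr; apply/eqP.
  by field; rewrite edot_eq0 T_neq0.
rewrite ler_pdivrMr ?exprn_gt0 // (le_trans pb) //.
rewrite -mulrA ler_wpM2l // expr2 mulrA ler_peMl ?enorm_ge0 //.
by rewrite -ler_pdivrMr // div1r T_h.
Qed.

Let enorm_mx N b : (forall X Y, `|edot X (N *m Y)| <= enorm X * enorm Y) ->
  enorm (N *m b) <= enorm b.
Proof.
move=> hN; have [->|n0] := eqVneq (enorm (N *m b)) 0; first exact: enorm_ge0.
have n1 : 0 < enorm (N *m b) by rewrite lt_neqAle eq_sym n0 enorm_ge0.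
rewrite -(ler_pM2l n1) -expr2 enorm_sq.
exact: le_trans (ler_norm _) (hN _ _).
Qed.

Let enorm_tmx N b : (forall X Y, `|edot X (N *m Y)| <= enorm X * enorm Y) ->
  enorm (N^T *m b) <= enorm b.
Proof.
move=> hN; apply: enorm_mx => X Y.
by rewrite edot_mx trmxK edotC mulrC.
Qed.

Let edot_divsq p k b : b \in T -> 0 <= k -> enorm p <= k -> `|edot p b / edot b b| <= k * h.
Proof.
move=> bT k0 pk; have b0 : 0 < enorm b by rewrite lt_neqAle eq_sym enorm_eq0 T_neq0 //= enorm_ge0.
rewrite normrM normfV (ger0_norm (edot_ge0 b)) ler_pdivrMr ?edot_gt0 ?T_neq0 //.
apply: (le_trans (cauchy_schwarz _ _)); rewrite -enorm_sq.
have : 1 <= h * enorm b by rewrite -ler_pdivrMr // div1r T_h.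
move=> hb; apply: (@le_trans _ _ (k * enorm b)); first by rewrite ler_wpM2r ?enorm_ge0.
have -> : k * h * enorm b ^+ 2 = k * enorm b * (h * enorm b) by ring.
by rewrite ler_peMr // mulr_ge0 ?enorm_ge0.
Qed.

(** The difference between [f] and its composite with the projection along [b]
    is divisible by [<b, X>], within the class [good]: telescoping a product
    replaces one factor at a time by its own divided difference. *)
Lemma good_divX n c f b : b \in T -> good n c f -> exists2 g,
  good n (n%:R * divC * c) g &
  forall X Y, f X Y - f (hproj b *m X) Y = edot b X * g X Y.
Proof.
move=> bT; have b0 := T_neq0 bT; have C1 := divC_ge1.
have h2 : 0 <= h ^+ 2 by apply: sqr_ge0.
elim => {n c f}.
- exists (fun _ _ => 0); first by rewrite !mul0r; apply: good_zero.
  by move=> X Y; rewrite subrr mulr0.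
- move=> N n c f [N1 N2] gf [g gg E].
  have gP : adm (hproj b *m N) by apply: adm_projl.
  exists (fun X Y => (0 + edot 0 X + edot ((edot b b)^-1 *: (N^T *m b)) Y) * f X Y
                     + (edot X (hproj b *m N *m Y) + M) * g X Y).
    apply: (@good_weak _ (divC * c + n%:R * divC * c)).
      by rewrite -natr1; lra.
    apply: good_add; last exact: good_form.
    apply: good_low => //.
    + by rewrite normr0.
    + by rewrite /enorm edot0l sqrtr0.
    + by rewrite -[leRHS]mul1r; apply: enorm_divsq; rewrite // mul1r enorm_tmx.
  move=> X Y; rewrite edot0l !add0r mulrDr [X in _ = _ + X]mulrCA -E -mulmxA -hproj_edot.
  have -> : edot X (N *m Y) = edot (hproj b *m X) (N *m Y) +
     edot b X * edot ((edot b b)^-1 *: (N^T *m b)) Y.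
    by rewrite hprojE // edotBl !edotZl -edot_mx; ring.
  ring.
- move=> k p q n c f hk hp hq gf [g gg E].
  exists (fun X Y => (edot p b / edot b b + edot 0 X + edot 0 Y) * f X Y
                     + (k + edot (hproj b *m p) X + edot q Y) * g X Y).
    apply: (@good_weak _ (divC * c + divC * (n%:R * divC * c))).
      have := good_ge0 gf; have : 0 <= n%:R :> R by []; rewrite -natr1.
      move: (n%:R : R) divC C1 => m D D1 m0 c0.
      have : D * c <= D * (D * c) by rewrite ler_peMl // mulr_ge0 //; lra.
      lra.
    apply: good_add; apply: good_low => //.
    + by rewrite expr2; apply: edot_divsq.
    + by rewrite /enorm edot0l sqrtr0.
    + by rewrite /enorm edot0l sqrtr0.
    + by apply: le_trans hp; apply: hproj_contract.
  move=> X Y; rewrite !edot0l !addr0 mulrDr [X in _ = _ + X]mulrCA -E hproj_edot.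
  have -> : edot p X = edot p (hproj b *m X) + edot b X * (edot p b / edot b b).
    by rewrite hprojE // edotBr edotZr; ring.
  ring.
- move=> n; exists (fun _ _ => 0); first by rewrite mulr0; apply: good_zero.
  by move=> X Y; rewrite subrr mulr0.
- move=> n c1 c2 f1 f2 _ [g1 gg1 E1] _ [g2 gg2 E2].
  exists (fun X Y => g1 X Y + g2 X Y); first by rewrite mulrDr; apply: good_add.
  by move=> X Y; rewrite mulrDr -E1 -E2; ring.
- move=> n c k f k1 _ [g gg E]; exists (fun X Y => k * g X Y); first exact: good_scale.
  by move=> X Y; rewrite mulrCA -E; ring.
- move=> n c c' f cc' _ [g gg E]; exists g => //.
  by apply: good_weak gg; rewrite ler_wpM2l // mulr_ge0 // (le_trans _ C1).
Qed.

Lemma good_divY n c f b : b \in T -> good n c f -> exists2 g,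
  good n (n%:R * divC * c) g &
  forall X Y, f X Y - f X (hproj b *m Y) = edot b Y * g X Y.
Proof.
move=> bT; have b0 := T_neq0 bT; have C1 := divC_ge1.
have h2 : 0 <= h ^+ 2 by apply: sqr_ge0.
elim => {n c f}.
- exists (fun _ _ => 0); first by rewrite !mul0r; apply: good_zero.
  by move=> X Y; rewrite subrr mulr0.
- move=> N n c f [N1 N2] gf [g gg E].
  have gP : adm (N *m hproj b) by apply: adm_projr.
  exists (fun X Y => (0 + edot ((edot b b)^-1 *: (N *m b)) X + edot 0 Y) * f X Y
                     + (edot X (N *m hproj b *m Y) + M) * g X Y).
    apply: (@good_weak _ (divC * c + n%:R * divC * c)).
      by rewrite -natr1; lra.
    apply: good_add; last exact: good_form.
    apply: good_low => //.
    + by rewrite normr0.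
    + by rewrite -[leRHS]mul1r; apply: enorm_divsq; rewrite // mul1r enorm_mx.
    + by rewrite /enorm edot0l sqrtr0.
  move=> X Y; rewrite edot0l !addr0 !add0r mulrDr [X in _ = _ + X]mulrCA -E -mulmxA.
  have -> : edot X (N *m Y) = edot X (N *m (hproj b *m Y)) +
     edot b Y * edot ((edot b b)^-1 *: (N *m b)) X.
    rewrite hprojE // mulmxBr -scalemxAr edotBr edotZr edotZl (edotC _ X); ring.
  ring.
- move=> k p q n c f hk hp hq gf [g gg E].
  exists (fun X Y => (edot q b / edot b b + edot 0 X + edot 0 Y) * f X Y
                     + (k + edot p X + edot (hproj b *m q) Y) * g X Y).
    apply: (@good_weak _ (divC * c + divC * (n%:R * divC * c))).
      have := good_ge0 gf; have : 0 <= n%:R :> R by []; rewrite -natr1.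
      move: (n%:R : R) divC C1 => m D D1 m0 c0.
      have : D * c <= D * (D * c) by rewrite ler_peMl // mulr_ge0 //; lra.
      lra.
    apply: good_add; apply: good_low => //.
    + by rewrite expr2; apply: edot_divsq.
    + by rewrite /enorm edot0l sqrtr0.
    + by rewrite /enorm edot0l sqrtr0.
    + by apply: le_trans hq; apply: hproj_contract.
  move=> X Y; rewrite !edot0l !addr0 mulrDr [X in _ = _ + X]mulrCA -E hproj_edot.
  have -> : edot q Y = edot q (hproj b *m Y) + edot b Y * (edot q b / edot b b).
    by rewrite hprojE // edotBr edotZr; ring.
  ring.
- move=> n; exists (fun _ _ => 0); first by rewrite mulr0; apply: good_zero.
  by move=> X Y; rewrite subrr mulr0.
- move=> n c1 c2 f1 f2 _ [g1 gg1 E1] _ [g2 gg2 E2].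
  exists (fun X Y => g1 X Y + g2 X Y); first by rewrite mulrDr; apply: good_add.
  by move=> X Y; rewrite mulrDr -E1 -E2; ring.
- move=> n c k f k1 _ [g gg E]; exists (fun X Y => k * g X Y); first exact: good_scale.
  by move=> X Y; rewrite mulrCA -E; ring.
- move=> n c c' f cc' _ [g gg E]; exists g => //.
  by apply: good_weak gg; rewrite ler_wpM2l // mulr_ge0 // (le_trans _ C1).
Qed.

(** A function of class [good] that vanishes on the hyperplanes orthogonal to
    the elements of [T'] is divisible by their product: a quotient by the
    first factors still vanishes on the next hyperplane, by density. *)
Lemma good_factorX n c f (T' : seq 'cV[R]_d) : {subset T' <= T} -> uniq T' ->
  good n c f ->
  (forall b X Y, b \in T' -> edot b X = 0 -> f X Y = 0) ->
  exists2 g, good n ((n%:R * divC) ^+ size T' * c) g &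
  forall X Y, f X Y = \prod_(b <- T') edot b X * g X Y.
Proof.
elim: T' => [|b T' IH] sT uT gf f0 /=.
  by exists f; rewrite ?expr0 ?mul1r // => X Y; rewrite big_nil mul1r.
have bT : b \in T by apply: sT; rewrite mem_head.
have sT' : {subset T' <= T} by move=> x xT; apply: sT; rewrite inE xT orbT.
move: uT => /= /andP[bT' uT'].
have [g gg E] := IH sT' uT' gf (fun x X Y xT => f0 x X Y (@mem_behead _ (b :: T') x xT)).
have [g' gg' E'] := good_divX bT gg.
exists g'; first by rewrite exprS -mulrA.
move=> X Y; rewrite E big_cons (mulrC (edot b X)) -mulrA -E'.
suff -> : g (hproj b *m X) Y = 0 by rewrite subr0.
set X' := hproj b *m X.
have bX' : edot b X' = 0.
  by rewrite /X' hprojE ?T_neq0 // edotBr edotZr divfK ?edot_eq0 ?T_neq0 // subrr.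
have [Z hZ] : exists Z, forall a, a \in [seq hproj b *m a | a <- T'] -> edot a Z != 0.
  apply: exists_generic => _ /mapP[a aT' ->]; apply: T_gen => //; first exact: sT'.
  by apply: contraNneq bT' => <-.
pose Z' := hproj b *m Z.
have bZ' : edot b Z' = 0.
  by rewrite /Z' hprojE ?T_neq0 // edotBr edotZr divfK ?edot_eq0 ?T_neq0 // subrr.
have near0 : \forall t \near (0 : R)^'+, g (X' + t *: Z') Y = 0.
  have : \forall t \near (0 : R)^'+, forall a, a \in T' -> edot a (X' + t *: Z') != 0.
    apply: near_line_neq0 => a aT'.
    by rewrite /Z' -hproj_edot hZ ?orbT // map_f.
  apply: filterS => t ht.
  have : \prod_(a <- T') edot a (X' + t *: Z') * g (X' + t *: Z') Y = 0.
    by rewrite -E (f0 b) ?mem_head // edotDr edotZr bX' bZ' mulr0 addr0.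
  move/eqP; rewrite mulf_eq0 => /orP[|/eqP //].
  by rewrite prodf_seq_eq0 => /hasP[a /ht /negPf] /= ->.
have lim1 : g (X' + t *: Z') Y @[t --> (0 : R)^'+] --> g X' Y.
  apply: (@good_cvg _ _ _ _ ((0 : R)^'+) _ (fun t => X' + t *: Z') (fun=> Y) X' Y gg); last exact: cvg_cst.
  exact: cvg_line.
have lim2 : g (X' + t *: Z') Y @[t --> (0 : R)^'+] --> (0 : R).
  by apply: cvg_near_cst.
exact: (cvg_unique _ lim1 lim2).
Qed.

Lemma good_factorY n c f (T' : seq 'cV[R]_d) : {subset T' <= T} -> uniq T' ->
  good n c f ->
  (forall b X Y, b \in T' -> edot b Y = 0 -> f X Y = 0) ->
  exists2 g, good n ((n%:R * divC) ^+ size T' * c) g &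
  forall X Y, f X Y = \prod_(b <- T') edot b Y * g X Y.
Proof.
elim: T' => [|b T' IH] sT uT gf f0 /=.
  by exists f; rewrite ?expr0 ?mul1r // => X Y; rewrite big_nil mul1r.
have bT : b \in T by apply: sT; rewrite mem_head.
have sT' : {subset T' <= T} by move=> x xT; apply: sT; rewrite inE xT orbT.
move: uT => /= /andP[bT' uT'].
have [g gg E] := IH sT' uT' gf (fun x X Y xT => f0 x X Y (@mem_behead _ (b :: T') x xT)).
have [g' gg' E'] := good_divY bT gg.
exists g'; first by rewrite exprS -mulrA.
move=> X Y; rewrite E big_cons (mulrC (edot b Y)) -mulrA -E'.
suff -> : g X (hproj b *m Y) = 0 by rewrite subr0.
set Y' := hproj b *m Y.
have bY' : edot b Y' = 0.
  by rewrite /Y' hprojE ?T_neq0 // edotBr edotZr divfK ?edot_eq0 ?T_neq0 // subrr.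
have [Z hZ] : exists Z, forall a, a \in [seq hproj b *m a | a <- T'] -> edot a Z != 0.
  apply: exists_generic => _ /mapP[a aT' ->]; apply: T_gen => //; first exact: sT'.
  by apply: contraNneq bT' => <-.
pose Z' := hproj b *m Z.
have bZ' : edot b Z' = 0.
  by rewrite /Z' hprojE ?T_neq0 // edotBr edotZr divfK ?edot_eq0 ?T_neq0 // subrr.
have near0 : \forall t \near (0 : R)^'+, g X (Y' + t *: Z') = 0.
  have : \forall t \near (0 : R)^'+, forall a, a \in T' -> edot a (Y' + t *: Z') != 0.
    apply: near_line_neq0 => a aT'.
    by rewrite /Z' -hproj_edot hZ ?orbT // map_f.
  apply: filterS => t ht.
  have : \prod_(a <- T') edot a (Y' + t *: Z') * g X (Y' + t *: Z') = 0.
    by rewrite -E (f0 b) ?mem_head // edotDr edotZr bY' bZ' mulr0 addr0.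
  move/eqP; rewrite mulf_eq0 => /orP[|/eqP //].
  by rewrite prodf_seq_eq0 => /hasP[a /ht /negPf] /= ->.
have lim1 : g X (Y' + t *: Z') @[t --> (0 : R)^'+] --> g X Y'.
  apply: (@good_cvg _ _ _ _ ((0 : R)^'+) _ (fun=> X) (fun t => Y' + t *: Z') X Y' gg); first exact: cvg_cst.
  exact: cvg_line.
have lim2 : g X (Y' + t *: Z') @[t --> (0 : R)^'+] --> (0 : R).
  by apply: cvg_near_cst.
exact: (cvg_unique _ lim1 lim2).
Qed.

Lemma good_prod n N : adm N -> good n 1 (fun X Y => (edot X (N *m Y) + M) ^+ n).
Proof.
move=> aN; elim: n => [|n IH].
  by under eq_fun do under eq_fun do rewrite expr0; apply: good_one.
under eq_fun do under eq_fun do rewrite exprS.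
exact: good_form.
Qed.

(** The alternating sum over [G] of the powers of [<X, wY> + M]. *)
Definition alt_pow n X Y := \sum_(w <- G) \det w * (edot X (w *m Y) + M) ^+ n.

Lemma alt_pow_good n : good n (size G)%:R (alt_pow n).
Proof.
apply: (good_sum (f := fun w X Y => \det w * (edot X (w *m Y) + M) ^+ n)) => w wG.
apply: good_scale; last exact/good_prod/adm_G.
have : \det w ^+ 2 = 1.
  by rewrite expr2 -[X in X * _](det_tr w) -det_mulmx (G_ortho wG) det1.
by move/eqP; rewrite sqrf_eq1 => /orP[]/eqP ->; rewrite ?normrN normr1.
Qed.

Let perm_left b : b \in T -> perm_eq [seq reflection_mx b *m w | w <- G] G.
Proof.
move=> bT; have K := refl_mxK (T_neq0 bT).
have inj : injective (mulmx (reflection_mx b) : 'M[R]_d -> 'M[R]_d).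
  by apply: (@can_inj _ _ _ (mulmx (reflection_mx b))) => w; rewrite mulmxA K mul1mx.
apply: uniq_perm; rewrite ?map_inj_uniq // => w.
apply/mapP/idP => [[u uG' ->]|wG]; first exact: G_left.
by exists (reflection_mx b *m w); [exact: G_left | rewrite mulmxA K mul1mx].
Qed.

Let perm_right b : b \in T -> perm_eq [seq w *m reflection_mx b | w <- G] G.
Proof.
move=> bT; have K := refl_mxK (T_neq0 bT).
have inj : injective (mulmx^~ (reflection_mx b) : 'M[R]_d -> 'M[R]_d).
  by apply: (@can_inj _ _ _ (mulmx^~ (reflection_mx b))) => w; rewrite -mulmxA K mulmx1.
apply: uniq_perm; rewrite ?map_inj_uniq // => w.
apply/mapP/idP => [[u uG' ->]|wG]; first exact: G_right.
by exists (w *m reflection_mx b); [exact: G_right | rewrite -mulmxA K mulmx1].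
Qed.

Lemma alt_pow_wallX n b X Y : b \in T -> edot b X = 0 -> alt_pow n X Y = 0.
Proof.
move=> bT bX; have : alt_pow n X Y = - alt_pow n X Y.
  rewrite {2}/alt_pow -(perm_big _ (perm_left bT)) big_map -sumrN /=.
  apply: eq_bigr => w _; rewrite det_mulmx det_refl ?T_neq0 // mulN1r mulNr opprK.
  rewrite -mulmxA (edot_mx (reflection_mx b)) refl_mxT [_ *m X]refl_mxE bX.
  by rewrite mulr0 mul0r scale0r subr0.
by move=> /eqP; rewrite -addr_eq0 -mulr2n mulrn_eq0 /= => /eqP.
Qed.

Lemma alt_pow_wallY n b X Y : b \in T -> edot b Y = 0 -> alt_pow n X Y = 0.
Proof.
move=> bT bY; have : alt_pow n X Y = - alt_pow n X Y.
  rewrite {2}/alt_pow -(perm_big _ (perm_right bT)) big_map -sumrN /=.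
  apply: eq_bigr => w _; rewrite det_mulmx det_refl ?T_neq0 // mulrN1 mulNr opprK.
  rewrite -mulmxA [reflection_mx b *m Y]refl_mxE bY.
  by rewrite mulr0 mul0r scale0r subr0.
by move=> /eqP; rewrite -addr_eq0 -mulr2n mulrn_eq0 /= => /eqP.
Qed.

Hypothesis uT : uniq T.

(** The alternating sum of powers is divisible by the linear forms of [T] in
    each variable; the quotient is continuous and grows with [n] at most like
    [gmax ^+ n] times a polynomial in [n]. *)
Lemma alt_pow_division n : exists B : 'cV[R]_d -> 'cV[R]_d -> R,
  [/\ forall X Y, alt_pow n X Y =
        \prod_(b <- T) edot b X * \prod_(b <- T) edot b Y * B X Y,
      forall (A : Type) (F : set_system A) (x y : A -> 'cV[R]_d) X Y, Filter F ->
        x t @[t --> F] --> X -> y t @[t --> F] --> Y ->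
        B (x t) (y t) @[t --> F] --> B X Y &
      forall X Y, enorm X <= rho -> enorm Y <= rho -> rho ^+ 2 <= M ->
        `|B X Y| <= (n%:R * divC) ^+ (2 * size T) * (size G)%:R * gmax X Y ^+ n].
Proof.
have [g1 gg1 E1] := good_factorX (fun b bT => bT) uT (alt_pow_good n)
  (fun b X Y bT bX => alt_pow_wallX n Y bT bX).
have g10 b X Y : b \in T -> edot b Y = 0 -> g1 X Y = 0.
  move=> bT bY; have [Z hZ] := exists_generic T_neq0.
  have near0 : \forall t \near (0 : R)^'+, g1 (X + t *: Z) Y = 0.
    have : \forall t \near (0 : R)^'+, forall a, a \in T -> edot a (X + t *: Z) != 0.
      by apply: near_line_neq0 => a aT; rewrite hZ ?orbT.
    apply: filterS => t ht.
    have : \prod_(a <- T) edot a (X + t *: Z) * g1 (X + t *: Z) Y = 0.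
      by rewrite -E1 (alt_pow_wallY _ _ bT).
    move/eqP; rewrite mulf_eq0 => /orP[|/eqP //].
    by rewrite prodf_seq_eq0 => /hasP[a /ht /negPf] /= ->.
  have lim1 : g1 (X + t *: Z) Y @[t --> (0 : R)^'+] --> g1 X Y.
    apply: (@good_cvg _ _ _ _ ((0 : R)^'+) _ (fun t => X + t *: Z) (fun=> Y) X Y gg1); last exact: cvg_cst.
    exact: cvg_line.
  have lim2 : g1 (X + t *: Z) Y @[t --> (0 : R)^'+] --> (0 : R).
    by apply: cvg_near_cst.
  exact: (cvg_unique _ lim1 lim2).
have [g2 gg2 E2] := good_factorY (fun b bT => bT) uT gg1 g10.
exists g2; split.
- by move=> X Y; rewrite E1 E2 mulrA.
- by move=> A F x y X Y FF hx hy; apply: (good_cvg FF gg2).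
- move=> X Y hX hY rM; apply: (le_trans (good_bound hX hY rM gg2)).
  by rewrite mul2n -addnn exprD -!mulrA.
Qed.
End Division.

(** * Series dominated by a geometric series *)

Section Series.
Variable R : realType.
Implicit Types (u v : nat -> R) (C r x : R).

Lemma cvg_seriesD u v (a b : R) : series u @ \oo --> a -> series v @ \oo --> b ->
  series (fun n => u n + v n) @ \oo --> a + b.
Proof.
move=> ua vb; have -> : series (fun n => u n + v n) = (fun n => series u n + series v n).
  by apply/funext => n; rewrite /series /= big_split.
exact: cvgD.
Qed.

Lemma cvg_seriesZ u (k a : R) : series u @ \oo --> a ->
  series (fun n => k * u n) @ \oo --> k * a.
Proof.
move=> ua; have -> : series (fun n => k * u n) = (fun n => k * series u n).
  by apply/funext => n; rewrite /series /= mulr_sumr.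
by apply: cvgM => //; exact: cvg_cst.
Qed.

Lemma cvg_series_bigsum (I : eqType) (s : seq I) (u : I -> nat -> R) (a : I -> R) :
  (forall i, i \in s -> series (u i) @ \oo --> a i) ->
  series (fun n => \sum_(i <- s) u i n) @ \oo --> \sum_(i <- s) a i.
Proof.
elim: s => [|i s IH] h.
  rewrite big_nil; under eq_fun do rewrite big_nil.
  have -> : series (fun=> 0 : R) = (fun=> 0).
    by apply/funext => n; rewrite /series /= big1.
  exact: cvg_cst.
rewrite big_cons; under eq_fun do rewrite big_cons.
apply: cvg_seriesD; first exact/h/mem_head.
by apply: IH => j js; apply: h; rewrite inE js orbT.
Qed.

Lemma geometric_tail C r N m : 0 <= C -> 0 <= r -> r < 1 ->
  \sum_(N <= k < m) C * r ^+ k <= C * r ^+ N / (1 - r).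
Proof.
move=> C0 r0 r1; have r1' : 0 < 1 - r by rewrite subr_gt0.
rewrite ler_pdivlMr //.
have [mN|/ltnW Nm] := leqP m N; first by rewrite big_geq // mul0r mulr_ge0 ?exprn_ge0.
suff -> : (\sum_(N <= k < m) C * r ^+ k) * (1 - r) = C * (r ^+ N - r ^+ m).
  by rewrite ler_wpM2l // gerBl exprn_ge0.
rewrite -(subnKC Nm); elim: (m - N)%N => [|k IH].
  by rewrite addn0 big_geq // mul0r subrr mulr0.
by rewrite addnS big_nat_recr ?leq_addr //= mulrDl IH exprS; ring.
Qed.

Section Dominated.
Variables (u : nat -> R) (C r : R).
Hypotheses (r0 : 0 <= r) (r1 : r < 1) (ub : forall n, `|u n| <= C * r ^+ n).

Let C0 : 0 <= C.
Proof. by have := ub 0; rewrite expr0 mulr1; apply: le_trans. Qed.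

Lemma geom_dominated_cvg : cvgn (series u).
Proof.
apply: normed_cvg; apply: (@series_le_cvg _ _ (geometric C r)) => // n.
- exact: normr_ge0.
- by rewrite mulr_ge0 // exprn_ge0.
- by apply: is_cvg_geometric_series; rewrite ger0_norm.
Qed.

Lemma geom_dominated_tail N : `|limn (series u) - series u N| <= C * r ^+ N / (1 - r).
Proof.
have h : `|limn (series u) - series u m| @[m --> \oo] --> (0 : R).
  have : `|limn (series u) - series u m| @[m --> \oo] --> `|limn (series u) - limn (series u)|.
    by apply: cvg_norm; apply: cvgB; [exact: cvg_cst | exact: geom_dominated_cvg].
  by rewrite subrr normr0.
have h2 : `|limn (series u) - series u m| + C * r ^+ N / (1 - r) @[m --> \oo] -->
    0 + C * r ^+ N / (1 - r) by apply: cvgD => //; exact: cvg_cst.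
rewrite add0r in h2; rewrite -(cvg_lim (@norm_hausdorff _ _) h2).
apply: limr_ge; first by apply/cvg_ex; eexists; exact: h2.
near=> m.
have Nm : (N <= m)%N by near: m; exact: nbhs_infty_ge.
rewrite -[X in `|X|](subrKA (series u m)); apply: (le_trans (ler_normD _ _)).
rewrite lerD2l; have -> : series u m - series u N = \sum_(N <= k < m) u k.
  by rewrite /series /= (big_cat_nat (leq0n N) Nm) /= addrAC subrr add0r.
apply: le_trans (geometric_tail N m C0 r0 r1).
apply: (le_trans (ler_norm_sum _ _ _)); exact: ler_sum.
Unshelve. all: by end_near. Qed.

End Dominated.

(** Passage to the limit under the sum of a series dominated by a geometric
    series. *)
Lemma cvg_series_dominated (A : Type) (F : set_system A) (FF : ProperFilter F)
    (f : nat -> A -> R) (l : nat -> R) (S : A -> R) C r :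
  0 <= r -> r < 1 -> (forall n, f n t @[t --> F] --> l n) ->
  (\forall t \near F, forall n, `|f n t| <= C * r ^+ n) ->
  (\forall t \near F, series (f^~ t) @ \oo --> S t) ->
  S t @[t --> F] --> limn (series l).
Proof.
move=> r0 r1 fl fb fS.
have lb n : `|l n| <= C * r ^+ n.
  have h : `|f n t| @[t --> F] --> `|l n| by apply: cvg_norm; apply: fl.
  rewrite -(cvg_lim (@norm_hausdorff _ _) h); apply: limr_le.
    by apply/cvg_ex; eexists; exact: h.
  by apply: filterS fb => t; apply.
have C0 : 0 <= C by have := lb 0; rewrite expr0 mulr1; apply: le_trans.
apply/cvgrPdist_lt => e e0.
have [N hN] : exists N, C * r ^+ N / (1 - r) < e / 3.
  have h : C * r ^+ n / (1 - r) @[n --> \oo] --> C * 0 / (1 - r).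
    apply: cvgM; last exact: cvg_cst.
    by apply: cvgM; [exact: cvg_cst | apply: cvg_expr; rewrite ger0_norm].
  rewrite mulr0 mul0r in h.
  have e3 : 0 < e / 3 by rewrite divr_gt0.
  have [n hn] := filter_ex (cvgr_lt _ h _ e3).
  by exists n.
have hs : series (f^~ t) N @[t --> F] --> series l N.
  by rewrite /series /=; apply: cvg_bigsum.
have e3 : 0 < e / 3 by rewrite divr_gt0.
have /cvgrPdist_lt /(_ _ e3) hs' := hs.
near=> t.
have b1 : `|limn (series l) - series l N| <= e / 3.
  by apply: le_trans (ltW hN); apply: geom_dominated_tail.
have b2 : `|S t - series (f^~ t) N| <= e / 3.
  apply: le_trans (ltW hN).
  have h : series (f^~ t) @ \oo --> S t by near: t.
  rewrite -(cvg_lim (@norm_hausdorff _ _) h); apply: geom_dominated_tail => //.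
  by near: t.
have b3 : `|series l N - series (f^~ t) N| < e / 3 by near: t.
have -> : limn (series l) - S t = (limn (series l) - series l N) +
   (series l N - series (f^~ t) N) - (S t - series (f^~ t) N) by ring.
apply: (le_lt_trans (ler_normB _ _)).
apply: (@le_lt_trans _ _ (`|limn (series l) - series l N| + `|series l N - series (f^~ t) N| +
   `|S t - series (f^~ t) N|)); first by rewrite lerD2r ler_normD.
lra.
Unshelve. all: by end_near. Qed.

(** A power of [n] is negligible with respect to any growing geometric
    sequence. *)
Lemma poly_le_geometric q (eta : R) : 1 < eta ->
  exists2 C, 0 <= C & forall n, n.+1%:R ^+ q <= C * eta ^+ n.
Proof.
move=> eta1.
have [dl [d0 d1 dq]] : exists dl : R, [/\ 0 < dl, dl <= 1 & (1 + dl) ^+ q <= eta].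
  have h : (1 + t) ^+ q @[t --> (0 : R)^'+] --> (1 + 0 : R) ^+ q.
    apply: cvg_pow; apply: cvgD; first exact: cvg_cst.
    exact: (cvg_at_right_filter (@cvg_id _ _)).
  rewrite addr0 expr1n in h.
  have h1 : \forall t \near (0 : R)^'+, (1 + t) ^+ q < eta by exact: (cvgr_lt _ h _ eta1).
  have h2 : \forall t \near (0 : R)^'+, t <= 1 by apply: nbhs_right_le.
  have h3 : \forall t \near (0 : R)^'+, 0 < t by apply: nbhs_right_gt.
  have [t [[t1 t2] t3]] := filter_ex (filterI (filterI h1 h2) h3).
  by exists t; split => //; apply: ltW.
exists (dl ^- q); first by rewrite invr_ge0 exprn_ge0 // ltW.
move=> n; rewrite mulrC ler_pdivlMr ?exprn_gt0 // -exprMn.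
apply: (@le_trans _ _ (((1 + dl) ^+ q) ^+ n)); last first.
  apply: lerXn2r => //; rewrite nnegrE; first by rewrite exprn_ge0 // addr_ge0 // ltW.
  by apply/ltW/(lt_trans ltr01).
rewrite -exprM mulnC exprM; apply: lerXn2r; rewrite ?nnegrE.
- by rewrite mulr_ge0 // ltW.
- by rewrite exprn_ge0 // addr_ge0 // ltW.
elim: n => [|n IH]; first by rewrite mul1r expr0.
rewrite -natr1 mulrDl mul1r exprSr.
apply: (@le_trans _ _ ((1 + dl) ^+ n + dl)); first by rewrite lerD2r.
rewrite mulrDr mulr1 lerD2l; apply: ler_peMl; first exact: ltW.
by apply: exprn_ege1; rewrite lerDl ltW.
Qed.

Lemma poly_dominated (c : nat -> R) (b : R) q x : `|x| < 1 ->
  (forall n, `|c n| <= b * n.+1%:R ^+ q) ->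
  exists C r, [/\ 0 <= r, r < 1 & forall n, `|c n * x ^+ n| <= C * r ^+ n].
Proof.
move=> x1 cb.
pose y := (`|x| + 1) / 2.
have y0 : 0 < y by rewrite /y; have := normr_ge0 x; lra.
have xy : `|x| < y by rewrite /y; lra.
have y1 : y < 1 by rewrite /y; lra.
have iy1 : 1 < y^-1 by rewrite invf_gt1.
have [C C0 hC] := poly_le_geometric q iy1.
have [->|x0] := eqVneq x 0.
  exists `|c 0|, 0; split => // -[|n]; first by rewrite !expr0 !mulr1.
  by rewrite !exprS !mul0r !mulr0 normr0.
exists (b * C), (`|x| / y); split.
- by rewrite divr_ge0 // ltW.
- by rewrite ltr_pdivrMr // mul1r.
- move=> n; rewrite normrM normrX expr_div_n mulrA [leRHS]mulrAC.
  rewrite ler_wpM2r ?exprn_ge0 //; apply: (le_trans (cb n)).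
  have b0 : 0 <= b by have := cb 0; rewrite expr1n mulr1; apply: le_trans.
  by rewrite -mulrA ler_wpM2l // -exprVn; apply: hC.
Qed.

Lemma poly_pseries_cvg (c : nat -> R) (b : R) q x : `|x| < 1 ->
  (forall n, `|c n| <= b * n.+1%:R ^+ q) -> cvgn (pseries c x).
Proof.
by move=> x1 /(poly_dominated x1)[C [r [r0 r1 h]]]; apply: (geom_dominated_cvg r0 r1 h).
Qed.

Lemma poly_pseries_diffs (c : nat -> R) (b : R) q :
  (forall n, `|c n| <= b * n.+1%:R ^+ q) ->
  forall n, `|pseries_diffs c n| <= (b * 2 ^+ q) * n.+1%:R ^+ q.+1.
Proof.
move=> cb n; have b0 : 0 <= b by have := cb 0; rewrite expr1n mulr1; apply: le_trans.
rewrite /pseries_diffs normrM ger0_norm // exprS mulrCA ler_wpM2l //.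
apply: (le_trans (cb _)); rewrite -mulrA ler_wpM2l // -exprMn.
by apply: lerXn2r; rewrite ?nnegrE ?mulr_ge0 // -natrM ler_nat; lia.
Qed.

Lemma poly_pseries_derive (c : nat -> R) (b : R) q x : `|x| < 1 ->
  (forall n, `|c n| <= b * n.+1%:R ^+ q) ->
  is_derive x (1 : R) (fun y : R => limn (pseries c y)) (limn (pseries (pseries_diffs c) x)).
Proof.
move=> x1 cb; pose K := (`|x| + 1) / 2.
have K1 : `|K| < 1 by rewrite ger0_norm /K; have := normr_ge0 x; lra.
have xK : `|x| < `|K| by rewrite [ltRHS]ger0_norm /K; have := normr_ge0 x; lra.
have cb1 := poly_pseries_diffs cb; have cb2 := poly_pseries_diffs cb1.
by apply: pseries_snd_diffs xK; apply: poly_pseries_cvg; eassumption.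
Qed.

Lemma zero_derive_cst (f : R -> R) x : `|x| < 1 ->
  (forall y : R, `|y| < 1 -> is_derive y (1 : R) f (0 : R)) -> f x = f 0.
Proof.
move=> x1 df.
have sub a b : a <= b -> `|a| < 1 -> `|b| < 1 -> f b - f a = 0.
  move=> ab a1 b1.
  have in1 y : y \in `[a, b] -> `|y| < 1.
    rewrite in_itv /= => /andP[ay yb]; rewrite ltr_norml in a1; rewrite ltr_norml in b1.
    by rewrite ltr_norml; lra.
  have in2 y : y \in `]a, b[ -> is_derive y (1 : R) f (0 : R).
    by move=> /subset_itv_oo_cc/in1/df.
  have cf : {within `[a, b], continuous f}.
    apply: derivable_within_continuous => y yab.
    by have := df _ (in1 _ yab) => -[].
  by have [c _ ->] := MVT_segment ab in2 cf; rewrite mul0r.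
have z1 : `|0 : R| < 1 by rewrite normr0.
apply/eqP; rewrite -subr_eq0; apply/eqP.
have [x0|/ltW x0] := leP 0 x; first exact: sub.
by rewrite -opprB (sub x 0) // oppr0.
Qed.

End Series.

(** * Expansions of the radial kernels *)

Section Expansions.
Variable R : realType.
Implicit Types (a x A : R).

(** The function [phi] expands about every positive point [A] into a power
    series in [x], where [A * (1 - x)] is the argument; the coefficients have
    at most polynomial growth. *)
Definition expands (phi : R -> R) (c : nat -> R -> R) (b : R -> R) (p : nat) :=
  [/\ forall A x, 0 < A -> `|x| < 1 ->
        series (fun n => c n A * x ^+ n) @ \oo --> phi (A * (1 - x)),
      forall n A, 0 < A -> `|c n A| <= b A * n.+1%:R ^+ p,
      forall n A, 0 < A -> {for A, continuous (c n)} &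
      forall A, 0 < A -> {for A, continuous b}].

Lemma series_delta0 (k : R) : series (fun n => (n == 0%N)%:R * k) @ \oo --> k.
Proof.
have E n : series (fun n => (n == 0%N)%:R * k) n.+1 = k.
  rewrite /series /= big_nat_recl //= mul1r big1 ?addr0 // => i _.
  by rewrite mul0r.
rewrite -(cvg_shiftS (series _)) /=; under eq_fun do rewrite E.
exact: cvg_cst.
Qed.

Lemma limn_pseries0 (c : nat -> R) : limn (pseries c 0) = c 0.
Proof.
apply: cvg_lim => //; rewrite /pseries.
have -> : [series c i * 0 ^+ i]_i = series (fun n => (n == 0%N)%:R * c 0).
  congr series; apply/funext => -[|n] /=; first by rewrite expr0 mulr1 mul1r.
  by rewrite exprS !mul0r mulr0.
exact: series_delta0.
Qed.

(** The coefficients [(a)_n / n!] of the expansion of [(1 - x)^-a]. *)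
Definition binom_coef a n := \prod_(i < n) ((a + i%:R) / i.+1%:R).

Lemma binom_coefS a n : binom_coef a n.+1 = binom_coef a n * ((a + n%:R) / n.+1%:R).
Proof. by rewrite /binom_coef big_ord_recr. Qed.

Lemma binom_coef_pochhammer a n : n`!%:R * binom_coef a n = pochhammer a n.
Proof.
elim: n => [|n IH]; first by rewrite fact0 mul1r /binom_coef /pochhammer !big_ord0.
rewrite binom_coefS /pochhammer big_ord_recr /= -/(pochhammer a n) -IH factS natrM.
have : n.+1%:R != 0 :> R by rewrite pnatr_eq0.
by move: (n`!%:R : R) (n.+1%:R : R) => f N N0; field.
Qed.

Lemma binom_coef_bound a k n : 0 <= a -> a <= k%:R -> (0 < k)%N ->
  `|binom_coef a n| <= 1 * n.+1%:R ^+ k.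
Proof.
move=> a0 ak k0; rewrite mul1r ger0_norm; last first.
  by apply: prodr_ge0 => i _; rewrite divr_ge0 // addr_ge0.
elim: n => [|n IH]; first by rewrite /binom_coef big_ord0 expr1n.
have b0 : 0 <= binom_coef a n.
  by apply: prodr_ge0 => i _; rewrite divr_ge0 // addr_ge0.
have n1 : 0 < n.+1%:R :> R by rewrite ltr0n.
rewrite binom_coefS.
have bern (y : R) j : 0 <= y -> 1 + j%:R * y <= (1 + y) ^+ j.
  move=> y0; elim: j => [|j IHj]; first by rewrite mul0r addr0 expr0.
  rewrite exprS -natr1; have := ler_wpM2l (addr_ge0 ler01 y0) IHj.
  apply: le_trans; have : 0 <= y * (j%:R * y) by rewrite !mulr_ge0.
  lra.
have -> : (n.+2)%:R = n.+1%:R * (1 + n.+1%:R^-1) :> R.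
  by rewrite mulrDr mulr1 divff ?gt_eqF // natr1.
rewrite exprMn; apply: ler_pM => //; first by rewrite divr_ge0 // addr_ge0.
apply: le_trans (bern _ _ _); last by rewrite invr_ge0 ltW.
rewrite ler_pdivrMr // mulrDl mul1r -mulrA mulVf ?gt_eqF // mulr1 -natr1.
lra.
Qed.

(** The sum [f] solves [(1 - x) f' = a f], so [f * (1 - x)^a] is constant. *)
Lemma binomial_series a k x : 0 <= a -> a <= k%:R -> (0 < k)%N -> `|x| < 1 ->
  series (fun n => binom_coef a n * x ^+ n) @ \oo --> ((1 - x) `^ a)^-1.
Proof.
move=> a0 ak k0 x1.
have bd n := binom_coef_bound n a0 ak k0.
have bd' := poly_pseries_diffs bd.
pose f (y : R) := limn (pseries (binom_coef a) y).
pose g (y : R) := limn (pseries (pseries_diffs (binom_coef a)) y).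
have fcv (y : R) : `|y| < 1 -> series (fun n => binom_coef a n * y ^+ n) @ \oo --> f y.
  by move=> y1; apply: (poly_pseries_cvg y1 bd).
have gcv (y : R) : `|y| < 1 -> pseries (pseries_diffs (binom_coef a)) y @ \oo --> g y.
  by move=> y1; apply: (poly_pseries_cvg y1 bd').
have ode (y : R) : `|y| < 1 -> (1 - y) * g y = a * f y.
  move=> y1; have h1 := pseries_diffs_equiv (gcv y y1).
  have h2 := @cvg_seriesZ _ _ (- y) _ h1.
  have h3 : series (fun n => (a + n%:R) * binom_coef a n * y ^+ n) @ \oo --> g y.
    have := gcv y y1; rewrite /pseries.
    suff -> : (fun n => pseries_diffs (binom_coef a) n * y ^+ n) =
       (fun n => (a + n%:R) * binom_coef a n * y ^+ n) by [].
    apply/funext => n; rewrite /pseries_diffs binom_coefS; congr (_ * _).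
    have : n.+1%:R != 0 :> R by rewrite pnatr_eq0.
    by move: (n.+1%:R : R) => N N0; field.
  have h4 := cvg_seriesD h3 h2.
  have h5 := @cvg_seriesZ _ _ a _ (fcv y y1).
  have E : (fun n => (a + n%:R) * binom_coef a n * y ^+ n +
      - y * (n%:R * binom_coef a n * y ^+ n.-1)) = (fun n => a * (binom_coef a n * y ^+ n)).
    by apply/funext => -[|n] /=; rewrite ?mul0r ?mulr0 ?expr0 ?exprS; ring.
  rewrite E in h4.
  rewrite -(cvg_unique (@norm_hausdorff _ _) h4 h5).
  by rewrite -[limn _]/(g y); ring.
pose h (y : R) := f y * (1 - y) `^ a.
have dh (y : R) : `|y| < 1 -> is_derive y (1 : R) h (0 : R).
  move=> y1; have y2 : 0 < 1 - y by rewrite subr_gt0; apply: le_lt_trans y1; apply: ler_norm.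
  have df : is_derive y (1 : R) f (g y) by apply: (poly_pseries_derive y1 bd).
  have dl : is_derive y (1 : R) (fun z : R => 1 - z) (-1).
    apply: (is_derive_eq (is_deriveB (is_derive_cst _ _ _) (is_derive_id _ _))).
    by rewrite sub0r.
  have dp : is_derive y (1 : R) (fun z : R => (1 - z) `^ a) (a * (1 - y) `^ (a - 1) * -1).
    exact: (@is_derive1_comp R (fun z => z `^ a) (fun z : R => 1 - z) y _ _
      (is_derive1_powR a y2) dl).
  apply: (is_derive_eq (is_deriveM df dp)).
  have -> : (1 - y) `^ a = (1 - y) * (1 - y) `^ (a - 1).
    rewrite -[X in _ = X * _]powRr1 ?(ltW y2) // -powRD; last by rewrite (gt_eqF y2) implybT.
    by congr (_ `^ _); ring.
  rewrite /GRing.scale /=.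
  have := ode y y1; move: ((1 - y) `^ (a - 1)) (g y) (f y) => P gy fy E.
  have -> : fy * (a * P * -1) + (1 - y) * P * gy = P * ((1 - y) * gy - a * fy) by ring.
  by rewrite E subrr mulr0.
have hx := zero_derive_cst x1 dh.
have h0 : h 0 = 1.
  by rewrite /h /f limn_pseries0 subr0 powR1 mulr1 /binom_coef big_ord0.
suff -> : ((1 - x) `^ a)^-1 = f x by exact: fcv.
have y2 : 0 < 1 - x by rewrite subr_gt0; apply: le_lt_trans x1; apply: ler_norm.
apply: (mulIf (lt0r_neq0 (powR_gt0 a y2))); rewrite mulVf ?gt_eqF ?powR_gt0 //.
by rewrite -[RHS]/(h x) hx h0.
Qed.

Lemma sqrtr_pow (y : R) k : 0 <= y -> Num.sqrt y ^+ k = y `^ (k%:R / 2).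
Proof.
move=> y0; rewrite mulrC powRrM powR12_sqrt // powR_mulrn //; exact: sqrtr_ge0.
Qed.

Lemma expands_power k : (0 < k)%N ->
  expands (fun r => (Num.sqrt r ^+ k)^-1)
    (fun n A => (Num.sqrt A ^+ k)^-1 * binom_coef (k%:R / 2) n)
    (fun A => (Num.sqrt A ^+ k)^-1) k.
Proof.
move=> k0.
have kk : k%:R / 2 <= k%:R :> R by rewrite ler_pdivrMr // ler_peMr // ler1n.
have k2 : 0 <= k%:R / 2 :> R by rewrite divr_ge0.
have cb A : 0 < A -> {for A, continuous (fun A : R => (Num.sqrt A ^+ k)^-1)}.
  move=> A0; apply: cvgV; first by rewrite expf_neq0 // gt_eqF // sqrtr_gt0.
  by apply: cvg_pow; apply: sqrt_continuous.
split => //.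
- move=> A x A0 x1.
  have x2 : 0 < 1 - x by rewrite subr_gt0; apply: le_lt_trans x1; apply: ler_norm.
  rewrite sqrtrM ?(ltW A0) // exprMn invfM.
  rewrite (sqrtr_pow k (ltW x2)).
  have -> : (fun n => (Num.sqrt A ^+ k)^-1 * binom_coef (k%:R / 2) n * x ^+ n) =
      (fun n => (Num.sqrt A ^+ k)^-1 * (binom_coef (k%:R / 2) n * x ^+ n)).
    by apply/funext => n; rewrite mulrA.
  by apply: cvg_seriesZ; apply: (binomial_series k2 kk k0 x1).
- move=> n A A0; rewrite normrM ger0_norm; last by rewrite invr_ge0 exprn_ge0 // sqrtr_ge0.
  rewrite ler_wpM2l ?invr_ge0 ?exprn_ge0 ?sqrtr_ge0 //.
  by have := binom_coef_bound n k2 kk k0; rewrite mul1r.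
- by move=> n A A0; apply: cvgM; [exact: cb | exact: cvg_cst].
Qed.

(** The coefficients of [ln (1 - x)]; the one of degree [0] is [- 0^-1 = 0]. *)
Definition log_coef (n : nat) : R := - (n%:R)^-1.

Lemma log_series x : `|x| < 1 ->
  series (fun n => log_coef n * x ^+ n) @ \oo --> ln (1 - x).
Proof.
move=> x1.
have bd n : `|log_coef n| <= 1 * n.+1%:R ^+ 0.
  rewrite expr0 mulr1 /log_coef normrN normfV ger0_norm //.
  case: n => [|n]; first by rewrite invr0.
  by rewrite invf_le1 ?ltr0n // ler1n.
pose f (y : R) := limn (pseries log_coef y).
pose h (y : R) := f y - ln (1 - y).
have dh (y : R) : `|y| < 1 -> is_derive y (1 : R) h (0 : R).
  move=> y1; have y2 : 0 < 1 - y by rewrite subr_gt0; apply: le_lt_trans y1; apply: ler_norm.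
  have df := poly_pseries_derive y1 bd.
  have dl : is_derive y (1 : R) (fun z : R => 1 - z) (-1).
    apply: (is_derive_eq (is_deriveB (is_derive_cst _ _ _) (is_derive_id _ _))).
    by rewrite sub0r.
  have dp : is_derive y (1 : R) (fun z : R => ln (1 - z)) ((1 - y)^-1 * -1).
    exact: (@is_derive1_comp R (@ln R) (fun z : R => 1 - z) y _ _ (is_derive1_ln y2) dl).
  apply: (is_derive_eq (is_deriveB df dp)).
  have -> : limn (pseries (pseries_diffs log_coef) y) = - (1 - y)^-1.
    apply: cvg_lim => //; rewrite /pseries.
    have -> : [series pseries_diffs log_coef i * y ^+ i]_i = series (geometric (-1) y).
      congr series; apply/funext => n /=; rewrite /pseries_diffs /log_coef mulrN divff ?pnatr_eq0 //.
    by have := @cvg_geometric_series R (-1) y y1; rewrite mulN1r.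
  by rewrite mulrN1 subrr.
have h0 : h 0 = 0.
  by rewrite /h /f limn_pseries0 subr0 ln1 subr0 /log_coef invr0 oppr0.
have := zero_derive_cst x1 dh; rewrite h0 /h => /subr0_eq <-.
exact: (poly_pseries_cvg x1 bd).
Qed.

Lemma expands_log :
  expands (fun r => ln (Num.sqrt r))
    (fun n A => (n == 0%N)%:R * ln (Num.sqrt A) + log_coef n / 2)
    (fun A => `|ln (Num.sqrt A)| + 1) 0.
Proof.
have cl A : 0 < A -> {for A, continuous (fun A : R => ln (Num.sqrt A))}.
  move=> A0; apply: (@continuous_comp _ _ _ Num.sqrt (@ln R)).
    exact: sqrt_continuous.
  by apply: continuous_ln; rewrite sqrtr_gt0.
split.
- move=> A x A0 x1.
  have x2 : 0 < 1 - x by rewrite subr_gt0; apply: le_lt_trans x1; apply: ler_norm.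
  rewrite sqrtrM ?(ltW A0) // lnM ?posrE ?sqrtr_gt0 //.
  have -> : ln (Num.sqrt (1 - x)) = 2^-1 * ln (1 - x).
    rewrite -{2}(sqr_sqrtr (ltW x2)) lnXn ?sqrtr_gt0 // -mulr_natl; by field.

  have -> : (fun n : nat => ((n == 0%N)%:R * ln (Num.sqrt A) + log_coef n / 2) * x ^+ n) =
     (fun n : nat => (n == 0%N)%:R * ln (Num.sqrt A) + 2^-1 * (log_coef n * x ^+ n)).
    apply/funext => -[|n]; first by rewrite expr0; ring.
    by rewrite !mul0r !add0r; ring.
  by apply: cvg_seriesD; [exact: series_delta0 | apply: cvg_seriesZ; apply: log_series].
- move=> n A A0; rewrite expr0 mulr1; apply: (le_trans (ler_normD _ _)); apply: lerD.
    by case: n => [|n]; rewrite ?mul1r // mul0r normr0.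
  rewrite /log_coef normrM normrN !normfV !ger0_norm //.
  case: n => [|n]; first by rewrite invr0 mul0r.
  rewrite -invfM invf_le1 ?mulr_gt0 ?ltr0n // -natrM ler1n; lia.
- move=> n A A0; apply: cvgD; last exact: cvg_cst.
  by apply: cvgM; [exact: cvg_cst | exact: cl].
- by move=> A A0; apply: cvgD; [apply: cvg_norm; exact: cl | exact: cvg_cst].
Qed.

End Expansions.

(** * Alternating sums of a radial kernel *)

Section Kernel.
Variables (R : realType) (d : nat) (phi : R -> R) (c : nat -> R -> R)
  (b : R -> R) (p : nat).
Hypothesis hphi : expands phi c b p.

Lemma cvg_enorm (T : Type) (F : set_system T) (FF : Filter F) (f : T -> 'cV[R]_d) X :
  f t @[t --> F] --> X -> enorm (f t) @[t --> F] --> enorm X.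
Proof.
move=> fX; apply: (@continuous_cvg _ _ _ _ _ (fun t => edot (f t) (f t)) Num.sqrt).
  exact: sqrt_continuous.
exact: cvg_edot.
Qed.

Lemma near_all_seq (I : eqType) (T : Type) (F : set_system T) (FF : Filter F)
    (s : seq I) (P : I -> T -> Prop) :
  (forall i, i \in s -> \forall t \near F, P i t) ->
  \forall t \near F, forall i, i \in s -> P i t.
Proof.
elim: s => [|i s IH] h; first by apply: nearW.
have h1 := h i (mem_head _ _).
have h2 : \forall t \near F, forall j, j \in s -> P j t.
  by apply: IH => j js; apply: h; rewrite inE js orbT.
apply: filterS2 h1 h2 => t Pi Ps j; rewrite inE => /predU1P[->//|]; exact: Ps.
Qed.

(** The alternating sum over [G] of [phi (|X - wY|^2)]. *)
Definition alt_kernel (G : seq 'M[R]_d) (X Y : 'cV[R]_d) :=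
  \sum_(w <- G) \det w * phi (edot (X - w *m Y) (X - w *m Y)).

Variables (G : seq 'M[R]_d) (T : seq 'cV[R]_d).
Hypothesis uG : uniq G.
Hypothesis G_ortho : forall w, w \in G -> orth_mx w.
Hypothesis T_neq0 : forall a, a \in T -> a != 0.
Hypothesis G_left : forall a w, a \in T -> w \in G -> reflection_mx a *m w \in G.
Hypothesis G_right : forall a w, a \in T -> w \in G -> w *m reflection_mx a \in G.
Hypothesis T_gen : forall a a', a \in T -> a' \in T -> a != a' -> hproj a' *m a != 0.
Hypothesis uT : uniq T.

(** Away from its singularities, the alternating sum of a radial kernel is the
    product of the linear forms of [T] in each variable by a continuous
    function. The expansion is in powers of [<X, wY> + M], which are
    nonnegative for [M] large, about the point [|X|^2 + |Y|^2 + 2 M]. *)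
Lemma alt_kernel_division (X1 Y1 : 'cV[R]_d) :
  (forall w, w \in G -> X1 != w *m Y1) ->
  exists2 K : 'cV[R]_d -> 'cV[R]_d -> R,
    K z.1 z.2 @[z --> (X1, Y1)] --> K X1 Y1 &
    \forall z \near (X1, Y1), alt_kernel G z.1 z.2 =
      \prod_(a <- T) edot a z.1 * \prod_(a <- T) edot a z.2 * K z.1 z.2.
Proof.
move=> sing; case: hphi => phi_sum c_bound c_cont b_cont.
pose h := \sum_(a <- T) (enorm a)^-1.
have h_ge0 : 0 <= h by apply: sumr_ge0 => a _; rewrite invr_ge0 enorm_ge0.
have T_h a : a \in T -> (enorm a)^-1 <= h.
  move=> aT; rewrite /h (big_rem a) //= lerDl.
  by apply: sumr_ge0 => x _; rewrite invr_ge0 enorm_ge0.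
pose rho := enorm X1 + enorm Y1 + 1.
have rho1 : 1 <= rho by rewrite lerDr addr_ge0 ?enorm_ge0.
have rho_ge0 : 0 <= rho by apply: le_trans rho1.
pose M : R := rho ^+ 2 + 1.
have rM : rho ^+ 2 <= M by rewrite lerDl.
have M2 : 2 <= M.
  have : 1 <= rho ^+ 2 by apply: exprn_ege1.
  rewrite /M; lra.
have [B hB] := choice (alt_pow_division M uG G_ortho T_neq0 G_left G_right T_gen
  h_ge0 rho_ge0 T_h uT).
pose A (z : 'cV[R]_d * 'cV[R]_d) := edot z.1 z.1 + edot z.2 z.2 + 2 * M.
have A4 z : 4 <= A z by rewrite /A; have := edot_ge0 z.1; have := edot_ge0 z.2; lra.
have A0 z : 0 < A z by apply: lt_le_trans (A4 z).
pose C := divC rho h.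
have C1 : 1 <= C by apply: divC_ge1.
pose f n (z : 'cV[R]_d * 'cV[R]_d) := c n (A z) * (2 / A z) ^+ n * B n z.1 z.2.
have cx : (fun z : 'cV[R]_d * 'cV[R]_d => z.1) z @[z --> (X1, Y1)] --> X1 by exact: cvg_fst.
have cy : (fun z : 'cV[R]_d * 'cV[R]_d => z.2) z @[z --> (X1, Y1)] --> Y1 by exact: cvg_snd.
have cA : A z @[z --> (X1, Y1)] --> A (X1, Y1).
  by apply: cvgD; [apply: cvgD; exact: cvg_edot | exact: cvg_cst].
have cf n : f n z @[z --> (X1, Y1)] --> f n (X1, Y1).
  apply: cvgM; last first.
    by have [_ + _] := hB n; apply.
  apply: cvgM.
    exact: (@continuous_cvg _ _ _ _ _ A (c n) _ (c_cont n _ (A0 _)) cA).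
  apply: cvg_pow; apply: cvgM; first exact: cvg_cst.
  by apply: cvgV => //; rewrite gt_eqF // A0.
(* [X1 <> w Y1] says that [2 (<X1, w Y1> + M) < A (X1, Y1)]: the ratio of the
   expansion is below some [th < 1] for all [w] at once. *)
have [th [th0 th1 hth]] : exists th, [/\ 2^-1 <= th, th < 1 & forall w, w \in G ->
    2 * (edot X1 (w *m Y1) + M) < th * A (X1, Y1)].
  have H w : w \in G -> 2 * (edot X1 (w *m Y1) + M) < A (X1, Y1).
    move=> wG; have : 0 < edot (X1 - w *m Y1) (X1 - w *m Y1).
      by rewrite edot_gt0 subr_eq0 sing.
    by rewrite edot_sq (edot_ortho _ _ (G_ortho wG)) /A /=; lra.
  elim: G H => [|w L IH] H.
    by exists 2^-1; split => //; rewrite invf_lt1 ?ltr1n.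
  have [|th [t0 t1 ht]] := IH; first by move=> u uL; apply: H; rewrite inE uL orbT.
  have Hw := H w (mem_head _ _).
  pose s := (2 * (edot X1 (w *m Y1) + M) / A (X1, Y1) + 1) / 2.
  have e1 : 2 * (edot X1 (w *m Y1) + M) / A (X1, Y1) < 1.
    by rewrite ltr_pdivrMr ?A0 // mul1r.
  exists (Num.max th s); split.
  - by rewrite le_max t0.
  - by rewrite gt_max t1 /s; lra.
  - move=> u; rewrite inE => /predU1P[->|/ht h1].
      rewrite -ltr_pdivrMr ?A0 // lt_max; apply/orP; right; rewrite /s; lra.
    by apply: (lt_le_trans h1); rewrite ler_wpM2r ?(ltW (A0 _)) // le_max lexx.
have near_X : \forall z \near (X1, Y1), enorm z.1 < rho.
  have lt1 : enorm X1 < rho by rewrite /rho; have := enorm_ge0 Y1; lra.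
  exact: (cvgr_lt _ (cvg_enorm _ cx) _ lt1).
have near_Y : \forall z \near (X1, Y1), enorm z.2 < rho.
  have lt1 : enorm Y1 < rho by rewrite /rho; have := enorm_ge0 X1; lra.
  exact: (cvgr_lt _ (cvg_enorm _ cy) _ lt1).
have near_th : \forall z \near (X1, Y1), forall w, w \in G ->
    2 * (edot z.1 (w *m z.2) + M) < th * A z.
  apply: (@near_all_seq _ _ (nbhs (X1, Y1)) _ G (fun w (z : 'cV[R]_d * 'cV[R]_d) =>
    is_true (2 * (edot z.1 (w *m z.2) + M) < th * A z))) => w wG.
  have cg : th * A z - 2 * (edot z.1 (w *m z.2) + M) @[z --> (X1, Y1)] -->
      th * A (X1, Y1) - 2 * (edot X1 (w *m Y1) + M).
    apply: cvgB; first by apply: cvgM => //; exact: cvg_cst.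
    apply: cvgM; first exact: cvg_cst.
    by apply: cvgD; [exact: cvg_edot_mx | exact: cvg_cst].
  have pos : 0 < th * A (X1, Y1) - 2 * (edot X1 (w *m Y1) + M) by rewrite subr_gt0 hth.
  have lt1 : \forall z \near (X1, Y1), 0 < th * A z - 2 * (edot z.1 (w *m z.2) + M).
    exact: (cvgr_gt _ cg _ pos).
  by apply: filterS lt1 => z; rewrite subr_gt0.
have near_b : \forall z \near (X1, Y1), b (A z) < b (A (X1, Y1)) + 1.
  have lt1 : b (A (X1, Y1)) < b (A (X1, Y1)) + 1 by rewrite ltrDl.
  exact: (cvgr_lt _ (@continuous_cvg _ _ _ _ _ A b _ (b_cont _ (A0 (X1, Y1))) cA) _ lt1).
pose q := (p + 2 * size T)%N.
have th_gt0 : 0 < th by apply: lt_le_trans th0.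
(* The polynomial growth is absorbed by passing from the ratio [th] to the
   larger ratio [r]. *)
pose eta := (1 + th^-1) / 2.
have ith : 1 < th^-1 by rewrite invf_gt1.
have eta1 : 1 < eta by rewrite /eta; lra.
have [D D0 hD] := poly_le_geometric q eta1.
pose r := eta * th.
have r0 : 0 <= r by rewrite mulr_ge0 // ltW // (lt_trans ltr01).
have r1 : r < 1.
  have : th^-1 * th = 1 by rewrite mulVf // gt_eqF.
  by rewrite /r /eta; move: th^-1 => i; nra.
have gmax0 z : 0 <= gmax G M z.1 z.2 by apply: le_trans (gmax_ge1 _ _ _ _).
have near_f : \forall z \near (X1, Y1), forall n,
    `|f n z| <= (b (A (X1, Y1)) + 1) * C ^+ (2 * size T) * (size G)%:R * D * r ^+ n.
  near=> z => n.
  have zX : enorm z.1 <= rho by apply: ltW; near: z.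
  have zY : enorm z.2 <= rho by apply: ltW; near: z.
  have zb : b (A z) <= b (A (X1, Y1)) + 1 by apply: ltW; near: z.
  have zth : forall w, w \in G -> 2 * (edot z.1 (w *m z.2) + M) < th * A z by near: z.
  have gm : 2 / A z * gmax G M z.1 z.2 <= th.
    rewrite mulrAC ler_pdivrMr ?A0 // mulrC -ler_pdivlMr //.
    apply: gmax_le => [|w wG]; first by rewrite ler_pdivlMr // mul1r; have := A4 z; nra.
    by rewrite ler_pdivlMr // mulrC ltW // zth.
  have b0 : 0 <= b (A z).
    by have := c_bound 0 _ (A0 z); rewrite expr1n mulr1; apply: le_trans.
  have [_ _ /(_ z.1 z.2 zX zY rM) hBn] := hB n.
  rewrite /f normrM normrM (ger0_norm (exprn_ge0 _ _)); last by rewrite divr_ge0 // ltW.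
  have cb : `|c n (A z)| <= (b (A (X1, Y1)) + 1) * n.+1%:R ^+ p.
    by apply: (le_trans (c_bound n _ (A0 z))); rewrite ler_wpM2r ?exprn_ge0.
  apply: (@le_trans _ _ ((b (A (X1, Y1)) + 1) * n.+1%:R ^+ p * (2 / A z) ^+ n *
     ((n.+1%:R * C) ^+ (2 * size T) * (size G)%:R * gmax G M z.1 z.2 ^+ n))).
    apply: ler_pM => //.
    - by rewrite mulr_ge0 // exprn_ge0 // divr_ge0 // ltW.
    - by rewrite ler_wpM2r // exprn_ge0 // divr_ge0 // ltW.
    - apply: (le_trans hBn); rewrite ler_wpM2r ?exprn_ge0 // ler_wpM2r //.
      apply: lerXn2r; rewrite ?nnegrE ?mulr_ge0 ?(le_trans _ C1) //.
      by rewrite ler_wpM2r ?ler_nat ?(le_trans _ C1).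
  rewrite (exprMn (2 * size T) n.+1%:R C).
  have -> : (b (A (X1, Y1)) + 1) * n.+1%:R ^+ p * (2 / A z) ^+ n *
     (n.+1%:R ^+ (2 * size T) * C ^+ (2 * size T) * (size G)%:R * gmax G M z.1 z.2 ^+ n) =
     (b (A (X1, Y1)) + 1) * C ^+ (2 * size T) * (size G)%:R *
     (n.+1%:R ^+ q * (2 / A z * gmax G M z.1 z.2) ^+ n).
    by rewrite /q exprD [(2 / A z * _) ^+ n]exprMn; ring.
  rewrite -[leRHS]mulrA ler_wpM2l //.
    by rewrite !mulr_ge0 // ?exprn_ge0 ?(le_trans _ C1) // (le_trans b0).
  have g0 : 0 <= 2 / A z * gmax G M z.1 z.2 by rewrite mulr_ge0 // divr_ge0 // ltW.
  have -> : D * r ^+ n = D * eta ^+ n * th ^+ n by rewrite /r exprMn mulrA.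
  apply: ler_pM; rewrite ?exprn_ge0 ?hD //.
  by apply: lerXn2r => //; rewrite nnegrE ltW.
have near_sum : \forall z \near (X1, Y1),
    series (f^~ z) @ \oo --> limn (series (f^~ z)).
  by apply: filterS near_f => z hz; exact: (@geom_dominated_cvg _ (f^~ z) _ _ r0 r1 hz).
exists (fun X Y => limn (series (f^~ (X, Y)))).
  have E : (fun z : 'cV[R]_d * 'cV[R]_d => limn (series (f^~ (z.1, z.2)))) =
      (fun z => limn (series (f^~ z))) by apply/funext => -[].
  rewrite E; exact: (cvg_series_dominated _ r0 r1 cf near_f near_sum).
near=> z.
have zX : enorm z.1 <= rho by apply: ltW; near: z.
have zY : enorm z.2 <= rho by apply: ltW; near: z.
have zth : forall w, w \in G -> 2 * (edot z.1 (w *m z.2) + M) < th * A z by near: z.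
have zs : series (f^~ z) @ \oo --> limn (series (f^~ z)) by near: z.
have -> : (z.1, z.2) = z by case: (z).
set P := \prod_(a <- T) edot a z.1 * \prod_(a <- T) edot a z.2.
have s1 := @cvg_seriesZ _ _ P _ zs.
pose x w := 2 / A z * (edot z.1 (w *m z.2) + M).
have s2 : series (fun n => \sum_(w <- G) \det w * (c n (A z) * x w ^+ n)) @ \oo -->
    alt_kernel G z.1 z.2.
  apply: (@cvg_series_bigsum _ _ _ (fun w n => \det w * (c n (A z) * x w ^+ n))) => w wG.
  apply: cvg_seriesZ.
  have -> : edot (z.1 - w *m z.2) (z.1 - w *m z.2) = A z * (1 - x w).
    rewrite edot_sq (edot_ortho _ _ (G_ortho wG)) /x; have := gt_eqF (A0 z).
    rewrite /A; move: (edot z.1 (w *m z.2)) => t /negbT a0; field.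
    by rewrite -/(A z).
  apply: phi_sum; rewrite ?A0 // ger0_norm.
    rewrite /x mulrAC ltr_pdivrMr ?A0 //; apply: (lt_le_trans (zth w wG)).
    by rewrite ler_wpM2r ?(ltW th1) // ltW.
  rewrite mulr_ge0 ?divr_ge0 ?(ltW (A0 z)) //.
  have := cauchy_schwarz z.1 (w *m z.2); rewrite ler_norml => /andP[+ _].
  rewrite (enorm_ortho _ (G_ortho wG)).
  have : enorm z.1 * enorm z.2 <= rho * rho by rewrite ler_pM ?enorm_ge0.
  rewrite -expr2; lra.
have E : (fun n => \sum_(w <- G) \det w * (c n (A z) * x w ^+ n)) = (fun n => P * f n z).
  apply/funext => n; have [+ _ _] := hB n => /(_ z.1 z.2) EB.
  rewrite /f mulrCA -EB /alt_pow mulr_sumr; apply: eq_bigr => w _.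
  by rewrite /x exprMn; ring.
rewrite E in s2.
exact: (cvg_unique (@norm_hausdorff _ _) s2 s1).
Unshelve. all: by end_near. Qed.

End Kernel.

(** * Kernels of a root system *)

Section RootKernel.
Variables (R : realType) (d : nat) (S Sp : {fset 'cV[R]_d}) (v : 'cV[R]_d).
Hypothesis hS : root_system S.
Hypothesis hv : forall a, a \in S -> edot a v != 0.
Hypothesis hSp : forall a, a \in Sp <-> (a \in S) && (0 < edot a v).

Lemma pos_root_neq0 a : a \in Sp -> a != 0.
Proof. by move=> /(pos_root hSp)/(root_neq0 hS). Qed.

Lemma weyl_seq_ortho w : w \in weyl_seq S -> orth_mx w.
Proof. by move=> /(mem_weyl_seq hS)/(weyl_ortho hS). Qed.

Lemma weyl_seq_left a w : a \in Sp -> w \in weyl_seq S ->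
  reflection_mx a *m w \in weyl_seq S.
Proof.
move=> /(pos_root hSp) aS /(mem_weyl_seq hS) wW.
by apply/(mem_weyl_seq hS)/(weylM (weyl_refl aS)).
Qed.

Lemma weyl_seq_right a w : a \in Sp -> w \in weyl_seq S ->
  w *m reflection_mx a \in weyl_seq S.
Proof.
move=> /(pos_root hSp) aS /(mem_weyl_seq hS) wW.
by apply/(mem_weyl_seq hS)/weylM => //; apply: weyl_refl.
Qed.

Lemma pos_roots_generic a a' : a \in Sp -> a' \in Sp -> a != a' ->
  hproj a' *m a != 0.
Proof.
move=> aSp aSp' aa'; apply/eqP; rewrite hprojE ?pos_root_neq0 // => /subr0_eq E.
have aS := pos_root hSp aSp; have aS' := pos_root hSp aSp'.
have : edot a' a / edot a' a' *: a' \in S by rewrite -E.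
case: hS => _ /(_ a' (edot a' a / edot a' a') aS') [+ _] _ _ => /[apply] -[] k.
  by rewrite E k scale1r eqxx in aa'.
have := pos_notN hSp aSp'; rewrite -scaleN1r -k -E aSp //.
Qed.

Lemma root_prod_chamber X : chamber Sp X -> 0 < root_prod Sp X.
Proof. by move=> hX; rewrite /root_prod big_seq prodr_gt0 // => a /hX. Qed.

Lemma root_prodZ k X : root_prod Sp (k *: X) = k ^+ #|` Sp| * root_prod Sp X.
Proof.
rewrite /root_prod; elim: (enum_fset Sp) => [|a L IH]; first by rewrite !big_nil mul1r.
by rewrite !big_cons IH edotZr exprS; ring.
Qed.

(** The alternating sum over the Weyl group of the powers of [<X, wY>]. *)
Definition weyl_pow n X Y := \sum_(w <- weyl_seq S) \det w * edot X (w *m Y) ^+ n.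

(** The alternating sums of the powers of [<X, wY>] vanish below the degree of
    [root_prod Sp]; in that degree they are proportional to
    [root_prod Sp X * root_prod Sp Y], and the denominator formula gives the
    constant. *)
Lemma weyl_pow_low :
  (forall n X Y, (n < #|` Sp|)%N -> weyl_pow n X Y = 0) /\
  (root_prod Sp (root_sum Sp) != 0 /\ forall X Y, weyl_pow #|` Sp| X Y =
     (#|` Sp|)`!%:R * 2 ^+ #|` Sp| / root_prod Sp (root_sum Sp) *
     (root_prod Sp X * root_prod Sp Y)).
Proof.
set g := #|` Sp|.
pose h := \sum_(a <- Sp) (enorm a)^-1.
have h_ge0 : 0 <= h by apply: sumr_ge0 => a _; rewrite invr_ge0 enorm_ge0.
have T_h a : a \in Sp -> (enorm a)^-1 <= h.
  move=> aT; rewrite /h (big_rem a) //= lerDl.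
  by apply: sumr_ge0 => x _; rewrite invr_ge0 enorm_ge0.
have H n := alt_pow_division 0 (uniq_weyl_seq S) weyl_seq_ortho pos_root_neq0
  weyl_seq_left weyl_seq_right pos_roots_generic h_ge0 (lexx 0) T_h (fset_uniq Sp) n.
have E n X Y : alt_pow (weyl_seq S) 0 n X Y = weyl_pow n X Y.
  by apply: eq_bigr => w _; rewrite addr0.
have homog n k X Y : weyl_pow n (k *: X) Y = k ^+ n * weyl_pow n X Y.
  rewrite /weyl_pow mulr_sumr; apply: eq_bigr => w _.
  by rewrite edotZl exprMn mulrCA.
have homog2 n k X Y : weyl_pow n X (k *: Y) = k ^+ n * weyl_pow n X Y.
  rewrite /weyl_pow mulr_sumr; apply: eq_bigr => w _.
  by rewrite -scalemxAr edotZr exprMn mulrCA.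
have near_gt0 : \forall t \near (0 : R)^'+, 0 < t by apply: nbhs_right_gt.
have cid : (fun t : R => t) t @[t --> (0 : R)^'+] --> (0 : R).
  exact: (cvg_at_right_filter (@cvg_id _ _)).
have c0 (X : 'cV[R]_d) : t *: X @[t --> (0 : R)^'+] --> (0 : 'cV[R]_d).
  by have := @cvg_line _ _ 0 X; under eq_fun do rewrite add0r.
split => [n X Y ng|].
  have [B [EB cB _]] := H n.
  (* Replacing [X] by [t X] multiplies the alternating sum by [t^n] and the
     product of the roots by [t^g], with [n < g]. *)
  have lim1 : t ^+ (g - n) * (root_prod Sp X * root_prod Sp Y * B (t *: X) Y)
      @[t --> (0 : R)^'+] --> 0 ^+ (g - n) * (root_prod Sp X * root_prod Sp Y * B 0 Y).
    apply: cvgM; first exact: cvg_pow.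
    apply: cvgM; first exact: cvg_cst.
    by apply: (cB _ _ (fun t => t *: X) (fun=> Y)) => //; exact: cvg_cst.
  rewrite expr0n subn_eq0 leqNgt ng mul0r in lim1.
  have near_eq : \forall t \near (0 : R)^'+,
      t ^+ (g - n) * (root_prod Sp X * root_prod Sp Y * B (t *: X) Y) = weyl_pow n X Y.
    apply: filterS near_gt0 => t t0.
    apply: (mulfI (expf_neq0 n (lt0r_neq0 t0))); rewrite -homog -E EB.
    rewrite -!/(root_prod Sp _) root_prodZ -/g.
    have -> : t ^+ g = t ^+ n * t ^+ (g - n) by rewrite -exprD subnKC // ltnW.
    ring.
  have lim2 : t ^+ (g - n) * (root_prod Sp X * root_prod Sp Y * B (t *: X) Y)
      @[t --> (0 : R)^'+] --> weyl_pow n X Y by apply: cvg_near_cst.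
  exact: (cvg_unique _ lim2 lim1).
have [B [EB cB _]] := H g.
(* In degree [g], the quotient is homogeneous of degree 0, hence constant. *)
have EF X Y : weyl_pow g X Y = B 0 0 * (root_prod Sp X * root_prod Sp Y).
  have lim1 : root_prod Sp X * root_prod Sp Y * B (t *: X) (t *: Y)
      @[t --> (0 : R)^'+] --> root_prod Sp X * root_prod Sp Y * B 0 0.
    apply: cvgM; first exact: cvg_cst.
    by apply: (cB _ _ (fun t => t *: X) (fun t => t *: Y)).
  have near_eq : \forall t \near (0 : R)^'+,
      root_prod Sp X * root_prod Sp Y * B (t *: X) (t *: Y) = weyl_pow g X Y.
    apply: filterS near_gt0 => t t0.
    apply: (mulfI (expf_neq0 g (lt0r_neq0 t0))).
    apply: (mulfI (expf_neq0 g (lt0r_neq0 t0))).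
    rewrite -[in RHS]homog2 -[in RHS]homog -E EB -!/(root_prod Sp _) !root_prodZ -/g.
    ring.
  rewrite mulrC.
  have lim2 : root_prod Sp X * root_prod Sp Y * B (t *: X) (t *: Y)
      @[t --> (0 : R)^'+] --> weyl_pow g X Y by apply: cvg_near_cst.
  exact: (cvg_unique _ lim2 lim1).
(* The constant is read off at half the sum of the positive roots. *)
have key : B 0 0 * root_prod Sp (root_sum Sp) = g`!%:R * 2 ^+ g.
  have v0 : root_prod Sp v != 0 by rewrite gt_eqF // root_prod_chamber // => a /(pos_height hSp).
  have := weyl_denominator_pow hS hv hSp v.
  have -> : \sum_(w <- weyl_seq S) \det w * edot (w *m (2^-1 *: root_sum Sp)) v ^+ #|` Sp|
      = weyl_pow g v (2^-1 *: root_sum Sp).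
    by apply: eq_bigr => w _; rewrite edotC.
  rewrite EF root_prodZ -/g exprVn => K; apply: (mulIf v0).
  rewrite mulrAC -[RHS]mulrAC -K; field.
  by rewrite expf_neq0.
have r0 : root_prod Sp (root_sum Sp) != 0.
  apply/eqP => r0; have := key; rewrite r0 mulr0 => /eqP.
  by rewrite eq_sym mulf_eq0 expf_eq0 !pnatr_eq0 andbF orbF -leqn0 leqNgt fact_gt0.
by split => // X Y; rewrite EF -key mulfK.
Qed.

Variables (phi : R -> R) (c : nat -> R -> R) (b : R -> R) (p : nat).
Hypothesis hphi : expands phi c b p.

(** Two points of the closed chamber in the same orbit are equal. *)
Lemma dominant_orbit_eq X Y w : weyl_group S w -> dominant Sp X -> dominant Sp Y ->
  X = w *m Y -> X = Y.
Proof.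
move=> wW dX dY E; apply/eqP; rewrite -subr_eq0 -edot_eq0 eq_le edot_ge0 andbT.
have := weyl_dominant_le hS hv hSp wW dX dY; rewrite -E edot_sq.
have : edot X X = edot Y Y by rewrite E (edot_ortho _ _ (weyl_ortho hS wW)).
lra.
Qed.

Lemma closure_dominant X : closure (chamber Sp) X -> dominant Sp X.
Proof.
move=> hX a aSp; rewrite leNgt; apply/negP => aX.
have ca : edot a Z @[Z --> X] --> edot a X.
  by apply: (@cvg_edot R _ (nbhs X) _ d (fun=> a) id a X); [exact: cvg_cst | exact: cvg_id].
have near_lt : \forall Z \near X, edot a Z < 0 by exact: (cvgr_lt _ ca _ aX).
have [Z [hZ1 hZ2]] := hX _ near_lt.
by have := hZ1 a aSp; rewrite ltNge ltW.
Qed.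

(** The sum over the Weyl group of the method of images, divided by the
    root products of both variables. *)
Definition image_quotient X Y :=
  alt_kernel phi (weyl_seq S) X Y / (root_prod Sp X * root_prod Sp Y).

(** The pairs of points of the open chamber. *)
Definition chamber2 : set ('cV[R]_d * 'cV[R]_d) :=
  [set z | chamber Sp z.1 /\ chamber Sp z.2].

Lemma image_quotient_limit X Y : dominant Sp X -> dominant Sp Y -> X != Y ->
  exists k, image_quotient z.1 z.2 @[z --> within chamber2 (nbhs (X, Y))] --> (k : R).
Proof.
move=> dX dY XY.
have sing w : w \in weyl_seq S -> X != w *m Y.
  move=> /(mem_weyl_seq hS) wW; apply: contra_neq XY; exact: dominant_orbit_eq.
have [K cK EK] := alt_kernel_division hphi (uniq_weyl_seq S) weyl_seq_ortho
  pos_root_neq0 weyl_seq_left weyl_seq_right pos_roots_generic (fset_uniq Sp) sing.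
exists (K X Y).
have cK' : K z.1 z.2 @[z --> within chamber2 (nbhs (X, Y))] --> K X Y.
  exact: cvg_within_filter cK.
apply: cvg_trans cK'; apply: near_eq_cvg; apply: filterS EK => z Ez [hz1 hz2].
have n0 : root_prod Sp z.1 * root_prod Sp z.2 != 0.
  by rewrite mulf_neq0 // gt_eqF // root_prod_chamber.
by rewrite /image_quotient Ez -!/(root_prod Sp _) mulrAC divff // mul1r.
Qed.

End RootKernel.

(** * Asymptotics at a boundary point *)

Section Asymptotics.
Variables (R : realType) (d : nat) (S Sp : {fset 'cV[R]_d}) (v : 'cV[R]_d).
Hypothesis hS : root_system S.
Hypothesis hv : forall a, a \in S -> edot a v != 0.
Hypothesis hSp : forall a, a \in Sp <-> (a \in S) && (0 < edot a v).
Variables (phi : R -> R) (c : nat -> R -> R) (b : R -> R) (p : nat).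
Hypothesis hphi : expands phi c b p.
Variable Y0 : 'cV[R]_d.
Hypothesis hY0 : closure (chamber Sp) Y0.

Let S' := roots_at S Y0.
Let Sp' := roots_at Sp Y0.
Let hS' : root_system S'.
Proof. exact: roots_at_system. Qed.
Let hv' : forall a, a \in S' -> edot a v != 0.
Proof. exact: roots_at_regular. Qed.
Let hSp' : forall a, a \in Sp' <-> (a \in S') && (0 < edot a v).
Proof. exact: roots_at_positive. Qed.
Let dY0 : dominant Sp Y0.
Proof. exact: closure_dominant. Qed.
Let g := #|` Sp'|.

(** The product of the positive roots that do not vanish at [Y0]. *)
Definition transverse_prod (X : 'cV[R]_d) :=
  \prod_(a <- Sp | edot a Y0 != 0) edot a X.

Lemma root_prod_split X : root_prod Sp X = root_prod Sp' X * transverse_prod X.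
Proof.
rewrite /root_prod (bigID (fun a => edot a Y0 == 0)) /=; congr (_ * _).
rewrite -big_filter; apply: perm_big; apply: uniq_perm.
- exact/filter_uniq/fset_uniq.
- exact: fset_uniq.
- by move=> a; rewrite mem_filter mem_roots_at andbC.
Qed.

Lemma transverse_prod_neq0 : transverse_prod Y0 != 0.
Proof. by rewrite /transverse_prod prodf_seq_neq0; apply/allP => a _; apply/implyP. Qed.

Lemma cvg_transverse_prod (A : Type) (F : set_system A) (FF : Filter F) (f : A -> 'cV[R]_d) X :
  f t @[t --> F] --> X -> transverse_prod (f t) @[t --> F] --> transverse_prod X.
Proof.
move=> fX; rewrite /transverse_prod -big_filter; under eq_fun do rewrite -big_filter.
by apply: cvg_bigprod => a; apply: cvg_edot => //; exact: cvg_cst.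
Qed.

Lemma root_prod_at_shift X : root_prod Sp' X = root_prod Sp' (X - Y0).
Proof.
rewrite /root_prod big_seq [RHS]big_seq; apply: eq_bigr => a.
by rewrite mem_roots_at => /andP[_ /eqP a0]; rewrite edotBr a0 subr0.
Qed.

Lemma chamber_neq0 X : chamber Sp X ->
  [/\ root_prod Sp X != 0, root_prod Sp' X != 0 & transverse_prod X != 0].
Proof.
move=> hX; have h : root_prod Sp X != 0 by rewrite gt_eqF // root_prod_chamber.
by split => //; move: h; rewrite root_prod_split mulf_eq0 negb_or => /andP[].
Qed.

(** The values [k X] at [(X, Y0)] of the continuous extension of
    [image_quotient]. *)
Variable k : 'cV[R]_d -> R.
Hypothesis hk : forall X, dominant Sp X -> X != Y0 ->
  image_quotient S Sp phi z.1 z.2 @[z --> within (chamber2 Sp) (nbhs (X, Y0))] --> k X.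

Lemma slice_limit (A : Type) (F : set_system A) (FF : Filter F) X (x y : A -> 'cV[R]_d) :
  dominant Sp X -> X != Y0 ->
  x t @[t --> F] --> X -> y t @[t --> F] --> Y0 ->
  (\forall t \near F, chamber Sp (x t)) -> (\forall t \near F, chamber Sp (y t)) ->
  image_quotient S Sp phi (x t) (y t) @[t --> F] --> k X.
Proof.
move=> dX XY hx hy cx cy.
have h : (x t, y t) @[t --> F] --> within (chamber2 Sp) (nbhs (X, Y0)).
  move=> U [[P Q] /= [hP hQ] PQ].
  have h1 : \forall t \near F, P (x t) := hx _ hP.
  have h2 : \forall t \near F, Q (y t) := hy _ hQ.
  have sub : [set t | (P (x t) /\ Q (y t)) /\ (chamber Sp (x t) /\ chamber Sp (y t))]
      `<=` (fun t => (x t, y t)) @^-1` U.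
    by move=> t [[Pt Qt] cc]; exact: (PQ (x t, y t) (conj Pt Qt) cc).
  exact: (@filterS _ F FF _ _ sub (filterI (filterI h1 h2) (filterI cx cy))).
exact: (cvg_comp _ _ h (hk dX XY)).
Qed.

(** A limit in both variables is continuous in the first one. *)
Lemma k_continuous X : closure (chamber Sp) X -> X != Y0 ->
  k Z @[Z --> within (chamber Sp) (nbhs X)] --> k X.
Proof.
move=> hX XY; have dX := closure_dominant hX.
apply/cvgrPdist_le => e e0.
have /cvgrPdist_le /(_ e e0) [[U V] /= [hU hV] UV] := hk dX XY.
have near_ne : \forall Z \near X, Z != Y0.
  have cn : enorm (Z - Y0) @[Z --> X] --> enorm (X - Y0).
    apply: (@cvg_enorm R d _ (nbhs X) _ (fun Z => Z - Y0) (X - Y0)).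
    by apply: (@cvg_vecB R _ (nbhs X) _ d id (fun=> Y0) X Y0); [exact: cvg_id | exact: cvg_cst].
  have n0 : 0 < enorm (X - Y0) by rewrite lt_neqAle eq_sym enorm_eq0 subr_eq0 XY enorm_ge0.
  have h : \forall Z \near X, 0 < enorm (Z - Y0) by exact: (cvgr_gt _ cn _ n0).
  apply: filterS h => Z; apply: contraTneq => ->.
  by rewrite subrr /enorm edot0l sqrtr0 ltxx.
apply: filterS2 near_ne hU => Z ZY hZ cZ.
have dZ : dominant Sp Z by move=> a /cZ/ltW.
have cY : ProperFilter (within (chamber Sp) (nbhs Y0)).
  exact: within_nbhs_proper.
have cvgY : id Y @[Y --> within (chamber Sp) (nbhs Y0)] --> Y0.
  by apply: cvg_within.
have lim : image_quotient S Sp phi Z Y @[Y --> within (chamber Sp) (nbhs Y0)] --> k Z.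
  apply: (@slice_limit _ _ _ Z (fun=> Z) id) => //; first exact: cvg_cst.
    by apply: nearW.
  exact: withinT.
have lim' : `|k X - image_quotient S Sp phi Z Y| @[Y --> within (chamber Sp) (nbhs Y0)] --> `|k X - k Z|.
  by apply: cvg_norm; apply: cvgB => //; exact: cvg_cst.
rewrite -(cvg_lim (@norm_hausdorff _ _) lim'); apply: limr_le.
  by apply/cvg_ex; eexists; exact: lim'.
apply: filterS hV => Y hY cYc; apply: (UV (Z, Y)) => //.
Qed.

Let W' := [seq w <- weyl_seq S | w *m Y0 == Y0].
Let W'' := [seq w <- weyl_seq S | w *m Y0 != Y0].

Lemma mem_stab w : (w \in W') <-> weyl_group S' w.
Proof.
rewrite mem_filter; split.
  move=> /andP[/eqP wY /(mem_weyl_seq hS) wW].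
  by apply/(weyl_stabilizer hS hv hSp).
by move=> /(weyl_stabilizer hS hv hSp _ dY0)[/(mem_weyl_seq hS) -> ->]; rewrite eqxx.
Qed.

Lemma perm_stab : perm_eq W' (weyl_seq S').
Proof.
apply: uniq_perm; [exact/filter_uniq/uniq_weyl_seq | exact: uniq_weyl_seq|].
move=> w; apply/idP/idP => [/mem_stab/(mem_weyl_seq hS')//|/(mem_weyl_seq hS')/mem_stab//].
Qed.

Let kappa := g`!%:R * 2 ^+ g / root_prod Sp' (root_sum Sp').

Lemma stab_pow_low n X Y : (n < g)%N -> \sum_(w <- W') \det w * edot X (w *m Y) ^+ n = 0.
Proof.
by move=> ng; rewrite (perm_big _ perm_stab) /=; have [+ _] := weyl_pow_low hS' hv' hSp'; apply.
Qed.

Lemma stab_pow_eq X Y : \sum_(w <- W') \det w * edot X (w *m Y) ^+ g =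
  kappa * (root_prod Sp' X * root_prod Sp' Y).
Proof.
by rewrite (perm_big _ perm_stab) /=; have [_ [_ +]] := weyl_pow_low hS' hv' hSp'; apply.
Qed.

(** The value at [(X, Y0)] of the kernel of the stabilizer of [Y0], divided by
    the products of the roots that vanish at [Y0]. *)
Definition leading X :=
  kappa * c g (edot (X - Y0) (X - Y0)) * (2 / edot (X - Y0) (X - Y0)) ^+ g.

Lemma limn_series_single (m : nat) (K : R) (l : nat -> R) :
  (forall n : nat, (n != m)%N -> l n = 0) -> l m = K -> limn (series l) = K.
Proof.
move=> l0 lm; apply: cvg_lim => //; apply: cvg_near_cst.
near=> n; have mn : (m < n)%N by near: n; exact: nbhs_infty_gt.
rewrite /series /= (big_rem m) ?mem_index_iota //= lm big_seq big1 ?addr0 //.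
move=> i; rewrite mem_rem_uniq ?iota_uniq // inE => /andP[im _]; exact: l0.
Unshelve. all: by end_near. Qed.

(** Along a segment leaving [Y0], the sum over the stabilizer is, to leading
    order, the term of degree [g] of its expansion. *)
Lemma stab_limit X : X != Y0 ->
  t ^- g * alt_kernel phi W' X (Y0 + t *: v) @[t --> (0 : R)^'+] -->
  root_prod Sp' X * root_prod Sp' v * leading X.
Proof.
have shuffle (x y z r q : R) : x * y * (z * (r * q)) = r * q * (z * x * y) by ring.
have half_le (y : R) : y <= 4^-1 -> 2 * y <= 2^-1 by lra.
have lt1_chain (x y z : R) : x <= y -> y <= z -> z <= 4^-1 -> x < 1 by lra.
move=> XY; case: hphi => phi_sum c_bound c_cont b_cont.
set X' := X - Y0.
have a00 : 0 < edot X' X' by rewrite edot_gt0 subr_eq0.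
pose A (t : R) := edot X' X' + t ^+ 2 * edot v v.
have A0 t : edot X' X' <= A t by rewrite lerDl mulr_ge0 ?sqr_ge0 ?edot_ge0.
have Ap t : 0 < A t by apply: lt_le_trans (A0 t).
pose s n := \sum_(w <- W') \det w * edot X' (w *m v) ^+ n.
pose f n (t : R) := c n (A t) * (2 / A t) ^+ n * t ^+ (n - g) * s n.
have cid : (fun t : R => t) t @[t --> (0 : R)^'+] --> (0 : R).
  exact: (cvg_at_right_filter (@cvg_id _ _)).
have cA : A t @[t --> (0 : R)^'+] --> edot X' X'.
  have h : A t @[t --> (0 : R)^'+] --> edot X' X' + 0 ^+ 2 * edot v v.
    apply: cvgD; first exact: cvg_cst.
    by apply: cvgM; [exact: cvg_pow | exact: cvg_cst].
  by rewrite expr0n mul0r addr0 in h.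
pose l n := c n (edot X' X') * (2 / edot X' X') ^+ n * 0 ^+ (n - g) * s n.
have fl n : f n t @[t --> (0 : R)^'+] --> l n.
  apply: cvgM; last exact: cvg_cst.
  apply: cvgM; last exact: cvg_pow.
  apply: cvgM.
    exact: (@continuous_cvg _ _ _ _ _ A (c n) _ (c_cont n _ a00) cA).
  apply: cvg_pow; apply: cvgM; first exact: cvg_cst.
  by apply: cvgV => //; rewrite gt_eqF.
have W'o w : w \in W' -> orth_mx w.
  by rewrite mem_filter => /andP[_]; exact: (weyl_seq_ortho hS).
pose N := enorm X' * enorm v.
have N0 : 0 <= N by rewrite mulr_ge0 ?enorm_ge0.
have wN w : w \in W' -> `|edot X' (w *m v)| <= N.
  by move=> wW; apply: (le_trans (cauchy_schwarz _ _)); rewrite (enorm_ortho _ (W'o w wW)).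
have sb n : `|s n| <= (size W')%:R * N ^+ n.
  rewrite /s; apply: (le_trans (ler_norm_sum _ _ _)).
  rewrite big_seq; apply: (@le_trans _ _ (\sum_(w <- W' | w \in W') N ^+ n)).
    apply: ler_sum => w wW; rewrite normrM.
    have -> : `|\det w| = 1.
      have : \det w ^+ 2 = 1.
        by rewrite expr2 -[X in X * _](det_tr w) -det_mulmx (W'o w wW) det1.
      by move/eqP; rewrite sqrf_eq1 => /orP[]/eqP ->; rewrite ?normrN normr1.
    rewrite mul1r normrX; apply: lerXn2r; rewrite ?nnegrE //; exact: wN.
  by rewrite -big_seq big_const_seq count_predT iter_addr_0 mulr_natl.
pose sg := 2 / edot X' X' * N.
have sg0 : 0 <= sg by rewrite mulr_ge0 // divr_ge0 // ltW.
pose t0 := (4 * (sg + 1))^-1.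
have t0p : 0 < t0 by rewrite invr_gt0 mulr_gt0 // ltr_wpDl.
have st0 : sg * t0 <= 4^-1.
  rewrite /t0 invfM mulrCA ger_pMr ?invr_gt0 // ler_pdivrMr ?ltr_wpDl // mul1r lerDl //.
have near_t : \forall t \near (0 : R)^'+, 0 < t /\ t <= t0.
  have h1 : \forall t \near (0 : R)^'+, 0 < t by apply: nbhs_right_gt.
  have h2 : \forall t \near (0 : R)^'+, t <= t0 by apply: nbhs_right_le.
  by apply: filterS2 h1 h2.
have near_b : \forall t \near (0 : R)^'+, b (A t) < b (edot X' X') + 1.
  have lt1 : b (edot X' X') < b (edot X' X') + 1 by rewrite ltrDl.
  exact: (cvgr_lt _ (@continuous_cvg _ _ _ _ _ A b _ (b_cont _ a00) cA) _ lt1).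
have [D D0 hD] := poly_le_geometric p (ltr1n R 2).
have b0 : 0 <= b (edot X' X').
  by have := c_bound 0 _ a00; rewrite expr1n mulr1; apply: le_trans.
have K0 : 0 <= (b (edot X' X') + 1) * D * (size W')%:R * t0 ^- g.
  rewrite !mulr_ge0 // ?addr_ge0 // invr_ge0 exprn_ge0 //; exact: ltW.
have fb : \forall t \near (0 : R)^'+, forall n,
    `|f n t| <= (b (edot X' X') + 1) * D * (size W')%:R * t0 ^- g * 2^-1 ^+ n.
  apply: filterS2 near_t near_b => t [tp tt0] bt n.
  have [ng|gn] := ltnP n g.
    rewrite /f /s stab_pow_low // mulr0 normr0.
    by rewrite mulr_ge0 // exprn_ge0 // invr_ge0.
  have i0 : 0 <= 2 / A t by rewrite divr_ge0 // ltW.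
  have i1 : 2 / A t <= 2 / edot X' X'.
    by rewrite ler_wpM2l // lef_pV2 ?posrE.
  rewrite /f 3!normrM (ger0_norm (exprn_ge0 _ i0)) (ger0_norm (exprn_ge0 _ (ltW tp))).
  apply: (@le_trans _ _ ((b (edot X' X') + 1) * (D * 2 ^+ n) * (2 / edot X' X') ^+ n *
      t0 ^+ (n - g) * ((size W')%:R * N ^+ n))).
    have n_i : 0 <= (2 / A t) ^+ n by rewrite exprn_ge0.
    have n_t : 0 <= t ^+ (n - g) by rewrite exprn_ge0 // ltW.
    have e_c : `|c n (A t)| <= (b (edot X' X') + 1) * (D * 2 ^+ n).
      apply: (le_trans (c_bound n _ (Ap t))); apply: ler_pM; rewrite ?exprn_ge0 //.
        by have := c_bound 0 _ (Ap t); rewrite expr1n mulr1; apply: le_trans.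
      exact: ltW.
    have e_i : (2 / A t) ^+ n <= (2 / edot X' X') ^+ n.
      by apply: lerXn2r; rewrite ?nnegrE // (le_trans i0).
    have e_t : t ^+ (n - g) <= t0 ^+ (n - g).
      by apply: lerXn2r; rewrite ?nnegrE // ltW.
    have n_c := normr_ge0 (c n (A t)); have n_ci := mulr_ge0 n_c n_i.
    exact: (ler_pM (mulr_ge0 n_ci n_t) (normr_ge0 _)
      (ler_pM n_ci n_t (ler_pM n_c n_i e_c e_i) e_t) (sb n)).
  have -> : t0 ^+ (n - g) = t0 ^+ n * t0 ^- g.
    by rewrite -[in RHS](subnK gn) exprD mulfK // expf_neq0 // gt_eqF.
  have -> : (b (edot X' X') + 1) * (D * 2 ^+ n) * (2 / edot X' X') ^+ n *
      (t0 ^+ n * t0 ^- g) * ((size W')%:R * N ^+ n) =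
      (b (edot X' X') + 1) * D * (size W')%:R * t0 ^- g * (2 * (sg * t0)) ^+ n.
    by rewrite /sg !(exprMn n); ring.
  rewrite ler_wpM2l //.
  have st : 0 <= sg * t0 by apply: mulr_ge0 => //; exact: ltW.
  have st1 := half_le _ st0.
  by apply: lerXn2r => //; rewrite nnegrE; [exact: mulr_ge0 | rewrite invr_ge0].
have fs : \forall t \near (0 : R)^'+,
    series (f^~ t) @ \oo --> t ^- g * alt_kernel phi W' X (Y0 + t *: v).
  apply: filterS near_t => t [tp tt0].
  have tg : t ^+ g != 0 by rewrite expf_neq0 // gt_eqF.
  pose x w := 2 * t / A t * edot X' (w *m v).
  have x1 w : w \in W' -> `|x w| < 1.
    move=> wW; rewrite /x normrM ger0_norm; last first.
      by rewrite divr_ge0 ?mulr_ge0 // ltW.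
    have e1 : 2 * t / A t <= 2 / edot X' X' * t.
      rewrite mulrAC ler_wpM2r ?(ltW tp) // ler_wpM2l // lef_pV2 ?posrE //.
    have e2 : sg * t <= sg * t0 by rewrite ler_wpM2l.
    have e3 : 2 * t / A t * `|edot X' (w *m v)| <= sg * t.
      have -> : sg * t = 2 / edot X' X' * t * N by rewrite /sg mulrAC.
      apply: ler_pM => //; last exact: wN.
      by apply: divr_ge0; [apply: mulr_ge0 => //; exact: ltW | exact: ltW].
    exact: (lt1_chain _ _ _ e3 e2 st0).
  have H : series (fun n => \sum_(w <- W') \det w * (c n (A t) * x w ^+ n)) @ \oo -->
      alt_kernel phi W' X (Y0 + t *: v).
    apply: (@cvg_series_bigsum _ _ _ (fun w n => \det w * (c n (A t) * x w ^+ n))) => w wW.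
    apply: cvg_seriesZ.
    have wY : w *m Y0 = Y0 by move: wW; rewrite mem_filter => /andP[/eqP].
    have -> : X - w *m (Y0 + t *: v) = X' - t *: (w *m v).
      by rewrite mulmxDr wY -scalemxAr opprD addrA.
    have -> : edot (X' - t *: (w *m v)) (X' - t *: (w *m v)) = A t * (1 - x w).
      rewrite edot_sq edotZl !edotZr (edot_ortho _ _ (W'o w wW)) /x.
      have := gt_eqF (Ap t); rewrite /A.
      move: (edot X' X') (edot v v) (edot X' (w *m v)) => q1 q2 q3 /negbT n0.
      by field.
    by apply: phi_sum; rewrite ?Ap // x1.
  have E : (fun n => f n t) =
      (fun n => t ^- g * \sum_(w <- W') \det w * (c n (A t) * x w ^+ n)).
    apply/funext => n.
    have -> : \sum_(w <- W') \det w * (c n (A t) * x w ^+ n) =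
       c n (A t) * (2 / A t) ^+ n * t ^+ n * s n.
      rewrite /s mulr_sumr; apply: eq_bigr => w _.
      rewrite /x -[2 * t / A t]mulrAC !(exprMn n); ring.
    rewrite /f; have [ng|gn] := ltnP n g.
      by rewrite /s stab_pow_low // !mulr0.
    have -> : t ^+ n = t ^+ (n - g) * t ^+ g by rewrite -exprD subnK.
    by move: (t ^+ g) tg (t ^+ (n - g)) ((2 / A t) ^+ n) => q q0 q1 q2; field.
  by rewrite E; apply: cvg_seriesZ.
have r0 : 0 <= 2^-1 :> R by rewrite invr_ge0.
have r1 : 2^-1 < 1 :> R by rewrite invf_lt1 // ltr1n.
have El : limn (series l) = root_prod Sp' X * root_prod Sp' v * leading X.
  apply: (@limn_series_single g) => [n|].
    rewrite neq_ltn => /orP[ng|gn]; first by rewrite /l /s stab_pow_low // mulr0.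
    by rewrite /l expr0n subn_eq0 leqNgt gn mulr0 mul0r.
  rewrite /l subnn expr0 mulr1 /s stab_pow_eq -root_prod_at_shift /leading -/X'.
  exact: shuffle.
by rewrite -El; apply: (cvg_series_dominated _ r0 r1 fl fb fs).
Qed.

Let W''_left a w : a \in Sp' -> w \in W'' -> reflection_mx a *m w \in W''.
Proof.
rewrite mem_roots_at !mem_filter => /andP[aSp /eqP a0] /andP[wY wW].
rewrite (weyl_seq_left hS hSp) // andbT; apply: contraNN wY => /eqP E.
have a1 := pos_root_neq0 hS hSp aSp.
have : reflection_mx a *m (reflection_mx a *m w *m Y0) = w *m Y0.
  by rewrite !mulmxA refl_mxK // mul1mx.
by rewrite E refl_mxE a0 mulr0 mul0r scale0r subr0 => <-.
Qed.

Let W''_right a w : a \in Sp' -> w \in W'' -> w *m reflection_mx a \in W''.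
Proof.
rewrite mem_roots_at !mem_filter => /andP[aSp /eqP a0] /andP[wY wW].
rewrite (weyl_seq_right hS hSp) // andbT -mulmxA refl_mxE a0.
by rewrite mulr0 mul0r scale0r subr0.
Qed.

(** For regular [X], the quotient has the singularity of its leading term, up
    to a bounded error: the elements outside of the stabilizer contribute a
    kernel that is regular at [(Y0, Y0)]. *)
Lemma regular_asymptotic : exists C0, \forall X \near Y0, chamber Sp X -> X != Y0 ->
  `|transverse_prod X * transverse_prod Y0 * k X - leading X| <= C0.
Proof.
have sing w : w \in W'' -> Y0 != w *m Y0.
  by rewrite mem_filter eq_sym => /andP[].
have W''o w : w \in W'' -> orth_mx w.
  by rewrite mem_filter => /andP[_]; exact: (weyl_seq_ortho hS).
have [K cK EK] := alt_kernel_division hphi (filter_uniq _ (uniq_weyl_seq S)) W''o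
  (pos_root_neq0 hS' hSp') W''_left W''_right
  (pos_roots_generic hS' hSp') (fset_uniq Sp') sing.
exists (`|K Y0 Y0| + 1).
have near_K : \forall z \near (Y0, Y0), `|K z.1 z.2| < `|K Y0 Y0| + 1.
  have lt1 : `|K Y0 Y0| < `|K Y0 Y0| + 1 by rewrite ltrDl.
  exact: (cvgr_lt _ (cvg_norm cK) _ lt1).
have [[U V] /= [hU hV] UV] := filterI near_K EK.
apply: filterS hU => X hX cX XY.
have dX : dominant Sp X by move=> a /cX/ltW.
have [p0 p'0 p''0] := chamber_neq0 cX.
have cv : chamber Sp v by exact: chamberv.
have [_ v'0 _] := chamber_neq0 cv.
have cYt : Y0 + t *: v @[t --> (0 : R)^'+] --> Y0 by exact: cvg_line.
have near_ch : \forall t \near (0 : R)^'+, chamber Sp (Y0 + t *: v).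
  have h1 : \forall t \near (0 : R)^'+, 0 < t by apply: nbhs_right_gt.
  apply: filterS h1 => t t0 a aSp; rewrite edotDr edotZr ltr_wpDl ?dY0 //.
  by rewrite mulr_gt0 // (pos_height hSp).
have lim1 : image_quotient S Sp phi X (Y0 + t *: v) @[t --> (0 : R)^'+] --> k X.
  apply: (@slice_limit _ _ _ X (fun=> X)) => //; first exact: cvg_cst.
  exact: nearW.
have lim2 := stab_limit XY.
(* By the splitting of the group, [H t] is the quotient of the kernel of the
   elements outside of the stabilizer. *)
pose H t := transverse_prod X * transverse_prod (Y0 + t *: v) *
    image_quotient S Sp phi X (Y0 + t *: v) -
  (t ^- g * alt_kernel phi W' X (Y0 + t *: v)) / (root_prod Sp' X * root_prod Sp' v).
have limH : H t @[t --> (0 : R)^'+] -->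
    transverse_prod X * transverse_prod Y0 * k X -
    (root_prod Sp' X * root_prod Sp' v * leading X) / (root_prod Sp' X * root_prod Sp' v).
  apply: cvgB; last by apply: cvgM => //; exact: cvg_cst.
  apply: cvgM => //; apply: cvgM; [exact: cvg_cst | exact: cvg_transverse_prod].
rewrite [X in _ - X / _]mulrC mulfK ?mulf_neq0 // in limH.
have limH' : `|H t| @[t --> (0 : R)^'+] -->
    `|transverse_prod X * transverse_prod Y0 * k X - leading X| by exact: cvg_norm limH.
rewrite -(cvg_lim (@norm_hausdorff _ _) limH'); apply: limr_le.
  by apply/cvg_ex; eexists; exact: limH'.
have hV' : \forall t \near (0 : R)^'+, V (Y0 + t *: v) := cYt _ hV.
have h1 : \forall t \near (0 : R)^'+, 0 < t by apply: nbhs_right_gt.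
apply: filterS3 near_ch hV' h1 => t ct Vt t0.
have [b1 E1] := UV (X, Y0 + t *: v) (conj hX Vt).
suff -> : H t = K X (Y0 + t *: v) by exact: ltW.
have [q0 q'0 q''0] := chamber_neq0 ct.
have E2 : alt_kernel phi (weyl_seq S) X (Y0 + t *: v) =
    alt_kernel phi W' X (Y0 + t *: v) +
    root_prod Sp' X * root_prod Sp' (Y0 + t *: v) * K X (Y0 + t *: v).
  have E1' : alt_kernel phi W'' X (Y0 + t *: v) =
    root_prod Sp' X * root_prod Sp' (Y0 + t *: v) * K X (Y0 + t *: v) := E1.
  rewrite -E1' /alt_kernel (bigID (fun w => w *m Y0 == Y0)) /=.
  by rewrite !big_filter.
have E3 : root_prod Sp' (Y0 + t *: v) = t ^+ g * root_prod Sp' v.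
  by rewrite root_prod_at_shift addrAC subrr add0r root_prodZ.
have tg : t ^+ g != 0 by rewrite expf_neq0 // gt_eqF.
rewrite /H /image_quotient E2 !root_prod_split E3.
rewrite E3 in q'0.
move: p'0 p''0 v'0 q''0 tg.
move: (root_prod Sp' X) (transverse_prod X) (root_prod Sp' v) (transverse_prod (Y0 + t *: v))
  (t ^+ g) (alt_kernel phi W' X (Y0 + t *: v)) (K X (Y0 + t *: v)).
move=> y1 y2 y3 y4 y5 y6 y7 n1 n2 n3 n4 n5.
by field; rewrite n1 n2 n3 n4 n5.
Qed.

Lemma cvg_edot_shift (A : Type) (F : set_system A) (FF : Filter F) (f : A -> 'cV[R]_d) (X : 'cV[R]_d) :
  f t @[t --> F] --> X ->
  edot (f t - Y0) (f t - Y0) @[t --> F] --> edot (X - Y0) (X - Y0).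
Proof. by move=> fX; apply: cvg_edot; apply: cvg_vecB => //; exact: cvg_cst. Qed.

Lemma near_neq (X : 'cV[R]_d) : X != Y0 -> \forall Z \near X, Z != Y0.
Proof.
move=> XY; have n0 : 0 < edot (X - Y0) (X - Y0) by rewrite edot_gt0 subr_eq0.
have h : \forall Z \near X, 0 < edot (Z - Y0) (Z - Y0).
  exact: (cvgr_gt _ (@cvg_edot_shift _ (nbhs X) _ id X cvg_id) _ n0).
by apply: filterS h => Z; rewrite edot_gt0 subr_eq0.
Qed.

Lemma cvg_leading (A : Type) (F : set_system A) (FF : Filter F) (f : A -> 'cV[R]_d) (X : 'cV[R]_d) :
  X != Y0 -> f t @[t --> F] --> X -> leading (f t) @[t --> F] --> leading X.
Proof.
move=> XY fX; case: hphi => phi_sum c_bound c_cont b_cont.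
have n0 : 0 < edot (X - Y0) (X - Y0) by rewrite edot_gt0 subr_eq0.
have cs := cvg_edot_shift FF fX.
apply: cvgM.
  apply: cvgM; first exact: cvg_cst.
  exact: (@continuous_cvg _ _ _ _ _ (fun t => edot (f t - Y0) (f t - Y0)) (c g) _ (c_cont g _ n0) cs).
apply: cvg_pow; apply: cvgM; first exact: cvg_cst.
by apply: cvgV => //; rewrite gt_eqF.
Qed.

(** The same for all [X] in the closed chamber, by continuity. *)
Lemma closed_asymptotic : exists C0, \forall X \near Y0, closure (chamber Sp) X -> X != Y0 ->
  `|transverse_prod X * transverse_prod Y0 * k X - leading X| <= C0.
Proof.
have [C0 hC] := regular_asymptotic; exists C0.
have {}hC := near_join hC.
apply: filterS hC => X hX cX XY.
have FX : ProperFilter (within (chamber Sp) (nbhs X)) by exact: within_nbhs_proper.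
have lim : transverse_prod Z * transverse_prod Y0 * k Z - leading Z @[Z --> within (chamber Sp) (nbhs X)] -->
    transverse_prod X * transverse_prod Y0 * k X - leading X.
  apply: cvgB; last by apply: cvg_within_filter; exact: (@cvg_leading _ (nbhs X) _ id X XY cvg_id).
  apply: cvgM; last exact: k_continuous.
  apply: cvgM; last exact: cvg_cst.
  by apply: cvg_within_filter; exact: (@cvg_transverse_prod _ (nbhs X) _ id X cvg_id).
have lim' : `|transverse_prod Z * transverse_prod Y0 * k Z - leading Z|
    @[Z --> within (chamber Sp) (nbhs X)] -->
    `|transverse_prod X * transverse_prod Y0 * k X - leading X| by exact: cvg_norm lim.
rewrite -(cvg_lim (@norm_hausdorff _ _) lim'); apply: limr_le.
  by apply/cvg_ex; eexists; exact: lim'.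
have h := near_neq XY.
have h' : \forall Z \near X, chamber Sp Z ->
    `|transverse_prod Z * transverse_prod Y0 * k Z - leading Z| <= C0.
  by apply: filterS2 h hX => Z ZY hZ cZ; apply: hZ.
exact: h'.
Qed.

(** When the leading term is a negative power of the distance to [Y0], the
    bounded error is negligible. *)
Lemma ratio_limit (K : R) (N : nat) : (0 < N)%N -> K != 0 ->
  (forall X, X != Y0 -> leading X = K / enorm (X - Y0) ^+ N) ->
  transverse_prod Y0 ^+ 2 * k X * enorm (X - Y0) ^+ N / K
    @[X --> within [set X | closure (chamber Sp) X /\ X != Y0] (nbhs Y0)] --> (1 : R).
Proof.
move=> N0 K0 hlead; have [C0 hC] := closed_asymptotic.
have cco : transverse_prod X @[X --> Y0] --> transverse_prod Y0.
  exact: (@cvg_transverse_prod _ (nbhs Y0) _ id Y0 cvg_id).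
have cen : enorm (X - Y0) ^+ N @[X --> Y0] --> (0 : R).
  have h : enorm (X - Y0) ^+ N @[X --> Y0] --> enorm (Y0 - Y0) ^+ N.
    apply: (@cvg_pow R _ (nbhs Y0)); apply: (@cvg_enorm R d _ (nbhs Y0) _ (fun Z => Z - Y0) (Y0 - Y0)).
    by apply: (@cvg_vecB R _ (nbhs Y0) _ d id (fun=> Y0) Y0 Y0); [exact: cvg_id | exact: cvg_cst].
  by rewrite subrr /enorm edot0l sqrtr0 expr0n gtn_eqF // in h.
have co0 := transverse_prod_neq0.
pose F := within [set X | closure (chamber Sp) X /\ X != Y0] (nbhs Y0).
have FF : Filter F by exact: within_filter.
have near_co : \forall X \near Y0, transverse_prod X != 0 by exact: (cvgr_neq0 _ cco co0).
pose E X := (transverse_prod X * transverse_prod Y0 * k X - leading X) * enorm (X - Y0) ^+ N / K.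
have cE : E X @[X --> F] --> (0 : R).
  have c1 : `|C0| * enorm (X - Y0) ^+ N / `|K| @[X --> F] --> (0 : R).
    have -> : (0 : R) = `|C0| * 0 / `|K| by rewrite mulr0 mul0r.
    apply: cvgM; last exact: cvg_cst.
    by apply: cvgM; [exact: cvg_cst | exact: cvg_within_filter].
  have c2 : `|E X| @[X --> F] --> (0 : R).
    apply: (squeeze_cvgr _ (cvg_cst (0 : R)) c1).
    apply: filterS hC => X hX [cX XY]; rewrite normr_ge0 /=.
    rewrite /E !normrM normfV ler_wpM2r ?invr_ge0 //.
    rewrite (ger0_norm (exprn_ge0 _ (enorm_ge0 _))) ler_wpM2r ?exprn_ge0 ?enorm_ge0 //.
    exact: (le_trans (hX cX XY) (ler_norm _)).
  by apply/cvgr0Pnorm_lt => e e0; have /cvgr0Pnorm_lt /(_ e e0) := c2; apply: filterS => X; rewrite normr_id.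
have cG : transverse_prod Y0 / transverse_prod X * (E X + 1) @[X --> F] --> (1 : R).
  have : transverse_prod Y0 / transverse_prod X * (E X + 1) @[X --> F] -->
      transverse_prod Y0 / transverse_prod Y0 * (0 + 1).
    apply: cvgM; last by apply: cvgD => //; exact: cvg_cst.
    apply: cvgM; first exact: cvg_cst.
    by apply: cvgV => //; apply: cvg_within_filter.
  by rewrite divff // mul1r add0r.
apply: cvg_trans cG; apply: near_eq_cvg.
apply: filterS near_co => X X0 [cX XY].
rewrite /E hlead //.
have e0 : enorm (X - Y0) ^+ N != 0 by rewrite expf_neq0 // enorm_eq0 subr_eq0.
move: X0 e0 K0 co0; move: (enorm _ ^+ N) (transverse_prod X) (transverse_prod Y0) (k X).
move=> y1 y2 y3 y4 n2 n1 nK n3.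
by field; rewrite n1 n2 nK.
Qed.

End Asymptotics.

(** * Euler's integral for the Gamma function is a positive number *)

Section Gamma.
Variable R : realType.
Notation mu := (@lebesgue_measure R).

Lemma expR_dominates (N : nat) (x : R) : 0 <= x ->
  (1 + x) ^+ N.+1 <= N.+1%:R ^+ N.+1 * expR x.
Proof.
move=> x0; have N0 : 0 < N.+1%:R :> R by rewrite ltr0n.
have -> : expR x = expR (x / N.+1%:R) ^+ N.+1.
  by rewrite -expRM_natr divfK // gt_eqF.
rewrite -exprMn; apply: lerXn2r; rewrite ?nnegrE ?addr_ge0 ?mulr_ge0 ?expR_ge0 //.
apply: (@le_trans _ _ (N.+1%:R * (1 + x / N.+1%:R))).
  by rewrite mulrDr mulr1 mulrC divfK ?gt_eqF // lerD2r ler1n.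
by rewrite ler_wpM2l // expR_ge1Dx.
Qed.

(** Near [0] and at infinity, [x^(s-1) exp(-x)] is dominated by a multiple of
    the derivative of the bounded function [s^-1 (x / (1 + x))^s]. *)
Variable s : R.
Hypothesis s0 : 0 < s.

Let f (x : R) := x `^ (s - 1) * expR (- x).
Let u (x : R) := x / (1 + x).
Let g (x : R) := u x `^ (s - 1) * (1 + x) ^- 2.
Let G (x : R) := s^-1 * u x `^ s.

Let f_ge0 x : 0 <= f x. Proof. by rewrite mulr_ge0 ?powR_ge0 ?expR_ge0. Qed.

Let mf : measurable_fun setT f.
Proof.
apply: measurable_funM; first exact: measurable_powR.
by apply: measurableT_comp => //; exact: measurableT_comp.
Qed.

Let dG (x : R) : 0 < x -> is_derive x (1 : R) G (g x).
Proof.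
move=> x0; have x1 : 0 < 1 + x by rewrite addr_gt0.
have u0 : 0 < u x by rewrite divr_gt0.
have d1 : is_derive x (1 : R) (fun z : R => 1 + z) 1.
  apply: (is_derive_eq (is_deriveD (is_derive_cst _ _ _) (is_derive_id _ _))).
  by rewrite add0r.
have n1 : 1 + x != 0 by rewrite gt_eqF.
have du : is_derive x (1 : R) u ((1 + x) ^- 2).
  apply: (is_derive_eq (is_deriveM (is_derive_id _ _) (is_deriveV n1 d1))).
  by rewrite /GRing.scale /=; field.
have dp : is_derive x (1 : R) (fun z => u z `^ s) (s * u x `^ (s - 1) * (1 + x) ^- 2).
  exact: (@is_derive1_comp R (fun z => z `^ s) u x _ _ (is_derive1_powR s u0) du).
apply: (is_derive_eq (is_deriveZ s^-1 dp)).
rewrite /g /GRing.scale /=; move: (u x `^ (s - 1)) ((1 + x) ^- 2) => y1 y2.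
by field; rewrite gt_eqF.
Qed.

Let G_le x : 0 < x -> G x <= s^-1.
Proof.
move=> x0; rewrite /G ler_piMr ?invr_ge0 ?(ltW s0) //.
have -> : 1 = 1 `^ s :> R by rewrite powR1.
apply: ge0_ler_powR; rewrite ?nnegrE ?(ltW s0) ?divr_ge0 ?addr_ge0 ?(ltW x0) //.
by rewrite /u ler_pdivrMr ?addr_gt0 // mul1r lerDr.
Qed.

Let dominated : exists2 C, 0 <= C & forall x, 0 < x -> f x <= C * g x.
Proof.
have [N hN] : exists N : nat, s + 1 <= N.+1%:R.
  exists (Num.truncn (s + 1)); rewrite ltW // truncnS_gt //.
exists (N.+1%:R ^+ N.+1); first by rewrite exprn_ge0.
move=> x x0; have x1 : 0 < 1 + x by rewrite addr_gt0.
have n1 : 1 + x != 0 by rewrite gt_eqF.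
have -> : f x = u x `^ (s - 1) * ((1 + x) `^ (s - 1) * expR (- x)).
  rewrite /f mulrA -powRM ?divr_ge0 ?(ltW x0) ?(ltW x1) //.
  by rewrite /u divfK.
rewrite /g [leRHS]mulrCA ler_wpM2l ?powR_ge0 //.
rewrite ler_pdivlMr ?exprn_gt0 // mulrAC -powR_mulrn ?(ltW x1) // -powRD; last first.
  by rewrite (negPf n1) implybT.
rewrite expRN ler_pdivrMr ?expR_gt0 //.
have -> : s - 1 + 2%:R = s + 1 by ring.
apply: le_trans (expR_dominates N (ltW x0)).
by rewrite -powR_mulrn ?(ltW x1) //; apply: ler_powR => //; rewrite lerDl ltW.
Qed.

Let I (n : nat) : set R := `[n.+1%:R^-1, n.+1%:R].

Let I_pos n x : I n x -> 0 < x.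
Proof.
by rewrite /I /= in_itv /= => /andP[+ _]; apply: lt_le_trans; rewrite invr_gt0 ltr0n.
Qed.

Let bigcup_I : \bigcup_n I n = `]0, +oo[%classic.
Proof.
apply/seteqP; split => x.
  by move=> [n _ /I_pos x0]; rewrite /= in_itv /= x0.
rewrite /= in_itv /= andbT => x0.
exists (Num.truncn (Num.max x x^-1)) => //=; rewrite /I /= in_itv /=.
have h : Num.max x x^-1 < (Num.truncn (Num.max x x^-1)).+1%:R.
  by rewrite truncnS_gt.
move: h; rewrite gt_max => /andP[h1 h2]; rewrite (ltW h1) andbT.
by rewrite invf_ple ?posrE ?ltr0n // ltW.
Qed.

Let integral_bound : exists C : R, forall n, (\int[mu]_(x in I n) (f x)%:E <= C%:E)%E.
Proof.
have [C C0 hC] := dominated; exists (C / s) => n.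
have mI : measurable (I n) by exact: measurable_itv.
have cg : {within `[n.+1%:R^-1, n.+1%:R], continuous g}.
  apply: continuous_in_subspaceT => x /set_mem /I_pos x0.
  have x1 : 1 + x != 0 by rewrite gt_eqF // addr_gt0.
  have u0 : 0 < u x by rewrite divr_gt0 // addr_gt0.
  have c1 : {for x, continuous (fun x : R => 1 + x)} by apply: cvgD; [exact: cvg_cst | exact: cvg_id].
  have cu : {for x, continuous u} by apply: cvgM; [exact: cvg_id | exact: cvgV].
  apply: cvgM.
    apply: (@continuous_cvg _ _ _ _ _ u (fun z => z `^ (s - 1))) => //.
    apply: differentiable_continuous; apply/derivable1_diffP.
    by have [] := is_derive1_powR (s - 1) u0.
  by apply: cvgV; [rewrite expf_neq0 | apply: cvg_pow].
have [n0|n0] := eqVneq n 0%N.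
  rewrite n0 /I invr1 set_itv1 integral_set1 lee_fin.
  by rewrite divr_ge0 // ltW.
have lt : n.+1%:R^-1 < n.+1%:R :> R.
  rewrite (@lt_trans _ _ 1) // ?invf_lt1 ?ltr1n ?ltr0n //; lia.
have FTC := continuous_FTC2 lt cg.
apply: (@le_trans _ _ (\int[mu]_(x in I n) (C%:E * (g x)%:E))%E).
  apply: ge0_le_integral => //.
  - by move=> x _; rewrite lee_fin.
  - apply/measurable_EFinP; exact: measurable_funTS.
  - apply/measurable_EFinP/measurable_funM => //.
    exact: subspace_continuous_measurable_fun.
  - by move=> x /I_pos x0; rewrite -EFinM lee_fin hC.
have g_ge0 x : 0 < x -> 0 <= g x.
  by move=> x0; rewrite mulr_ge0 ?powR_ge0 // invr_ge0 exprn_ge0 // addr_ge0 // ltW.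
rewrite ge0_integralZl //; first last.
- by move=> x /I_pos x0; rewrite lee_fin g_ge0.
- by apply/measurable_EFinP; exact: subspace_continuous_measurable_fun.
rewrite (FTC G).
- rewrite -EFinB -EFinM lee_fin ler_wpM2l //.
  apply: le_trans (G_le (_ : 0 < n.+1%:R)); last by rewrite ltr0n.
  by rewrite gerBl mulr_ge0 ?invr_ge0 ?(ltW s0) ?powR_ge0.
- have cG x : 0 < x -> {for x, continuous G}.
    move=> x0; apply: differentiable_continuous; apply/derivable1_diffP.
    by have [] := dG x0.
  split.
  + by move=> x; rewrite in_itv /= => /andP[h _]; have [] := dG (lt_trans _ h); rewrite ?invr_gt0.
  + by apply: cvg_at_right_filter; apply: cG; rewrite invr_gt0.
  + by apply: cvg_at_left_filter; apply: cG.
- move=> x; rewrite in_itv /= => /andP[h _].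
  have x0 : 0 < x by apply: lt_trans h; rewrite invr_gt0.
  by rewrite derive1E; have [_ ->] := dG x0.
Qed.

Lemma euler_Gamma_gt0 : 0 < euler_Gamma s.
Proof.
have mp : measurable (`]0, +oo[ : set R) by exact: measurable_itv.
have [C hC] := integral_bound.
have fin : (\int[mu]_(x in `]0%R, +oo[) (f x)%:E <= C%:E)%E.
  have h := @ge0_nondecreasing_set_cvg_integral _ (measurableTypeR R) R I (EFin \o f) lebesgue_measure.
  rewrite bigcup_I in h.
  have {}h : (\int[mu]_(x in I i) (f x)%:E @[i --> \oo] --> \int[mu]_(x in `]0%R, +oo[) (f x)%:E)%E.
    apply: h.
    - apply/nondecreasing_seqP => n; rewrite subsetEset => x; rewrite /I /= !in_itv /= => /andP[h1 h2].
      apply/andP; split.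
        by apply: le_trans h1; rewrite lef_pV2 ?posrE ?ltr0n // ler_nat.
      by apply: (le_trans h2); rewrite ler_nat.
    - by move=> i; exact: measurable_itv.
    - by move=> i; apply/measurable_EFinP; exact: measurable_funTS.
    - by move=> i x _; rewrite /= lee_fin.
  rewrite -(cvg_lim _ h) //; apply: lime_le; first by apply/cvg_ex; eexists; exact: h.
  exact: nearW.
have pos : ((expR (-2) / 2)%:E <= \int[mu]_(x in `]0%R, +oo[) (f x)%:E)%E.
  have sub : `[1, 2]%classic `<=` (`]0, +oo[%classic : set R).
    by move=> x; rewrite /= !in_itv /= andbT => /andP[+ _]; apply: lt_le_trans.
  apply: (@le_trans _ _ (\int[mu]_(x in `[1%R, 2%R]) (f x)%:E)%E); last first.
    apply: ge0_subset_integral => //.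
    - by apply/measurable_EFinP; exact: measurable_funTS.
    - by move=> x _; rewrite lee_fin.
  have -> : ((expR (-2) / 2)%:E = \int[mu]_(x in `[1%R, 2%R]) (expR (-2) / 2 : R)%:E)%E.
    rewrite integral_cst; last exact: measurable_itv.
    rewrite /= lebesgue_measure_itv /= lte_fin ltr1n /= -EFinB -EFinM.
    by congr EFin; ring.
  apply: ge0_le_integral => //.
    by apply/measurable_EFinP; exact: measurable_funTS.
  move=> x; rewrite /= in_itv /= => /andP[x1 x2]; rewrite lee_fin /f mulrC.
  have x0 : 0 < x by apply: lt_le_trans x1.
  apply: ler_pM; rewrite ?expR_ge0 ?invr_ge0 //; last by rewrite ler_expR lerN2.
  rewrite powRB ?(gt_eqF x0) ?implybT // powRr1 ?(ltW x0) //.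
  apply: (@le_trans _ _ x^-1); first by rewrite lef_pV2 ?posrE.
  rewrite ler_peMl ?invr_ge0 ?(ltW x0) //.
  apply: (@le_trans _ _ (1 `^ s)); first by rewrite powR1.
  by apply: ge0_ler_powR; rewrite ?nnegrE // ltW.
rewrite /euler_Gamma /Rintegral; apply: fine_gt0; apply/andP; split.
  by apply: lt_le_trans pos; rewrite lte_fin divr_gt0 // expR_gt0.
exact: le_lt_trans fin (ltry _).
Qed.

End Gamma.

Lemma sphere_area_gt0 (R : realType) (d : nat) : (0 < d)%N -> 0 < sphere_area R d.
Proof.
move=> d0; rewrite /sphere_area divr_gt0 ?mulr_gt0 ?powR_gt0 ?pi_gt0 //.
by apply: euler_Gamma_gt0; rewrite divr_gt0 // ltr0n.
Qed.

(** * The kernels of the Dyson Brownian motion *)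

Section Final.
Variables (R : realType) (d : nat) (S Sp : {fset 'cV[R]_d}) (v : 'cV[R]_d).
Hypothesis hS : root_system S.
Hypothesis hv : forall a, a \in S -> edot a v != 0.
Hypothesis hSp : forall a, a \in Sp <-> (a \in S) && (0 < edot a v).
Variables (phi : R -> R) (c : nat -> R -> R) (b : R -> R) (p : nat).
Hypothesis hphi : expands phi c b p.
Variable Y0 : 'cV[R]_d.
Hypothesis hY0 : closure (chamber Sp) Y0.

Lemma image_quotient_extension : exists k : 'cV[R]_d -> R,
  forall X, dominant Sp X -> X != Y0 ->
  image_quotient S Sp phi z.1 z.2 @[z --> within (chamber2 Sp) (nbhs (X, Y0))] --> k X.
Proof.
have H X : exists k : R, dominant Sp X -> X != Y0 ->
    image_quotient S Sp phi z.1 z.2 @[z --> within (chamber2 Sp) (nbhs (X, Y0))] --> k.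
  have [[dX XY]|N] := pselect (dominant Sp X /\ X != Y0); last first.
    by exists 0 => dX XY; case: N.
  have [k hk] := image_quotient_limit hS hv hSp hphi dX (closure_dominant hY0) XY.
  by exists k.
by have [k hk] := choice H; exists k.
Qed.

Variable k : 'cV[R]_d -> R.
Hypothesis hk : forall X, dominant Sp X -> X != Y0 ->
  image_quotient S Sp phi z.1 z.2 @[z --> within (chamber2 Sp) (nbhs (X, Y0))] --> k X.

(** A kernel that is [image_quotient] up to continuous factors has a limit at
    the points [(X, Y0)] of the closed chambers. *)
Lemma kernel_quotient_limit (D : set ('cV[R]_d * 'cV[R]_d)) (pre : 'cV[R]_d -> R)
    (f : 'cV[R]_d * 'cV[R]_d -> R) (X : 'cV[R]_d) :
  dominant Sp X -> X != Y0 -> D `<=` chamber2 Sp ->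
  (forall z, D z -> f z = pre z.1 * transverse_prod Sp Y0 z.2 ^+ 2 * image_quotient S Sp phi z.1 z.2) ->
  pre z.1 @[z --> nbhs (X, Y0)] --> pre X ->
  f z @[z --> within D (nbhs (X, Y0))] --> pre X * transverse_prod Sp Y0 Y0 ^+ 2 * k X.
Proof.
move=> dX XY DC fE cpre.
have c1 : pre z.1 * transverse_prod Sp Y0 z.2 ^+ 2 * image_quotient S Sp phi z.1 z.2
    @[z --> within (chamber2 Sp) (nbhs (X, Y0))] -->
    pre X * transverse_prod Sp Y0 Y0 ^+ 2 * k X.
  apply: cvgM; last exact: hk.
  apply: cvg_within_filter; apply: cvgM => //; apply: cvg_pow.
  by apply: (@cvg_transverse_prod _ _ _ _ _ (nbhs (X, Y0)) _ snd Y0); exact: cvg_snd.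
move=> U hU.
have sub : [set z | chamber2 Sp z ->
      U (pre z.1 * transverse_prod Sp Y0 z.2 ^+ 2 * image_quotient S Sp phi z.1 z.2)] `<=`
    [set z | D z -> U (f z)].
  by move=> z hz Dz; rewrite fE //; apply: hz; apply: DC.
exact: (@filterS _ (nbhs (X, Y0)) _ _ _ sub (c1 U hU)).
Qed.

Lemma ratio_within (A B : set 'cV[R]_d) (f g : 'cV[R]_d -> R) :
  A `<=` B -> (forall X, A X -> g X = f X) ->
  f X @[X --> within B (nbhs Y0)] --> (1 : R) ->
  g X @[X --> within A (nbhs Y0)] --> (1 : R).
Proof.
move=> AB E h U hU.
have sub : [set X | B X -> U (f X)] `<=` [set X | A X -> U (g X)].
  by move=> X hX AX; rewrite E //; apply: hX; apply: AB.
exact: (@filterS _ (nbhs Y0) _ _ _ sub (h U hU)).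
Qed.

End Final.

(** In the plane, the only positive root that vanishes at a nonzero point is
    the given one. *)
Lemma roots_at_line (R : realType) (S Sp : {fset 'cV[R]_2}) (v Y0 b : 'cV[R]_2) :
  root_system S -> (forall a, a \in Sp <-> (a \in S) && (0 < edot a v)) ->
  Y0 != 0 -> b \in Sp -> edot b Y0 = 0 -> roots_at Sp Y0 = [fset b]%fset.
Proof.
move=> hS hSp Y00 bSp bY; apply/fsetP => r; rewrite mem_roots_at inE.
apply/andP/eqP => [[rSp /eqP rY]|->]; last by rewrite bSp bY.
apply/eqP; apply: contraT => rb.
have := pos_roots_generic hS hSp rSp bSp rb; rewrite hprojE ?(pos_root_neq0 hS hSp bSp) //.
have b0 : edot b b != 0 by rewrite edot_eq0 (pos_root_neq0 hS hSp bSp).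
suff -> : r = (edot b r / edot b b) *: b by rewrite edotZr divfK // subrr eqxx.
have cross : r 0 0 * b 1 0 = r 1 0 * b 0 0.
  move: rY bY; rewrite /edot !big_ord_recl !big_ord0 !addr0 => rY bY.
  have l1 : lift ord0 ord0 = 1 :> 'I_2 by apply: val_inj.
  rewrite !l1 in rY bY.
  have [y0|y0] := eqVneq (Y0 0 0) 0.
    have y1 : Y0 1 0 != 0.
      apply: contraNneq Y00 => y1; apply/eqP/matrixP => i j; rewrite ord1 mxE.
      by case: (unliftP ord0 i) => [i'|] ->; rewrite // (ord1 i') l1.
    rewrite y0 !mulr0 !add0r in rY bY.
    have r1 : r 1 0 = 0 by apply/eqP; move/eqP: rY; rewrite mulf_eq0 (negPf y1) orbF.
    have b1 : b 1 0 = 0 by apply/eqP; move/eqP: bY; rewrite mulf_eq0 (negPf y1) orbF.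
    by rewrite r1 b1 mulr0 mul0r.
  apply: (mulIf y0).
  have -> : r 0 0 * b 1 0 * Y0 0 0 = (r 0 0 * Y0 0 0 + r 1 0 * Y0 1 0) * b 1 0 - r 1 0 * Y0 1 0 * b 1 0 by ring.
  have -> : r 1 0 * b 0 0 * Y0 0 0 = r 1 0 * (b 0 0 * Y0 0 0 + b 1 0 * Y0 1 0) - r 1 0 * Y0 1 0 * b 1 0 by ring.
  by rewrite rY bY mul0r mulr0.
apply/matrixP => i j; rewrite ord1 mxE; apply: (mulIf b0); rewrite mulrAC divfK //.
have l1 : lift ord0 ord0 = 1 :> 'I_2 by apply: val_inj.
rewrite /edot !big_ord_recl !big_ord0 !addr0 !l1.
case: (unliftP ord0 i) => [i'|] ->; rewrite ?(ord1 i') ?l1.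
  have -> : r 1 0 * (b 0 0 * b 0 0 + b 1 0 * b 1 0) = (r 1 0 * b 0 0) * b 0 0 + b 1 0 * r 1 0 * b 1 0 by ring.
  by rewrite -cross; ring.
have -> : r 0 0 * (b 0 0 * b 0 0 + b 1 0 * b 1 0) = b 0 0 * r 0 0 * b 0 0 + (r 0 0 * b 1 0) * b 1 0 by ring.
by rewrite cross; ring.
Qed.

Lemma leading_power (R : realType) (d : nat) (Sp : {fset 'cV[R]_d}) (Y0 X : 'cV[R]_d) (m : nat) :
  X != Y0 ->
  leading Sp (fun n A => (Num.sqrt A ^+ m)^-1 * binom_coef (m%:R / 2) n) Y0 X =
  (2 ^+ (2 * #|` roots_at Sp Y0|) * pochhammer (m%:R / 2) #|` roots_at Sp Y0| /
    root_prod (roots_at Sp Y0) (root_sum (roots_at Sp Y0))) /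
  enorm (X - Y0) ^+ (2 * #|` roots_at Sp Y0| + m).
Proof.
move=> XY; have e0 : enorm (X - Y0) != 0 by rewrite enorm_eq0 subr_eq0.
rewrite /leading -enorm_sq -binom_coef_pochhammer.
have -> : Num.sqrt (enorm (X - Y0) ^+ 2) = enorm (X - Y0) by rewrite enorm_sq.
set g := #|` _|; rewrite mul2n -addnn !exprD expr_div_n -exprM mul2n -addnn exprD.
have em : enorm (X - Y0) ^+ m != 0 by rewrite expf_neq0.
have eg : enorm (X - Y0) ^+ g != 0 by rewrite expf_neq0.
move: (root_prod _ _)^-1 (enorm (X - Y0) ^+ m) (enorm (X - Y0) ^+ g) em eg.
move: (g`!%:R : R) (binom_coef _ _) (2 ^+ g : R) => y1 y2 y3 y4 y5 y6 n5 n6.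
by field; rewrite n5 n6.
Qed.


Lemma enorm_neq0_dim (R : realType) (d : nat) (X : 'cV[R]_d) : enorm X != 0 -> (0 < d)%N.
Proof.
by case: d X => // X; rewrite /enorm /edot big_ord0 sqrtr0 eqxx.
Qed.

Lemma cvg_enorm_fst (R : realType) (d : nat) (X Y : 'cV[R]_d) :
  (1 - enorm z.1 ^+ 2) @[z --> nbhs (X, Y)] --> 1 - enorm X ^+ 2.
Proof.
apply: cvgB; first exact: cvg_cst.
by apply: cvg_pow; apply: (@cvg_enorm _ _ _ (nbhs (X, Y)) _ fst X); exact: cvg_fst.
Qed.

Lemma cancel_ball (R : realType) (r k w e x P q : R) :
  w != 0 -> e != 0 -> x != 0 -> P != 0 -> q != 0 ->
  x / w * r * k / (P / (w * q) * (x / e)) = r * k * e / (P / q).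
Proof. by move=> n1 n2 n3 n4 n5; field; rewrite n1 n2 n3 n4 n5. Qed.

Lemma cancel_newton (R : realType) (r k w e x P q : R) :
  w != 0 -> e != 0 -> x != 0 -> P != 0 -> q != 0 ->
  (x * w)^-1 * r * k / (P / (x * w * q) * (1 / e)) = r * k * e / (P / q).
Proof. by move=> n1 n2 n3 n4 n5; field; rewrite n1 n2 n3 n4 n5. Qed.

Lemma regroup (R : realType) (w r r1 r2 k : R) :
  w != 0 -> r != 0 -> r1 != 0 -> r2 != 0 ->
  r1 * r2 / (w * r) * k / r1 ^+ 2 = w^-1 * r2 ^+ 2 * (k / (r * (r1 * r2))).
Proof. by move=> n1 n2 n3 n4; field; rewrite n1 n2 n3 n4. Qed.

Theorem corollary5p7 (R : realType) (d : nat) (S Sp : {fset 'cV[R]_d})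
    (hS : root_system S) (hSp : positive_roots S Sp)
    (Y0 : 'cV[R]_d) (hY0 : closure (chamber Sp) Y0) :
  let Sp' := roots_at Sp Y0 in
  let gamma' := #|` Sp'| in
  let c' := root_prod Sp' (root_sum Sp') in
  [/\ enorm Y0 = 1 ->
      exists2 q : 'cV[R]_d -> R, PD_quotient S Sp Y0 q &
        asymp_equiv [set X | closure (chamber Sp) X /\ enorm X < 1] Y0 q
          (fun X => 2 ^+ (2 * gamma') * pochhammer (d%:R / 2) gamma' /
                      (sphere_area R d * c') *
                    ((1 - enorm X ^+ 2) / enorm (X - Y0) ^+ (2 * gamma' + d))),
      forall a b : 'cV[R]_d, d = 2%N ->
      a <> b ->
      (forall r, simple_root Sp r <-> (r = a \/ r = b)) ->
      edot a Y0 <> 0 -> edot b Y0 = 0 ->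
      exists2 q : 'cV[R]_d -> R, ND_quotient S Sp Y0 q &
        asymp_equiv [set X | closure (chamber Sp) X /\ X <> Y0] Y0 q
          (fun X => - (2 ^+ (2 * gamma' - 1) * (gamma' - 1)`!%:R) /
                      (2 * pi * edot b b) *
                    enorm (X - Y0) ^- 2)
    & (3 <= d)%N ->
      exists2 q : 'cV[R]_d -> R, ND_quotient S Sp Y0 q &
        asymp_equiv [set X | closure (chamber Sp) X /\ X <> Y0] Y0 q
          (fun X => 2 ^+ (2 * gamma') * pochhammer ((d%:R - 2) / 2) gamma' /
                      ((2 - d%:R) * sphere_area R d * c') *
                    (1 / enorm (X - Y0) ^+ (2 * gamma' + d - 2)))].

Proof.
move=> Sp' gamma' c'.
case: hSp => v [hv {}hSp].
have hS' := roots_at_system hS Y0.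
have hSp' := roots_at_positive hSp Y0.
have hv' a : a \in roots_at S Y0 -> edot a v != 0 by exact: roots_at_regular.
have c'0 : c' != 0 by have [_ [h _]] := weyl_pow_low hS' hv' hSp'; exact: h.
split.
- move=> Y1.
  have d0 : (0 < d)%N by apply: (@enorm_neq0_dim _ _ Y0); rewrite Y1 oner_eq0.
  have w0 := sphere_area_gt0 R d0.
  have hphi := expands_power R d0.
  have [k hk] := image_quotient_extension hS hv hSp hphi hY0.
  have XY X : enorm X < 1 -> X != Y0.
    by move=> X1; apply/eqP => E; move: X1; rewrite E Y1 ltxx.
  pose K : R := 2 ^+ (2 * gamma') * pochhammer (d%:R / 2) gamma' / c'.
  have K0 : K != 0.
    rewrite mulf_neq0 ?invr_eq0 // mulf_neq0 ?expf_neq0 //.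
    rewrite /pochhammer prodf_seq_neq0; apply/allP => i _.
    by rewrite gt_eqF // ltr_wpDr // divr_gt0 // ltr0n.
  have lim := ratio_limit hS hv hSp hphi hY0 hk (ltn_addl _ d0) K0
    (fun X XY => leading_power Sp d XY).
  exists (fun X => (1 - enorm X ^+ 2) / sphere_area R d * transverse_prod Sp Y0 Y0 ^+ 2 * k X).
    move=> X cX X1.
    apply: (kernel_quotient_limit (pre := fun X => (1 - enorm X ^+ 2) / sphere_area R d) hk).
    + exact: closure_dominant.
    + exact: XY.
    + by move=> z [c1 _ c2 _].
    + move=> z [c1 _ c2 _]; rewrite /PD (sum_weyl hS).
      have [p1 _ _] := chamber_neq0 Y0 c1; have [_ p2 q2] := chamber_neq0 Y0 c2.
      rewrite /image_quotient -/(alt_kernel (fun r => (Num.sqrt r ^+ d)^-1) (weyl_seq S) z.1 z.2).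
      rewrite (root_prod_split Sp Y0 z.2).
      move: (alt_kernel _ _ _ _) (1 - enorm z.1 ^+ 2) p1 p2 q2.
      move: (root_prod Sp z.1) (root_prod (roots_at Sp Y0) z.2) (transverse_prod Sp Y0 z.2).
      move=> y1 y2 y3 y4 y5 n1 n2 n3; field.
      by rewrite n1 n2 n3 gt_eqF.
    + by apply: cvgM; [exact: cvg_enorm_fst | exact: cvg_cst].
  apply: (ratio_within _ _ lim) => [X [cX X1]|X [cX X1]]; first by split => //; exact: XY.
  have e0 : enorm (X - Y0) ^+ (2 * gamma' + d) != 0.
    by rewrite expf_neq0 // enorm_eq0 subr_eq0 XY.
  have x0 : 1 - enorm X ^+ 2 != 0.
    by rewrite lt0r_neq0 // subr_gt0 exprn_ilt1 ?enorm_ge0.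
  have p0 : 2 ^+ (2 * gamma') * pochhammer (d%:R / 2) gamma' != 0 :> R.
    by move: K0; rewrite /K mulf_eq0 negb_or => /andP[].
  exact: (cancel_ball _ _ (lt0r_neq0 w0) e0 x0 p0 c'0).
- move=> a b d2 ab simple aY bY; subst d.
  have hphi := expands_log R.
  have [k hk] := image_quotient_extension hS hv hSp hphi hY0.
  have [bSp _] : simple_root Sp b by apply/simple; right.
  have Y00 : Y0 != 0 by apply: contra_not_neq aY => ->; rewrite edot0r.
  have b0 := pos_root_neq0 hS hSp bSp.
  have ESp' : Sp' = [fset b]%fset by apply: (roots_at_line hS hSp).
  have g1 : gamma' = 1%N by rewrite /gamma' ESp' cardfs1.
  have Ec' : c' = edot b b by rewrite /c' ESp' /root_prod /root_sum !big_seq_fset1.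
  have bb0 : edot b b != 0 by rewrite -Ec'.
  pose K : R := - 2 / edot b b.
  have K0 : K != 0 by rewrite mulf_neq0 ?invr_eq0 // oppr_eq0 pnatr_eq0.
  have lead X : X != Y0 -> leading Sp
      (fun n A => (n == 0%N)%:R * ln (Num.sqrt A) + log_coef R n / 2) Y0 X =
      K / enorm (X - Y0) ^+ 2.
    move=> XY; have e0 : enorm (X - Y0) != 0 by rewrite enorm_eq0 subr_eq0.
    rewrite /leading -/Sp' -/gamma' -/c' g1 Ec' -(enorm_sq (X - Y0)) /log_coef /K factS fact0 muln1.
    rewrite mul0r add0r expr1.
    by move: (enorm _) e0 (edot b b) bb0 => y1 n1 y2 n2; field; rewrite n1 n2.
  have lim := ratio_limit hS hv hSp hphi hY0 hk (isT : (0 < 2)%N) K0 lead.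
  have pi0 : (pi : R) != 0 by rewrite gt_eqF // pi_gt0.
  exists (fun X => (2 * pi)^-1 * transverse_prod Sp Y0 Y0 ^+ 2 * k X).
    move=> X cX /eqP XY.
    apply: (kernel_quotient_limit (pre := fun X => (2 * pi)^-1) hk) => //.
    + exact: closure_dominant.
    + by move=> z [c1 c2 _].
    + move=> z [c1 c2 _]; rewrite /ND /= (sum_weyl hS).
      have [p1 _ _] := chamber_neq0 Y0 c1; have [_ p2 q2] := chamber_neq0 Y0 c2.
      rewrite /image_quotient -/(alt_kernel (fun r => ln (Num.sqrt r)) (weyl_seq S) z.1 z.2).
      rewrite (root_prod_split Sp Y0 z.2).
      by apply: regroup => //; rewrite mulf_neq0 ?pnatr_eq0.
    + exact: cvg_cst.
  apply: (ratio_within _ _ lim) => [X [cX /eqP XY] //|X [cX /eqP XY]].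
  have e0 : enorm (X - Y0) != 0 by rewrite enorm_eq0 subr_eq0.
  rewrite /K g1 expr1 fact0; move: pi0 e0 bb0.
  move: (pi : R) (enorm (X - Y0)) (edot b b) (transverse_prod Sp Y0 Y0) (k X).
  move=> y1 y2 y3 y4 y5 n1 n2 n3; field.
  by rewrite n1 n2 n3.
- move=> d3.
  have d0 : (0 < d)%N by apply: leq_trans d3.
  have d20 : (0 < d - 2)%N by rewrite subn_gt0.
  have w0 := sphere_area_gt0 R d0.
  have hphi := expands_power R d20.
  have [k hk] := image_quotient_extension hS hv hSp hphi hY0.
  have Ed : (d - 2)%:R = d%:R - 2 :> R by rewrite natrB // ltnW.
  have dn0 : 2 - d%:R != 0 :> R.
    by rewrite -opprB oppr_eq0 -Ed pnatr_eq0 -lt0n.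
  pose K : R := 2 ^+ (2 * gamma') * pochhammer ((d%:R - 2) / 2) gamma' / c'.
  have K0 : K != 0.
    rewrite mulf_neq0 ?invr_eq0 // mulf_neq0 ?expf_neq0 //.
    rewrite /pochhammer prodf_seq_neq0; apply/allP => i _.
    by rewrite gt_eqF // ltr_wpDr // divr_gt0 // -Ed ltr0n.
  have lead X : X != Y0 -> leading Sp
      (fun n A => (Num.sqrt A ^+ (d - 2))^-1 * binom_coef ((d - 2)%:R / 2) n) Y0 X =
      K / enorm (X - Y0) ^+ (2 * gamma' + (d - 2)).
    by move=> XY; rewrite leading_power // -/gamma' -/Sp' -/c' /K -Ed.
  have lim := ratio_limit hS hv hSp hphi hY0 hk (ltn_addl _ d20) K0 lead.
  exists (fun X => ((2 - d%:R) * sphere_area R d)^-1 * transverse_prod Sp Y0 Y0 ^+ 2 * k X).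
    move=> X cX /eqP XY.
    apply: (kernel_quotient_limit (pre := fun X => ((2 - d%:R) * sphere_area R d)^-1) hk) => //.
    + exact: closure_dominant.
    + by move=> z [c1 c2 _].
    + move=> z [c1 c2 _]; rewrite /ND ifN ?(sum_weyl hS); last by rewrite gtn_eqF.
      have [p1 _ _] := chamber_neq0 Y0 c1; have [_ p2 q2] := chamber_neq0 Y0 c2.
      rewrite /image_quotient -/(alt_kernel (fun r => (Num.sqrt r ^+ (d - 2))^-1) (weyl_seq S) z.1 z.2).
      rewrite (root_prod_split Sp Y0 z.2).
      by apply: regroup => //; rewrite mulf_neq0 ?(lt0r_neq0 w0).
    + exact: cvg_cst.
  apply: (ratio_within _ _ lim) => [X [cX /eqP XY] //|X [cX /eqP XY]].
  have e0 : enorm (X - Y0) ^+ (2 * gamma' + (d - 2)) != 0.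
    by rewrite expf_neq0 // enorm_eq0 subr_eq0.
  have p0 : 2 ^+ (2 * gamma') * pochhammer ((d%:R - 2) / 2) gamma' != 0 :> R.
    by move: K0; rewrite /K mulf_eq0 negb_or => /andP[].
  rewrite /K -addnBA //; last by apply: leq_trans d3.
  exact: (cancel_newton _ _ (lt0r_neq0 w0) e0 dn0 p0 c'0).
Qed.
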